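(* Let $1<p<q$, let $\mathbf{M}:\mathbb{R}^3\to\mathbb{R}^{3\times 3}$ be a matrix-valued function, and let $\rho,\mu,v_p,v_q:\mathbb{R}^3\to(0,\infty)$ be radially symmetric $C^2$-functions satisfying $$v_p(x)=\left(\frac{\mu(x)^{q-p}}{v_q(x)^{1-p}}\right)^{\frac1{q-1}}\qquad\text{for all }x\in\mathbb{R}^3 .$$ Set $$\tau(x)=\left(\frac{\mu(x)}{v_q(x)}\right)^{\frac1{q-1}},\qquad \sigma(x)=\left(\frac{\mu(x)}{\rho(x)}\right)^{\frac12},\qquad T=2\pi\sigma(0).$$ Assume that: (H1) $\sigma(0)\sigma(x)<1$ for all $x\in\mathbb{R}^3\setminus\{0\}$; (H2) $|1-\sigma(0)\sigma(x)|^{\frac1{q-1}}\to0$ in the $C^2$-sense as $x\to0$; (H3) $\sup_{x\in\mathbb{R}^3}|1-\sigma(0)\sigma(x)|\,e^{\gamma(q-1)|x|}<\infty$ for some $\gamma>0$; (H4) $\sup_{x\in\mathbb{R}^3}\tau(x)<\infty$. Then there exists a $T$-periodic $\mathbb{R}^3$-valued breather solution $\mathbf{u}$ of $$\rho(x)\mathbf{u}_{tt}+\nabla\times(\mathbf{M}(x)\nabla\times\mathbf{u})+\mu(x)\mathbf{u}+v_p(x)|\mathbf{u}|^{p-1}\mathbf{u}+v_q(x)|\mathbf{u}|^{q-1}\mathbf{u}=0,\qquad (x,t)\in\mathbb{R}^3\times\mathbb{R},$$ with the extra property that $\sup_{(x,t)\in\mathbb{R}^3\times\mathbb{R}}|\mathbf{u}(x,t)|e^{\gamma|x|}<\infty$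 (with the $\gamma$ of (H3)). The breather solution $\mathbf{u}$ can generate a continuum of phase-shifted breathers $\mathbf{u}_b(x,t)=\mathbf{u}(x,t+b(x))$, where $b:\mathbb{R}^3\to\mathbb{R}$ is an arbitrary radially symmetric $C^2$-function.
   Context: A $T$-periodic breather (solution) of the equation is a classical solution $\mathbf{u}:\mathbb{R}^3\times\mathbb{R}\to\mathbb{R}^3$ that is $T$-periodic in time $t$ and spatially exponentially localized, i.e. $\sup_{\mathbb{R}^3\times\mathbb{R}}|\mathbf{u}(x,t)|e^{\gamma|x|}<\infty$ for some $\gamma>0$. The curl $\nabla\times$ acts in the variable $x\in\mathbb{R}^3$. The matrix function $\mathbf{M}$ is arbitrary. A function on $\mathbb{R}^3$ is radially symmetric if it depends only on $|x|$. A real-valued function $U$ satisfies $U(x)\to0$ in the $C^2$-sense as $x\to0$ if $U(x)\to0$, $\nabla U(x)\to0$ and $D^2U(x)\to0$ as $x\to0$. *)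

(* Defs.v *)
From HB Require Import structures.
From mathcomp Require Import all_boot all_order all_algebra.
From mathcomp Require Import all_classical all_reals all_analysis.

Set Implicit Arguments.
Unset Strict Implicit.
Unset Printing Implicit Defensive.

Import Order.TTheory GRing.Theory Num.Theory.
Import numFieldNormedType.Exports.

Local Open Scope classical_set_scope.
Local Open Scope ring_scope.

(* The library norm `|x| on 'cV[R]_3 is the max norm (it induces the usual
   topology); every |x| of the mathematics is the Euclidean norm below. *)
Definition enorm {R : realType} (x : 'cV[R]_3) : R :=
  Num.sqrt (\sum_(i < 3) x i ord0 ^+ 2).

Definition radial {R : realType} {A : Type} (f : 'cV[R]_3 -> A) : Prop :=
  forall x y, enorm x = enorm y -> f x = f y.

(* C^k on the whole space: all iterated directional derivatives of order at
   most k exist everywhere and are continuous.  It is used only for finite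
   dimensional V and W, where this is the usual notion; quantifying over all
   directions covers R^3 and R^3 x R uniformly. *)
Fixpoint Ck {R : realType} {V W : normedModType R} (k : nat) (f : V -> W)
    : Prop :=
  match k with
  | 0%N => continuous f
  | k'.+1 => continuous f /\
      forall v : V, (forall x, derivable f x v) /\ Ck k' ('D_v f)
  end.

Definition partial {R : realType} (i : 'I_3) (f : 'cV[R]_3 -> R)
    (x : 'cV[R]_3) : R :=
  'D_(delta_mx i ord0) f x.

(* U(x) -> 0, grad U(x) -> 0, D^2 U(x) -> 0 as x -> 0, x <> 0; the derivatives
   are required to exist near 0, as 'D_v has a default value otherwise. *)
Definition C2_vanishes_at0 {R : realType} (U : 'cV[R]_3 -> R) : Prop :=
  [/\ U x @[x --> (0 : 'cV[R]_3)^'] --> 0,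
      forall i, (\forall x \near (0 : 'cV[R]_3)^', derivable U x (delta_mx i ord0)) /\
        partial i U x @[x --> (0 : 'cV[R]_3)^'] --> 0
    & forall i j,
        (\forall x \near (0 : 'cV[R]_3)^', derivable (partial i U) x (delta_mx j ord0)) /\
        partial j (partial i U) x @[x --> (0 : 'cV[R]_3)^'] --> 0].

(* Indices are taken in the cyclic group 'I_3, so that the k-th entry is
   d_(k+1) F_(k+2) - d_(k+2) F_(k+1). *)
Definition curl {R : realType} (F : 'cV[R]_3 -> 'cV[R]_3) (x : 'cV[R]_3)
    : 'cV[R]_3 :=
  \col_(k < 3) (partial (k + 1) (fun y => F y (k + 1 + 1) ord0) x
                - partial (k + 1 + 1) (fun y => F y (k + 1) ord0) x).

Definition tau {R : realType} (q : R) (mu vq : 'cV[R]_3 -> R) (x : 'cV[R]_3)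
    : R :=
  (mu x / vq x) `^ (q - 1)^-1.

Definition sigma {R : realType} (rho mu : 'cV[R]_3 -> R) (x : 'cV[R]_3) : R :=
  (mu x / rho x) `^ 2^-1.

(* M is arbitrary, so M curl u need not inherit any smoothness from u; its
   being C^1 in x is part of being a classical solution, since its curl occurs
   in the equation. *)
Definition classical_solution {R : realType} (p q : R)
    (M : 'cV[R]_3 -> 'M[R]_3) (rho mu vp vq : 'cV[R]_3 -> R)
    (u : 'cV[R]_3 -> R -> 'cV[R]_3) : Prop :=
  [/\ Ck 2 (fun z : 'cV[R]_3 * R => u z.1 z.2),
      forall t, Ck 1 (fun x => M x *m curl (fun y => u y t) x)
    & forall x t,
        rho x *: derive1n 2 (u x) t
        + curl (fun y => M y *m curl (fun z => u z t) y) x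
        + mu x *: u x t
        + (vp x * enorm (u x t) `^ (p - 1)) *: u x t
        + (vq x * enorm (u x t) `^ (q - 1)) *: u x t = 0].

Definition exp_localized {R : realType} (gamma : R)
    (u : 'cV[R]_3 -> R -> 'cV[R]_3) : Prop :=
  has_ubound (range (fun z : 'cV[R]_3 * R =>
    enorm (u z.1 z.2) * expR (gamma * enorm z.1))).

Definition breather {R : realType} (T p q : R)
    (M : 'cV[R]_3 -> 'M[R]_3) (rho mu vp vq : 'cV[R]_3 -> R)
    (u : 'cV[R]_3 -> R -> 'cV[R]_3) : Prop :=
  [/\ classical_solution p q M rho mu vp vq u,
      forall x, periodic (u x) T
    & exists2 gamma, 0 < gamma & exp_localized gamma u].

Definition phase_shift {R : realType} (u : 'cV[R]_3 -> R -> 'cV[R]_3)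
    (b : 'cV[R]_3 -> R) : 'cV[R]_3 -> R -> 'cV[R]_3 :=
  fun x t => u x (t + b x).

(* The phase shifts of u form a continuum: some family of admissible shifts
   indexed by the reals produces pairwise distinct functions.  In particular u
   depends on time, which excludes u = 0. *)
Definition continuum_of_shifts {R : realType}
    (u : 'cV[R]_3 -> R -> 'cV[R]_3) : Prop :=
  exists b : R -> 'cV[R]_3 -> R,
    (forall s, radial (b s) /\ Ck 2 (b s)) /\
    injective (fun s => phase_shift u (b s)).

(* Main.v *)
Require Import Defs.
From HB Require Import structures.
From mathcomp Require Import all_boot all_order all_algebra.
From mathcomp Require Import all_classical all_reals all_analysis.
From mathcomp Require Import ring lra.
Import Order.TTheory GRing.Theory Num.Theory.
Import numFieldNormedType.Exports.
Local Open Scope classical_set_scope.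
Local Open Scope ring_scope.

(* Write u(x,t) = tau(x) y(|x|, sigma(x) t) x/|x|.  Such a field is curl-free, so M
   plays no role, and the equation becomes, at every x, the oscillator equation
   w'' + w + |w|^(p-1) w + |w|^(q-1) w = 0 for w = y(|x|, .).  Its periods decrease
   strictly with the amplitude, from 2 pi to 0, and the requirement that u be
   T-periodic says that w has period 2 pi sigma(0) sigma(x), which by (H1) is an
   admissible period; this determines the amplitude exp(h(|x|)).  In (H2) the
   limit at 0 forces sigma(0) = 1, hence T = 2 pi.
   In the phase-plane coordinates w = exp(eta) sin(theta), where exp(eta) is the maximum of w,
   the elapsed time is an integral of a positive function slow(eta,theta) over
   [0, theta].  Everything is then an implicit function of eta and theta, and
   2 pi - period is bounded below by a multiple of exp((p-1) eta); comparing
   logarithmic derivatives, (H2) yields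
   exp(h) h'^2 -> 0, exp(h) h'' -> 0 and exp(h)/s^2 -> 0 as s -> 0.  These rates
   are what is needed for u and its derivatives up to order two to vanish at
   x = 0, so that u is C^2 across the origin.  The decay of exp(h) is read off
   from the same lower bound and (H3). *)

Set Implicit Arguments.
Unset Strict Implicit.
Unset Printing Implicit Defensive.

(** * Derivatives along lines and mean value theorems *)

(** The energy law contains cos(theta)^2 (dtheta/dt)^2 on one side and differences of potentials
    that vanish at the turning points on the other. Dividing by cos(theta)^2 = 1 - sin(theta)^2
    leaves the divided differences [kap], which are positive and C^1 across sin(theta) = 1 and -1;
    so the elapsed time is a proper integral and no orbit is cut at its turning points. The
    amplitude is taken logarithmically because differentiating in eta reproduces the exponentials:
    [slow] and its eta derivatives stay bounded down to amplitude 0, and for eta <= 0 they are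
    compared with the single quantity [potX]. Integrated over a turn, this bounds the first two
    derivatives of the period by 2 pi - period, with no asymptotic expansion. Put m = 1 - sigma(0)
    sigma and U = m^(1/(q-1)). As U is nonnegative and C^2-small, U'^2 <= 4 U, which bounds U h'^2
    and U h''. The step from bounded to vanishing uses p < q: exp(h) is at most a multiple of
    m^(1/(p-1)), which is U times a positive power of m. *)

Notation dir1 R := ((1, 0) : (R * R)%type).
Notation dir2 R := ((0, 1) : (R * R)%type).

Lemma is_derive_line {R : realType} {V W : normedModType R} (f : V -> W)
    (z v : V) (h0 : R) (df : W) :
  is_derive (h0 *: v + z) v f df <->
  is_derive h0 1 (fun h : R => f (h *: v + z)) df.
Proof.
have E : (fun h : R => h^-1 *: ((f \o shift (h0 *: v + z)) (h *: v)
            - f (h0 *: v + z))) =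
   (fun h : R => h^-1 *: (((fun h : R => f (h *: v + z)) \o shift h0) (h *: 1)
            - f (h0 *: v + z))).
  by apply/funext => h /=; rewrite scalerDl [h *: 1]mulr1 addrA.
by split=> -[d1 d2]; split; move: d1 d2; rewrite /derivable /derive E.
Qed.

Lemma is_derive_line0 {R : realType} {V W : normedModType R} (f : V -> W)
    (z v : V) (df : W) :
  is_derive z v f df <-> is_derive (0 : R) 1 (fun h : R => f (h *: v + z)) df.
Proof. by rewrite -is_derive_line scale0r add0r. Qed.

Lemma is_derive_chain1 {R : realType} {V : normedModType R} (f : R -> R)
    (a : V -> R) (z v : V) (df da : R) :
  is_derive z v a da -> is_derive (a z) 1 f df ->
  is_derive z v (f \o a) (df * da).
Proof.
move=> /is_derive_line0 Da Df; apply/is_derive_line0.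
have := @is_derive1_comp R f (fun h => a (h *: v + z)) 0 df da.
by rewrite /= scale0r add0r => /(_ Df Da).
Qed.

Lemma cvg_line {R : realType} {V : normedModType R} (z v : V) :
  (h *: v + z) @[h --> (0 : R)] --> z.
Proof.
rewrite -[X in _ --> X](add0r z) -[X in _ --> X + _](scale0r v).
by apply: cvgD; [apply: cvgZr_tmp; exact: cvg_id|exact: cvg_cst].
Qed.

Lemma cvg_dnbhs {R : realType} {T : topologicalType} (f : R -> T) (x : R) (l : T) :
  f @ x --> l -> f @ x^' --> l.
Proof. exact: cvg_within_filter. Qed.

Lemma cvg_near_eq {T : Type} {U : topologicalType} {F : set_system T}
    {FF : Filter F} (f g : T -> U) (l : U) :
  (\forall x \near F, f x = g x) -> f @ F --> l -> g @ F --> l.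
Proof. by move=> fg; apply: cvg_trans; exact: near_eq_cvg. Qed.

Lemma derivable_cvg_line {R : realType} {V W : normedModType R} (f : V -> W)
    (z v : V) : derivable f z v -> f (h *: v + z) @[h --> (0 : R)] --> f z.
Proof.
move=> /derivable1P/derivable1_diffP/differentiable_continuous.
by rewrite /prop_for /continuous_at scale0r add0r.
Qed.

Lemma is_derive_continuous {R : realType} {W : normedModType R} (f : R -> W)
  (x : R) (df : W) : is_derive x 1 f df -> {for x, continuous f}.
Proof. by move=> [/derivable1_diffP/differentiable_continuous]. Qed.

Lemma mean_value {R : realType} (f df : R -> R) (a b : R) :
  (forall x, Num.min a b <= x <= Num.max a b -> is_derive x 1 f (df x)) ->
  exists2 c, Num.min a b <= c <= Num.max a b & f b - f a = df c * (b - a).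
Proof.
have H (x y : R) : x <= y ->
    (forall z, x <= z <= y -> is_derive z 1 f (df z)) ->
    exists2 c, x <= c <= y & f y - f x = df c * (y - x).
  move=> xy D.
  have D1 z : z \in `]x, y[ -> is_derive z 1 f (df z).
    by rewrite in_itv /= => /andP[/ltW az /ltW zb]; apply: D; rewrite az.
  have [|c] := MVT_segment xy D1; last by rewrite in_itv /= => cxy fE; exists c.
  apply: continuous_in_subspaceT => z; rewrite inE /= in_itv /= => zab.
  exact: is_derive_continuous (D z zab).
case: (leP a b) => [ab|/ltW ba] D; first exact: H.
have [c cab fE] := H _ _ ba D; exists c => //.
by rewrite -(opprB (f a)) fE; ring.
Qed.

Lemma scale_pairD {R : realType} (x a b c d : R) :
  x *: ((a, b) : (R * R)%type) + (c, d) = (x * a + c, x * b + d).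
Proof. by []. Qed.

(* The difference quotients of f in each coordinate, with the partial
   derivative as the value at coinciding arguments. *)
Lemma hadamard2 {R : realType} (f f1 f2 : R * R -> R) (p0 : R * R) :
  (\forall p \near p0, is_derive p (dir1 R) f (f1 p)) ->
  (\forall p \near p0, is_derive p (dir2 R) f (f2 p)) ->
  {for p0, continuous f1} -> {for p0, continuous f2} ->
  exists m1 m2 : R * R -> R,
    [/\ m1 @ p0 --> f1 p0, m2 @ p0 --> f2 p0 &
      forall p, f p - f p0 = m1 p * (p.1 - p0.1) + m2 p * (p.2 - p0.2)].
Proof.
case: p0 => a b D1 D2 c1 c2.
(* The increment from (a, b) to (x, y) passes through the corner (a, y); hence the second quotient
   is taken on the line with first coordinate [a]. *)
exists (fun p => if p.1 == a then f1 (a, b)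
                 else (f p - f (a, p.2)) / (p.1 - a)).
exists (fun p => if p.2 == b then f2 (a, b)
                 else (f (a, p.2) - f (a, b)) / (p.2 - b)).
have L1 (c y x : R) : is_derive (x, y) (dir1 R) f c ->
    is_derive x 1 (fun h => f (h, y)) c.
  have -> : (x, y) = x *: dir1 R + (0, y).
    by rewrite scale_pairD mulr1 mulr0 addr0 add0r.
  move/is_derive_line; congr is_derive; apply/funext => h; congr f.
  by rewrite scale_pairD mulr1 mulr0 addr0 add0r.
have L2 (c y x : R) : is_derive (x, y) (dir2 R) f c ->
    is_derive y 1 (fun h => f (x, h)) c.
  have -> : (x, y) = y *: dir2 R + (x, 0).
    by rewrite scale_pairD mulr1 mulr0 addr0 add0r.
  move/is_derive_line; congr is_derive; apply/funext => h; congr f.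
  by rewrite scale_pairD mulr1 mulr0 addr0 add0r.
have between (x y z e : R) : Num.min x y <= z <= Num.max x y ->
    ball x e y -> ball x e z.
  rewrite -!ball_normE /=.
  by case: (leP x y) => xy /andP[h1 h2]; rewrite !ltr_norml => /andP[h3 h4];
    apply/andP; split; lra.
split=> /=.
- apply/cvgrPdist_lt => e e0.
  have := c1; move/cvgrPdist_lt => /(_ e e0) c1e.
  have : nbhs (a, b) (fun p => is_derive p (dir1 R) f (f1 p) /\
      `|f1 (a, b) - f1 p| < e) by exact: filterI.
  move=> [[A B] [/= /nbhs_ballP [r /= r0 rA] /nbhs_ballP [s /= s0 sB]] AB].
  exists (ball a r, ball b s); first by split; exact: nbhsx_ballx.
  have H p : ball a r p.1 -> ball b s p.2 -> _ := fun h1 h2 => AB p (conj (rA _ h1) (sB _ h2)).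
  move=> [x y] [/= xa yb]; case: eqP => [_|/eqP xa0].
    by rewrite subrr normr0.
  have [|c cab /= ->] := @mean_value R (fun h => f (h, y)) (fun h => f1 (h, y)) a x.
    move=> z zax; apply: L1; apply: (H (z, y) _ _).1 => //=.
    exact: between zax xa.
  rewrite mulfK ?subr_eq0//; apply: (H (c, y) _ _).2 => //=.
  exact: between cab xa.
- apply/cvgrPdist_lt => e e0.
  have := c2; move/cvgrPdist_lt => /(_ e e0) c1e.
  have : nbhs (a, b) (fun p => is_derive p (dir2 R) f (f2 p) /\
      `|f2 (a, b) - f2 p| < e) by exact: filterI.
  move=> [[A B] [/= /nbhs_ballP [r /= r0 rA] /nbhs_ballP [s /= s0 sB]] AB].
  exists (ball a r, ball b s); first by split; exact: nbhsx_ballx.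
  have H p : ball a r p.1 -> ball b s p.2 -> _ := fun h1 h2 => AB p (conj (rA _ h1) (sB _ h2)).
  move=> [x y] [/= xa yb]; case: eqP => [_|/eqP xa0].
    by rewrite subrr normr0.
  have [|c cab /= ->] := @mean_value R (fun h => f (a, h)) (fun h => f2 (a, h)) b y.
    move=> z zax; apply: L2; apply: (H (a, z) _ _).1 => /=.
      exact: ballxx.
    exact: between zax yb.
  rewrite mulfK ?subr_eq0//; apply: (H (a, c) _ _).2 => //=.
    exact: ballxx.
  exact: between cab yb.
- move=> [x y] /=; case: eqP => [->|/eqP xa]; case: eqP => [->|/eqP yb].
  + by rewrite !subrr !mulr0 addr0.
  + by rewrite subrr mulr0 add0r divfK// subr_eq0.
  + by rewrite subrr mulr0 addr0 divfK// subr_eq0.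
  + by rewrite !divfK ?subr_eq0//; ring.
Qed.

(** In the Hadamard form the difference quotient of the composite is a sum of products of convergent
    factors. Only derivatives along the one direction [v] occur, in accordance with the directional
    definition of [Ck]. *)
Lemma is_derive_chain2 {R : realType} {V : normedModType R}
    (f f1 f2 : R * R -> R) (a b : V -> R) (z v : V) (da db : R) :
  (\forall p \near (a z, b z), is_derive p (dir1 R) f (f1 p)) ->
  (\forall p \near (a z, b z), is_derive p (dir2 R) f (f2 p)) ->
  {for (a z, b z), continuous f1} -> {for (a z, b z), continuous f2} ->
  is_derive z v a da -> is_derive z v b db ->
  is_derive z v (fun x => f (a x, b x)) (f1 (a z, b z) * da + f2 (a z, b z) * db).
Proof.
move=> D1 D2 c1 c2 [Da daE] [Db dbE].
have [m1 [m2 [M1 M2 fE]]] := hadamard2 D1 D2 c1 c2.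
have ca := cvg_dnbhs (derivable_cvg_line Da).
have cb := cvg_dnbhs (derivable_cvg_line Db).
have cab : (a (h *: v + z), b (h *: v + z)) @[h --> 0^'] --> (a z, b z).
  exact: (cvg_pair ca cb).
have M1' := cvg_comp _ _ cab M1; have M2' := cvg_comp _ _ cab M2.
have Ca : (h^-1 *: (a (h *: v + z) - a z)) @[h --> 0^'] --> da.
  by rewrite -daE; exact: Da.
have Cb : (h^-1 *: (b (h *: v + z) - b z)) @[h --> 0^'] --> db.
  by rewrite -dbE; exact: Db.
have C : (h^-1 *: (f (a (h *: v + z), b (h *: v + z)) - f (a z, b z))) @[h --> 0^']
    --> f1 (a z, b z) * da + f2 (a z, b z) * db.
  apply: (cvg_near_eq _ (cvgD (cvgM M1' Ca) (cvgM M2' Cb))); near=> h => /=.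
  by rewrite !fctE fE /GRing.scale /=; ring.
split; first by apply/cvg_ex; exists (f1 (a z, b z) * da + f2 (a z, b z) * db).
exact/cvg_lim.
Unshelve. all: by end_near. Qed.

(** The Hadamard form of the constraint is linear in the increment of [b] and can be solved for it:
    the factor [m2] tends to the nonzero value of [f2]. Continuity of [b] is what makes [m1] and
    [m2] converge. *)
Lemma is_derive_implicit {R : realType} {V : normedModType R}
    (f f1 f2 : R * R -> R) (a b c : V -> R) (z v : V) (da dc : R) :
  (\forall p \near (a z, b z), is_derive p (dir1 R) f (f1 p)) ->
  (\forall p \near (a z, b z), is_derive p (dir2 R) f (f2 p)) ->
  {for (a z, b z), continuous f1} -> {for (a z, b z), continuous f2} ->
  is_derive z v a da -> is_derive z v c dc -> {for z, continuous b} ->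
  f2 (a z, b z) != 0 ->
  (\forall x \near z, f (a x, b x) = c x) ->
  is_derive z v b ((dc - f1 (a z, b z) * da) / f2 (a z, b z)).
Proof.
move=> D1 D2 c1 c2 [Da daE] [Dc dcE] cb f2n0 fc.
have [m1 [m2 [M1 M2 fE]]] := hadamard2 D1 D2 c1 c2.
have cl := cvg_dnbhs (@cvg_line R V z v).
have ca := cvg_dnbhs (derivable_cvg_line Da).
have cb' := cvg_comp _ _ cl cb.
have cab : (a (h *: v + z), b (h *: v + z)) @[h --> 0^'] --> (a z, b z).
  exact: (cvg_pair ca cb').
have M1' := cvg_comp _ _ cab M1; have M2' := cvg_comp _ _ cab M2.
have Ca : (h^-1 *: (a (h *: v + z) - a z)) @[h --> 0^'] --> da.
  by rewrite -daE; exact: Da.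
have Cc : (h^-1 *: (c (h *: v + z) - c z)) @[h --> 0^'] --> dc.
  by rewrite -dcE; exact: Dc.
have C : (h^-1 *: (b (h *: v + z) - b z)) @[h --> 0^']
    --> (dc - f1 (a z, b z) * da) / f2 (a z, b z).
  apply: (cvg_near_eq _ (cvgM (cvgB Cc (cvgM M1' Ca)) (cvgV f2n0 M2'))); near=> h => /=.
  have E : f (a (h *: v + z), b (h *: v + z)) = c (h *: v + z).
    by near: h; exact: cl _ fc.
  have H := fE (a (h *: v + z), b (h *: v + z)).
  rewrite E (nbhs_singleton fc) /= in H.
  have m0 : m2 (a (h *: v + z), b (h *: v + z)) != 0.
    by near: h; exact: (cvgr_neq0 _ M2' f2n0).
  rewrite !fctE H /GRing.scale /=; field.
  by rewrite m0 andbT; near: h; exact: nbhs_dnbhs_neq.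
split; first by apply/cvg_ex; exists ((dc - f1 (a z, b z) * da) / f2 (a z, b z)).
exact/cvg_lim.
Unshelve. all: by end_near. Qed.

(** * C^k functions on open sets *)

(** The recursion of [Ck] relative to [A], since the amplitude and |x| are smooth only away from the
    origin. It is meant for open [A], where ['D_v f] on [A] depends on [f] on [A] alone, whatever
    default values it takes elsewhere. *)
Fixpoint Ckon {R : realType} {V W : normedModType R} (k : nat) (A : set V)
    (f : V -> W) : Prop :=
  match k with
  | 0%N => forall x, A x -> {for x, continuous f}
  | k'.+1 => (forall x, A x -> {for x, continuous f}) /\
      forall v : V, (forall x, A x -> derivable f x v) /\ Ckon k' A ('D_v f)
  end.

Lemma Ckon_setT {R : realType} {V W : normedModType R} k (f : V -> W) :
  Ckon k setT f <-> Ck k f.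
Proof.
elim: k f => [|k IH] f /=; first by split=> [H x|H x _]; exact: H.
split=> -[c d]; split.
- by move=> x; exact: c.
- by move=> v; have [d1 d2] := d v; split=> [x|]; [exact: d1|exact/IH].
- by move=> x _; exact: c.
- by move=> v; have [d1 d2] := d v; split=> [x _|]; [exact: d1|exact/IH].
Qed.

Lemma Ckon_cont {R : realType} {V W : normedModType R} k (A : set V) (f : V -> W) x :
  Ckon k A f -> A x -> {for x, continuous f}.
Proof. by case: k => [|k] /=; [|case]; move=> H; [exact: H|move=> _; exact: H]. Qed.

Lemma Ckon_is_derive {R : realType} {V W : normedModType R} k (A : set V)
    (f : V -> W) v x : Ckon k.+1 A f -> A x -> is_derive x v f ('D_v f x).
Proof. by move=> [_ /(_ v)[d _]] Ax; apply/derivableP/d. Qed.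

Lemma Ckon_D {R : realType} {V W : normedModType R} k (A : set V)
    (f : V -> W) v : Ckon k.+1 A f -> Ckon k A ('D_v f).
Proof. by move=> [_ /(_ v)[]]. Qed.

Lemma CkonW {R : realType} {V W : normedModType R} k (A : set V) (f : V -> W) :
  Ckon k.+1 A f -> Ckon k A f.
Proof.
elim: k f => [|k IH] f; first by case.
move=> [c d]; split=> // v; have [d1 d2] := d v; split=> //; exact: IH.
Qed.

Lemma Ckon_sub {R : realType} {V W : normedModType R} k (A B : set V) (f : V -> W) :
  A `<=` B -> Ckon k B f -> Ckon k A f.
Proof.
move=> AB; elim: k f => [|k IH] f /=; first by move=> H x /AB; exact: H.
move=> [c d]; split; first by move=> x /AB; exact: c.
by move=> v; have [d1 d2] := d v; split; [move=> x /AB; exact: d1|exact: IH].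
Qed.

Lemma Ckon_setU {R : realType} {V W : normedModType R} k (A B : set V) (f : V -> W) :
  Ckon k A f -> Ckon k B f -> Ckon k (A `|` B) f.
Proof.
elim: k f => [|k IH] f /=; first by move=> H K x []; [exact: H|exact: K].
move=> [c d] [c' d']; split; first by move=> x []; [exact: c|exact: c'].
move=> v; have [d1 d2] := d v; have [e1 e2] := d' v.
by split; [move=> x []; [exact: d1|exact: e1]|exact: IH].
Qed.

Lemma continuous_near_eq {R : realType} {V W : normedModType R} (f g : V -> W) x :
  (\forall y \near x, f y = g y) -> {for x, continuous f} -> {for x, continuous g}.
Proof.
move=> fg; rewrite /prop_for /continuous_at -(nbhs_singleton fg).
exact: cvg_near_eq.
Qed.

Lemma Ckon_eq {R : realType} {V W : normedModType R} k (A : set V) (f g : V -> W) :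
  open A -> (forall x, A x -> f x = g x) -> Ckon k A f -> Ckon k A g.
Proof.
move=> oA; elim: k f g => [|k IH] f g fg /=.
  move=> H x Ax; apply: continuous_near_eq (H x Ax).
  by apply: filterS (open_nbhs_nbhs (conj oA Ax)) => y; exact: fg.
have nfg x : A x -> \forall y \near x, f y = g y.
  by move=> Ax; apply: filterS (open_nbhs_nbhs (conj oA Ax)) => y; exact: fg.
move=> [c d]; split.
  by move=> x Ax; apply: continuous_near_eq (c x Ax); exact: nfg.
move=> v; have [d1 d2] := d v; split.
  by move=> x Ax; apply: near_eq_derivable (d1 x Ax); exact: nfg.
by apply: IH d2 => x Ax; apply: near_eq_derive; exact: nfg.
Qed.

(** Lets an explicit formula stand for ['D_v f] in the recursion, so that inductions on [k] can work
    with formulas. *)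
Lemma Ckon_intro {R : realType} {V W : normedModType R} k (A : set V)
    (f : V -> W) (df : V -> V -> W) :
  open A -> (forall x, A x -> {for x, continuous f}) ->
  (forall v x, A x -> is_derive x v f (df v x)) ->
  (forall v, Ckon k A (df v)) -> Ckon k.+1 A f.
Proof.
move=> oA c d Cd; split=> // v; split=> [x /(d v)[]//|].
by apply: (Ckon_eq oA _ (Cd v)) => x /(d v)[].
Qed.

Lemma Ckon_cst {R : realType} {V W : normedModType R} k (A : set V) (c : W) :
  Ckon k A (fun _ : V => c).
Proof.
apply: (@Ckon_sub _ _ _ _ _ setT) => //.
elim: k c => [|k IH] c; first by move=> x _; exact: cst_continuous.
apply: (@Ckon_intro _ _ _ _ _ _ (fun _ _ => 0)) => //.
- exact: openT.
- by move=> x _; exact: cst_continuous.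
Qed.

Lemma Ckon_add {R : realType} {V W : normedModType R} k (A : set V) (f g : V -> W) :
  open A -> Ckon k A f -> Ckon k A g -> Ckon k A (fun x => f x + g x).
Proof.
move=> oA; elim: k f g => [|k IH] f g F G.
  by move=> x Ax; apply: continuousD; [exact: F|exact: G].
apply: (@Ckon_intro _ _ _ _ _ _ (fun v x => 'D_v f x + 'D_v g x)) => //.
- by move=> x Ax; apply: continuousD; [exact: Ckon_cont F Ax|exact: Ckon_cont G Ax].
- move=> v x Ax; apply: (@is_deriveD _ _ _ f g);
    [exact: (Ckon_is_derive v F Ax)|exact: (Ckon_is_derive v G Ax)].
- by move=> v; apply: IH; exact: Ckon_D.
Qed.

Lemma Ckon_mul {R : realType} {V : normedModType R} k (A : set V) (f g : V -> R) :
  open A -> Ckon k A f -> Ckon k A g -> Ckon k A (fun x => f x * g x).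
Proof.
move=> oA; elim: k f g => [|k IH] f g F G.
  by move=> x Ax; apply: continuousM; [exact: F|exact: G].
apply: (@Ckon_intro _ _ _ _ _ _ (fun v x => f x * 'D_v g x + g x * 'D_v f x)) => //.
- by move=> x Ax; apply: continuousM; [exact: Ckon_cont F Ax|exact: Ckon_cont G Ax].
- move=> v x Ax; apply: (@is_deriveM _ _ f g);
    [exact: (Ckon_is_derive v F Ax)|exact: (Ckon_is_derive v G Ax)].
- move=> v; apply: Ckon_add => //; apply: IH; try exact: Ckon_D; exact: CkonW.
Qed.

Lemma Ckon_opp {R : realType} {V : normedModType R} k (A : set V) (f : V -> R) :
  open A -> Ckon k A f -> Ckon k A (fun x => - f x).
Proof.
move=> oA F; apply: (Ckon_eq oA _ (Ckon_mul oA (Ckon_cst k A (-1 : R)) F)).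
by move=> x _; rewrite mulN1r.
Qed.

Lemma Ckon_sub_fun {R : realType} {V : normedModType R} k (A : set V) (f g : V -> R) :
  open A -> Ckon k A f -> Ckon k A g -> Ckon k A (fun x => f x - g x).
Proof. by move=> oA F G; apply: Ckon_add => //; exact: Ckon_opp. Qed.

Lemma is_derive_scalel {R : realType} {V W : normedModType R} (f : V -> R) (w : W)
   z v df : is_derive z v f df -> is_derive z v (fun x => f x *: w) (df *: w).
Proof.
move=> [d dE].
have C : (h^-1 *: (f (h *: v + z) *: w - f z *: w)) @[h --> 0^'] --> df *: w.
  have E : (h^-1 *: (f (h *: v + z) - f z)) *: w @[h --> 0^'] --> df *: w.
    by apply: cvgZr_tmp; rewrite -dE; exact: d.
  apply: (cvg_near_eq _ E); near=> h.
  by rewrite -scalerA scalerBl.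
split; first exact: cvgP C.
exact/cvg_lim.
Unshelve. all: by end_near. Qed.

Lemma Ckon_scalel {R : realType} {V W : normedModType R} k (A : set V) (f : V -> R)
    (w : W) : open A -> Ckon k A f -> Ckon k A (fun x => f x *: w).
Proof.
move=> oA; elim: k f => [|k IH] f F.
  by move=> x Ax; apply: cvgZr_tmp; exact: F.
apply: (@Ckon_intro _ _ _ _ _ _ (fun v x => 'D_v f x *: w)) => //.
- by move=> x Ax; apply: cvgZr_tmp; exact: Ckon_cont F Ax.
- by move=> v x Ax; apply: is_derive_scalel; exact: (Ckon_is_derive v F Ax).
- by move=> v; apply: IH; exact: Ckon_D.
Qed.

Lemma is_derive_affine {R : realType} {U V W : normedModType R} (f : V -> W)
    (a l : U -> V) (z u : U) df :
  (forall h z, a (h *: u + z) = h *: l u + a z) ->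
  is_derive (a z) (l u) f df -> is_derive z u (f \o a) df.
Proof.
move=> aE /is_derive_line0 D; apply/is_derive_line0.
by move: D; congr is_derive; apply/funext => h /=; rewrite aE.
Qed.

Lemma Ckon_affine {R : realType} {U V W : normedModType R} k (B : set V)
    (f : V -> W) (a l : U -> V) :
  open B -> continuous a -> (forall u h z, a (h *: u + z) = h *: l u + a z) ->
  Ckon k B f -> Ckon k (a @^-1` B) (f \o a).
Proof.
move=> oB ca aE; have oA : open (a @^-1` B) by apply: open_comp => // x _; exact: ca.
elim: k f => [|k IH] f F.
  by move=> x Ax; apply: continuous_comp; [exact: ca|exact: F].
apply: (@Ckon_intro _ _ _ _ _ _ (fun u => 'D_(l u) f \o a)) => //.
- by move=> x Ax; apply: continuous_comp; [exact: ca|exact: Ckon_cont F Ax].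
- move=> u x Ax; apply: (is_derive_affine (aE u)); exact: Ckon_is_derive F Ax.
- by move=> u; apply: IH; exact: Ckon_D.
Qed.

Lemma Ckon_linear {R : realType} {V : normedModType R} k (A : set V) (f : V -> R) :
  open A -> continuous f -> (forall h v z, f (h *: v + z) = h * f v + f z) ->
  Ckon k A f.
Proof.
move=> oA cf fE; case: k => [|k]; first by move=> x _; exact: cf.
apply: (@Ckon_intro _ _ _ _ _ _ (fun v x => f v)) => //.
- by move=> x _; exact: cf.
- move=> v x _; apply: (@is_derive_affine R V R R id f f x v (f v)) => //.
- by move=> v; exact: Ckon_cst.
Qed.

Lemma Ckon_comp1 {R : realType} {V : normedModType R} k (A : set V) (B : set R)
    (f : R -> R) (a : V -> R) :
  open A -> Ckon k B f -> Ckon k A a -> (forall x, A x -> B (a x)) ->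
  Ckon k A (f \o a).
Proof.
move=> oA + + AB; elim: k f a AB => [|k IH] f a AB F G.
  by move=> x Ax; apply: continuous_comp; [exact: G|apply: F; exact: AB].
apply: (@Ckon_intro _ _ _ _ _ _ (fun v x => 'D_1 f (a x) * 'D_v a x)) => //.
- move=> x Ax; apply: continuous_comp; first exact: Ckon_cont G Ax.
  by apply: (Ckon_cont F); exact: AB.
- move=> v x Ax; apply: is_derive_chain1; first exact: Ckon_is_derive G Ax.
  exact: (@Ckon_is_derive R R R k B f (1 : R) (a x) F (AB _ Ax)).
- move=> v; apply: Ckon_mul => //; last exact: Ckon_D.
  by apply: (IH ('D_1 f)) => //; [exact: Ckon_D|exact: CkonW].
Qed.

Lemma Ckon_chain2 {R : realType} {V : normedModType R} k (A : set V) (B : set (R * R))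
    (f : R * R -> R) (a b : V -> R) z v da db :
  open B -> Ckon k.+1 B f -> B (a z, b z) ->
  is_derive z v a da -> is_derive z v b db ->
  is_derive z v (fun x => f (a x, b x))
    ('D_(dir1 R) f (a z, b z) * da + 'D_(dir2 R) f (a z, b z) * db).
Proof.
move=> oB F Bz Da Db; have nB := open_nbhs_nbhs (conj oB Bz).
apply: (@is_derive_chain2 R V f ('D_(dir1 R) f) ('D_(dir2 R) f)) => //.
- by apply: filterS nB => p Bp; exact: Ckon_is_derive F Bp.
- by apply: filterS nB => p Bp; exact: Ckon_is_derive F Bp.
- exact: Ckon_cont (Ckon_D _ F) Bz.
- exact: Ckon_cont (Ckon_D _ F) Bz.
Qed.

Lemma continuous_pair {R : realType} {V U W : normedModType R} (a : V -> U)
  (b : V -> W) z : {for z, continuous a} -> {for z, continuous b} ->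
  {for z, continuous (fun x => (a x, b x))}.
Proof. exact: cvg_pair. Qed.

Lemma Ckon_comp2 {R : realType} {V : normedModType R} k (A : set V) (B : set (R * R))
    (f : R * R -> R) (a b : V -> R) :
  open A -> open B -> Ckon k B f -> Ckon k A a -> Ckon k A b ->
  (forall x, A x -> B (a x, b x)) ->
  Ckon k A (fun x => f (a x, b x)).
Proof.
move=> oA oB + + + AB; elim: k f a b AB => [|k IH] f a b AB F G H.
  move=> x Ax; apply: (@continuous_comp _ _ _ (fun x => (a x, b x)) f).
    by apply: continuous_pair; [exact: G|exact: H].
  by apply: F; exact: AB.
apply: (@Ckon_intro _ _ _ _ _ _ (fun v x => 'D_(dir1 R) f (a x, b x) * 'D_v a x +
          'D_(dir2 R) f (a x, b x) * 'D_v b x)) => //.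
- move=> x Ax; apply: (@continuous_comp _ _ _ (fun x => (a x, b x)) f).
    by apply: continuous_pair; [exact: Ckon_cont G Ax|exact: Ckon_cont H Ax].
  by apply: (Ckon_cont F); exact: AB.
- move=> v x Ax; apply: (Ckon_chain2 A oB F (AB _ Ax)).
    exact: Ckon_is_derive G Ax.
  exact: Ckon_is_derive H Ax.
- have Ga := CkonW G; have Hb := CkonW H.
  move=> v; apply: (Ckon_add oA); apply: (Ckon_mul oA).
  + by apply: (IH ('D_(dir1 R) f)) => //; exact: Ckon_D.
  + exact: Ckon_D G.
  + by apply: (IH ('D_(dir2 R) f)) => //; exact: Ckon_D.
  + exact: Ckon_D H.
Qed.

(** All directional derivatives come from the two partials by the chain rule, with [f] composed with
    the two coordinate projections. *)
Lemma Ckon_partials {R : realType} k (B : set (R * R)) (f f1 f2 : R * R -> R) :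
  open B -> (forall p, B p -> is_derive p (dir1 R) f (f1 p)) ->
  (forall p, B p -> is_derive p (dir2 R) f (f2 p)) ->
  (forall p, B p -> {for p, continuous f}) ->
  Ckon k B f1 -> Ckon k B f2 -> Ckon k.+1 B f.
Proof.
move=> oB D1 D2 cf F1 F2.
apply: (@Ckon_intro _ _ _ _ _ _ (fun v p => f1 p * v.1 + f2 p * v.2)) => //.
- move=> v p Bp; have nB := open_nbhs_nbhs (conj oB Bp).
  have := @is_derive_chain2 R (R * R)%type f f1 f2 fst snd p v v.1 v.2.
  case: p Bp nB => a b Bp nB /=.
  have -> : (fun x => f (x.1, x.2)) = f by apply/funext => -[].
  apply.
  + by apply: filterS nB => p Bp'; exact: D1.
  + by apply: filterS nB => p Bp'; exact: D2.
  + exact: Ckon_cont F1 Bp.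
  + exact: Ckon_cont F2 Bp.
  + by apply: (@is_derive_affine R (R * R)%type R R id fst fst).
  + by apply: (@is_derive_affine R (R * R)%type R R id snd snd).
- by move=> v; apply: Ckon_add => //; apply: Ckon_mul => //; exact: Ckon_cst.
Qed.

Lemma Ckon_inv {R : realType} {V : normedModType R} k (A : set V) (f : V -> R) :
  open A -> (forall x, A x -> f x != 0) -> Ckon k A f ->
  Ckon k A (fun x => (f x)^-1).
Proof.
move=> oA f0; elim: k => [|k IH] F.
  by move=> x Ax; apply: cvgV; [exact: f0|exact: F].
have G := IH (CkonW F).
apply: (@Ckon_intro _ _ _ _ _ _ (fun v x => - ((f x)^-1 * (f x)^-1 * 'D_v f x))) => //.
- by move=> x Ax; apply: cvgV; [exact: f0|exact: Ckon_cont F Ax].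
- move=> v x Ax; have [d _] := Ckon_is_derive v F Ax; split.
    exact: derivableV (f0 _ Ax) d.
  by rewrite deriveV ?f0// /GRing.scale /= expr2 invfM mulNr.
- move=> v; apply: Ckon_opp => //; apply: Ckon_mul => //; last exact: Ckon_D.
  exact: Ckon_mul.
Qed.

(** A bootstrap: the derivative of [b] contains [b] only through partials of [f] at [(a, b)]. If [b]
    is C^k, its derivative is C^k, hence [b] is C^(k+1). The start of the induction is the assumed
    continuity of [b]. *)
Lemma Ckon_implicit {R : realType} {V : normedModType R} k (A : set V)
    (B : set (R * R)) (f : R * R -> R) (a b c : V -> R) :
  open A -> open B -> Ckon k B f -> Ckon k A a -> Ckon k A c ->
  (forall x, A x -> {for x, continuous b}) ->
  (forall x, A x -> B (a x, b x)) ->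
  (forall x, A x -> f (a x, b x) = c x) ->
  (forall p, B p -> 'D_(dir2 R) f p != 0) ->
  Ckon k A b /\ ((0 < k)%N -> forall x v, A x -> is_derive x v b
     (('D_v c x - 'D_(dir1 R) f (a x, b x) * 'D_v a x) / 'D_(dir2 R) f (a x, b x))).
Proof.
move=> oA oB + + + cb AB fc f2.
elim: k => [|k IH] F G H //.
have [Cb _] := IH (CkonW F) (CkonW G) (CkonW H).
have D v x : A x -> is_derive x v b (('D_v c x - 'D_(dir1 R) f (a x, b x) * 'D_v a x)
    / 'D_(dir2 R) f (a x, b x)).
  move=> Ax; have nB := open_nbhs_nbhs (conj oB (AB _ Ax)).
  have nA := open_nbhs_nbhs (conj oA Ax).
  apply: (@is_derive_implicit R V f ('D_(dir1 R) f) ('D_(dir2 R) f) a b c).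
  - by apply: filterS nB => p Bp; exact: Ckon_is_derive F Bp.
  - by apply: filterS nB => p Bp; exact: Ckon_is_derive F Bp.
  - exact: Ckon_cont (Ckon_D _ F) (AB _ Ax).
  - exact: Ckon_cont (Ckon_D _ F) (AB _ Ax).
  - exact: Ckon_is_derive G Ax.
  - exact: Ckon_is_derive H Ax.
  - exact: cb.
  - exact/f2/AB.
  - by apply: filterS nA => y; exact: fc.
split=> [|_ x v]; last exact: D.
apply: (Ckon_intro oA cb D) => v.
apply: Ckon_mul => //; first apply: Ckon_sub_fun => //; first exact: Ckon_D.
- apply: Ckon_mul => //; last exact: Ckon_D.
  apply: (@Ckon_comp2 _ _ _ _ B ('D_(dir1 R) f)) => //; last exact: CkonW.
  exact: Ckon_D.
- apply: Ckon_inv => //; first by move=> x Ax; exact/f2/AB.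
  apply: (@Ckon_comp2 _ _ _ _ B ('D_(dir2 R) f)) => //; last exact: CkonW.
  exact: Ckon_D.
Qed.

(** * Extension by zero across the complement of an open set *)

Fixpoint vanishes {R : realType} {V : normedModType R} (k : nat) (A : set V)
    (z0 : V) (f : V -> R) : Prop :=
  f z @[z --> within A (nbhs z0)] --> 0 /\
  (if k is k'.+1 then forall v, vanishes k' A z0 ('D_v f) else True).

(** The intermediate point is different from 0, so the lemma applies while differentiability at 0 is
    still the open question. *)
Lemma mean_value0 {R : realType} (g dg : R -> R) (h : R) :
  h != 0 -> (forall x : R, 0 < `|x| <= `|h| -> is_derive x 1 g (dg x)) ->
  {for 0, continuous g} ->
  exists2 c, 0 < `|c| <= `|h| & g h - g 0 = dg c * h.
Proof.
move=> h0 D c0.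
have cg x : `|x| <= `|h| -> {for x, continuous g}.
  move=> xh; have [->//|x0] := eqVneq x 0.
  by apply: is_derive_continuous (D x _); rewrite normr_gt0 x0.
move: h0; rewrite neq_lt => /orP[h0|h0].
- have [x| |c] := @MVT R g dg h 0 h0.
  + by rewrite in_itv /= => /andP[hx x0]; apply: D; rewrite !ltr0_norm//; lra.
  + apply: continuous_in_subspaceT => x; rewrite inE /= in_itv /= => /andP[hx x0].
    by apply: cg; rewrite ler0_norm// ltr0_norm//; lra.
  + rewrite in_itv /= => /andP[hc c0'] E; exists c.
      by rewrite !ltr0_norm//; lra.
    by rewrite -opprB E; ring.
- have [x| |c] := @MVT R g dg 0 h h0.
  + by rewrite in_itv /= => /andP[hx x0]; apply: D; rewrite !gtr0_norm//; lra.
  + apply: continuous_in_subspaceT => x; rewrite inE /= in_itv /= => /andP[hx x0].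
    by apply: cg; rewrite ger0_norm// gtr0_norm//; lra.
  + rewrite in_itv /= => /andP[hc c0'] E; exists c.
      by rewrite !gtr0_norm//; lra.
    by rewrite E subr0.
Qed.

(** At a point outside [A], a line that enters [A] at once has, by the mean value theorem,
    difference quotients equal to derivatives at nearby points of [A], which tend to 0; a line that
    stays outside has zero quotients. So all first derivatives vanish off [A], and the induction
    applies to ['D_v f] in place of [f]. *)
Lemma Ckon_glue {R : realType} {V : normedModType R} k (A B : set V) (f : V -> R) :
  open A -> open B -> A `<=` B -> (forall z, B z -> ~ A z -> f z = 0) ->
  (forall z0, B z0 -> ~ A z0 -> forall v,
     (\forall h \near (0 : R)^', A (h *: v + z0)) \/
     (\forall h \near (0 : R)^', ~ A (h *: v + z0))) ->
  Ckon k A f -> (forall z0, B z0 -> ~ A z0 -> vanishes k A z0 f) ->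
  Ckon k B f /\ ((0 < k)%N -> forall z0 v, B z0 -> ~ A z0 -> is_derive z0 v f 0).
Proof.
move=> oA oB AB + HA; elim: k f => [|k IH] f f0 F Vf.
- split=> // x Bx; have [Ax|nAx] := pselect (A x); first exact: F.
  rewrite /prop_for /continuous_at (f0 _ Bx nAx).
  have [V0 _] := Vf _ Bx nAx.
  apply/cvgrPdist_lt => e e0; move/cvgrPdist_lt: V0 => /(_ e e0).
  rewrite near_withinE => V1.
  apply: filterS2 V1 (open_nbhs_nbhs (conj oB Bx)) => z V1 Bz.
  have [Az|nAz] := pselect (A z); first exact: V1.
  by rewrite f0// subrr normr0.
- have [|C0 _] := IH f f0 (CkonW F).
    move=> z0 Bz nAz; have := Vf z0 Bz nAz; clear.
    elim: k f => [|k IH] f /=; first by case.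
    by move=> [c d]; split=> // v; apply: IH; exact: d.
  have cf x : B x -> {for x, continuous f} by exact: Ckon_cont C0.
  have D z0 v : B z0 -> ~ A z0 -> is_derive z0 v f 0.
    move=> Bz nAz; have fz0 := f0 _ Bz nAz.
    have C : (h^-1 *: (f (h *: v + z0) - f z0)) @[h --> 0^'] --> (0 : R).
      rewrite fz0; have nB : \forall h \near (0 : R)^', B (h *: v + z0).
        exact: cvg_dnbhs (@cvg_line R V z0 v) _ (open_nbhs_nbhs (conj oB Bz)).
      have [HA1|HA1] := HA _ Bz nAz v; last first.
        apply: (cvg_near_eq _ (@cvg_cst _ _ _ _ _)).
        by near=> h; rewrite f0 ?subrr ?scaler0//; near: h.
      have V0 : 'D_v f z @[z --> within A (nbhs z0)] --> 0.
        by have [_ /(_ v)] := Vf _ Bz nAz; case: (k) => [|?] [].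
      move/cvgrPdist_lt : V0 => V1; apply/cvgrPdist_lt => e e0.
      have := V1 e e0; rewrite near_withinE => V2.
      have := @cvg_line R V z0 v _ V2.
      move: HA1; rewrite near_withinE => HA1 V3.
      have : nbhs (0 : R) (fun h : R => (h != 0 -> A (h *: v + z0)) /\
          (A (h *: v + z0) -> `|0 - 'D_v f (h *: v + z0)| < e)).
        exact: filterI HA1 V3.
      move=> /nbhs_ballP [d /= d0 H].
      rewrite near_withinE; apply/nbhs_ballP; exists d => //= h hd h0.
      have Hx (x : R) : 0 < `|x| <= `|h| ->
          A (x *: v + z0) /\ `|0 - 'D_v f (x *: v + z0)| < e.
        move=> /andP[x0 xh]; have [|h1 h2] := H x; last first.
          by rewrite normr_gt0 in x0; have Ax := h1 x0; split=> //; exact: h2.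
        move: hd; rewrite -!ball_normE /= !sub0r !normrN; exact: le_lt_trans.
      have [x xh|//|c ch] := @mean_value0 R (fun x => f (x *: v + z0))
          (fun x => 'D_v f (x *: v + z0)) h h0.
      + apply: (@is_derive_line R V R f z0 v x _).1.
        exact: (@Ckon_is_derive R V R k A f v (x *: v + z0) F (Hx x xh).1).
      + rewrite /prop_for /continuous_at scale0r add0r.
        exact: (cvg_comp _ _ (@cvg_line R V z0 v) (cf _ Bz)).
      + rewrite scale0r add0r fz0 => ->.
        by rewrite [h^-1 *: _]mulrC mulfK//; exact: (Hx _ ch).2.
    split; first exact: cvgP C.
    exact/cvg_lim.
  split=> [|_ z0 v]; last exact: D.
  split=> // v; split=> [x Bx|].
    have [Ax|nAx] := pselect (A x); last by have [] := D x v Bx nAx.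
    by have [] := Ckon_is_derive v F Ax.
  apply: (IH ('D_v f) _ (Ckon_D v F) _).1 => z Bz nAz.
    by have [] := D z v Bz nAz.
  by have [_] := Vf z Bz nAz; exact.
Unshelve. all: by end_near. Qed.

(** * Integrals depending on a parameter *)

(* The integral of g from 0 to x, taken from -1 on so that 0 is an interior point. *)
Definition prim {R : realType} (g : R -> R) (x : R) : R :=
  if 0 <= x
  then Rintegral (@lebesgue_measure R) `[-1, x] g
       - Rintegral (@lebesgue_measure R) `[-1, 0] g
  else Rintegral (@lebesgue_measure R) `[-1, 0] (g \o -%R)
       - Rintegral (@lebesgue_measure R) `[-1, - x] (g \o -%R).

Lemma prim0 {R : realType} (g : R -> R) : prim g 0 = 0.
Proof. by rewrite /prim lexx subrr. Qed.

Lemma is_derive_Rintegral {R : realType} (g : R -> R) (x : R) :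
  continuous g -> -1 < x ->
  is_derive x 1 (fun y => Rintegral (@lebesgue_measure R) `[-1, y] g) (g x).
Proof.
move=> cg x1; have [||//||d dE] := @continuous_FTC1_closed R g (-1) x (x + 1) _.
- by rewrite ltrDl.
- apply: continuous_compact_integrable; first exact: segment_compact.
  exact: continuous_subspaceT.
- exact: cg.
- by split; [exact: d|rewrite -derive1E; exact: dE].
Qed.

Lemma is_derive_0_eq {R : realType} (f : R -> R) (a b : R) :
  (forall x, Num.min a b <= x <= Num.max a b -> is_derive x 1 f 0) -> f a = f b.
Proof.
move=> D; have [c _ E] := @mean_value R f (fun=> 0) a b D.
by apply/esym/eqP; rewrite -subr_eq0 E mul0r.
Qed.

Lemma is_derive_prim {R : realType} (g : R -> R) (x : R) :
  continuous g -> is_derive x 1 (prim g) (g x).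
Proof.
move=> cg; have cg' : continuous (g \o -%R).
  by move=> y; apply: continuous_comp; [exact: opp_continuous|exact: cg].
pose F y := Rintegral (@lebesgue_measure R) `[-1, y] g
       - Rintegral (@lebesgue_measure R) `[-1, 0] g.
pose H y := Rintegral (@lebesgue_measure R) `[-1, 0] (g \o -%R)
       - Rintegral (@lebesgue_measure R) `[-1, - y] (g \o -%R).
have DF (y : R) : -1 < y -> is_derive y 1 F (g y).
  move=> y1; have := is_derive_Rintegral cg y1 => D.
  by apply: is_derive_eq; rewrite subr0.
have DH (y : R) : y < 1 -> is_derive y 1 H (g y).
  move=> y1; have y1' : -1 < - y by lra.
  have D := is_derive_Rintegral cg' y1'.
  have D' := @is_derive_chain1 R R _ (fun z : R => - z) y 1 _ (-1) _ D.
  have D2 : is_derive y 1 (fun z : R => - z) (-1) by exact: is_deriveNid.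
  have D3 := D' D2.
  have D4 : is_derive y 1 H (0 - (g \o -%R) (- y) * -1).
    apply: (@is_deriveB _ _ _ (fun=> _)); exact: D3.
  by apply: is_derive_eq; rewrite /= opprK mulrN1 sub0r opprK.
have [x0|x0] := ltP x 0.
  apply: near_eq_is_derive (DH _ _); last by lra.
  near=> y; have y0 : y < 0 by near: y; exact: lt_nbhsl.
  by rewrite /prim leNgt y0.
apply: near_eq_is_derive (DF _ _); last by lra.
near=> y; rewrite /prim; case: ifPn => // /negP y0.
have {}y0 : y < 0 by rewrite ltNge; apply/negP.
have y1 : -1 < y by near: y; apply: lt_nbhsr; lra.
(* At x = 0 the two branches of [prim] have to match: [F] and [H] have the same derivative on the
   interval from -1 to 1 and both are 0 at 0. *)
have D (z : R) : Num.min 0 y <= z <= Num.max 0 y -> is_derive z 1 (fun t => F t - H t) 0.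
  rewrite min_r ?max_l ?(ltW y0)// => /andP[z0 z1].
  have D1 : is_derive z 1 F (g z) by apply: DF; lra.
  have D2 : is_derive z 1 H (g z) by apply: DH; lra.
  have D3 := @is_deriveB _ _ _ F H z 1 _ _ D1 D2.
  by apply: is_derive_eq; rewrite subrr.
have := is_derive_0_eq D.
rewrite /F /H oppr0 !subrr => /esym/eqP; rewrite subr_eq0 => /eqP ->.
by [].
Unshelve. all: by end_near. Qed.

Lemma prim_norm_le {R : realType} (P g : R -> R) (c x : R) :
  P 0 = 0 -> (forall y : R, is_derive y 1 P (g y)) ->
  (forall y, `|y| <= `|x| -> `|g y| <= c) -> `|P x| <= c * `|x|.
Proof.
move=> P0 D gc; have [y yx] := @mean_value R P g 0 x (fun y _ => D y).
rewrite P0 !subr0 => ->; rewrite normrM ler_wpM2r// gc//.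
move: yx; case: (leP 0 x) => x0 /andP[h1 h2].
  by rewrite !ger0_norm.
by rewrite (ltr0_norm x0) ler0_norm// lerN2.
Qed.

(** Monotonicity of integrals, stated for arbitrary antiderivatives so that it also covers functions
    not written as integrals, such as y - [time]. *)
Lemma prim_le {R : realType} (P Q f g : R -> R) (x : R) :
  P 0 = 0 -> Q 0 = 0 -> (forall y : R, is_derive y 1 P (f y)) ->
  (forall y : R, is_derive y 1 Q (g y)) -> 0 <= x ->
  (forall y, 0 <= y <= x -> f y <= g y) -> P x <= Q x.
Proof.
move=> P0 Q0 DP DQ x0 fg.
have D (y : R) : is_derive y 1 (fun z => Q z - P z) (g y - f y).
  exact: (@is_deriveB _ _ _ Q P).
have [y yx] := @mean_value R _ _ 0 x (fun y _ => D y).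
rewrite P0 Q0 !subr0 => E; rewrite -subr_ge0 E mulr_ge0// subr_ge0 fg//.
by move: yx; rewrite min_l// max_r.
Qed.

Definition pint {R : realType} (G : R * R -> R) (p : R * R) : R :=
  prim (fun y => G (p.1, y)) p.2.

Lemma continuous_slice2 {R : realType} (G : R * R -> R) (a : R) :
  continuous G -> continuous (fun y => G (a, y)).
Proof.
move=> cG y; apply: (@continuous_comp _ _ _ (fun y => (a, y)) G); last exact: cG.
by apply: continuous_pair => /=; [exact: cst_continuous|].
Qed.

(** A tube argument: compactness of the interval from -b to b makes the neighbourhood of [a]
    independent of [y]. *)
Lemma uniform_slice {R : realType} (G : R * R -> R) (a b e : R) :
  continuous G -> 0 < e ->
  \forall x \near a, forall y, `|y| <= b -> `|G (x, y) - G (a, y)| < e.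
Proof.
move=> cG e0; pose P (x y : R) : Prop := `|G (x, y) - G (a, y)| < e.
have /compact_near_coveringP H := @segment_compact R (- b) b.
have : \forall x \near a, `[- b, b]%classic `<=` P x.
  apply: (H R (nbhs a) P) => y _.
  have C : {for (y, a), continuous (fun p : R * R => G (p.2, p.1) - G (a, p.1))}.
    apply: continuousB.
      apply: (@continuous_comp _ _ _ (fun p : R * R => (p.2, p.1)) G); last exact: cG.
      by apply: continuous_pair; [exact: cvg_snd|exact: cvg_fst].
    apply: (@continuous_comp _ _ _ (fun p : R * R => (a, p.1)) G); last exact: cG.
    by apply: continuous_pair; [exact: cst_continuous|exact: cvg_fst].
  have := cvgr_norm_lt _ C; rewrite /= subrr normr0 => /(_ (nbhs_filter _) e e0).
  exact.
apply: filterS => x xP y yb; apply: xP => /=.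
by rewrite in_itv /= -ler_norml.
Qed.

Lemma is_derive_pint2 {R : realType} (G : R * R -> R) (p : R * R) :
  continuous G -> is_derive p (dir2 R) (pint G) (G p).
Proof.
case: p => a b cG; have D := is_derive_prim b (continuous_slice2 (a := a) cG).
have -> : (a, b) = b *: dir2 R + (a, 0).
  by rewrite scale_pairD mulr1 mulr0 addr0 add0r.
apply/is_derive_line; rewrite scale_pairD mulr1 mulr0 addr0 add0r.
move: D; congr is_derive; apply/funext => h.
by rewrite /pint scale_pairD mulr1 mulr0 addr0 add0r.
Qed.

Lemma continuous_pint {R : realType} (G : R * R -> R) :
  continuous G -> continuous (pint G).
Proof.
move=> cG [a b]; apply/cvgrPdist_lt => e e0.
have D := is_derive_prim b (continuous_slice2 (a := a) cG).
have e2 : 0 < e / 2 by lra.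
(* A bound of this size on the integrands, over a length at most |b| + 1, contributes e / 2; the
   other half comes from moving the endpoint at fixed [a]. *)
have e3 : 0 < e / (2 * (`|b| + 1)) by rewrite divr_gt0// mulr_gt0// ltr_pwDr.
have U := uniform_slice a (`|b| + 1) cG e3.
have /cvgrPdist_lt/(_ _ e2) L := is_derive_continuous D.
have B : \forall y \near b, `|y| < `|b| + 1.
  by apply: (cvgr_norm_lt b cvg_id); rewrite ltrDl.
exists ([set x | forall y, `|y| <= `|b| + 1 -> `|G (x, y) - G (a, y)| < e / (2 * (`|b| + 1))],
  [set y | `|prim (fun y0 => G (a, y0)) b - prim (fun y0 => G (a, y0)) y| < e / 2
     /\ `|y| < `|b| + 1]).
  by split=> //=; exact: filterI.
move=> [x y] /= [xU [yL yB]].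
have Dd (z : R) : is_derive z 1 (fun z => prim (fun t => G (x, t)) z - prim (fun t => G (a, t)) z)
    (G (x, z) - G (a, z)).
  apply: (@is_deriveB _ _ _ (prim (fun t => G (x, t))) (prim (fun t => G (a, t))));
  exact: (@is_derive_prim _ (fun t => G (_, t)) z (continuous_slice2 cG)).
have := @prim_norm_le R _ _ (e / (2 * (`|b| + 1))) y _ Dd.
rewrite !prim0 subrr => /(_ erefl) H.
have {H} : `|prim (fun t => G (x, t)) y - prim (fun t => G (a, t)) y| <= e / 2.
  apply: le_trans (H _) _.
    by move=> z zy; apply/ltW/xU; apply: le_trans zy (ltW yB).
  have b1 : 0 < `|b| + 1 by rewrite ltr_pwDr.
  rewrite mulrAC ler_pdivrMr ?mulr_gt0//.
  have -> : e / 2 * (2 * (`|b| + 1)) = e * (`|b| + 1) by field.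
  by rewrite ler_pM2l// ltW.
rewrite /pint /= => H.
have -> : prim (fun y0 => G (a, y0)) b - prim (fun y0 => G (x, y0)) y =
  (prim (fun y0 => G (a, y0)) b - prim (fun y0 => G (a, y0)) y) -
  (prim (fun t => G (x, t)) y - prim (fun t => G (a, t)) y) by ring.
by apply: le_lt_trans (ler_normB _ _) _; lra.
Qed.

(** Differentiation under the integral. The primitive of G(a + h, y) - G(a, y) - h G1(a, y) is
    estimated by its integrand, which the mean value theorem in the first variable and
    [uniform_slice] for [G1] make o(h) uniformly in y. *)
Lemma is_derive_pint1 {R : realType} (G G1 : R * R -> R) (p : R * R) :
  continuous G -> continuous G1 -> (forall p, is_derive p (dir1 R) G (G1 p)) ->
  is_derive p (dir1 R) (pint G) (pint G1 p).
Proof.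
case: p => a b cG cG1 D.
have D1 (x y : R) : is_derive x 1 (fun h => G (h, y)) (G1 (x, y)).
  have : is_derive (x *: dir1 R + (0, y)) (dir1 R) G (G1 (x, y)).
    by rewrite scale_pairD mulr1 mulr0 addr0 add0r.
  move/is_derive_line; congr is_derive; apply/funext => h; congr G.
  by rewrite scale_pairD mulr1 mulr0 addr0 add0r.
have C : (h^-1 *: (pint G (h *: dir1 R + (a, b)) - pint G (a, b))) @[h --> 0^']
   --> pint G1 (a, b).
  apply/cvgrPdist_lt => e e0.
  have b1 : 0 < `|b| + 1 by rewrite ltr_pwDr.
  have e3 : 0 < e / (`|b| + 1) by rewrite divr_gt0.
  have /nbhs_ballP [d /= d0 U] := uniform_slice a `|b| cG1 e3.
  rewrite near_withinE; apply/nbhs_ballP; exists d => //= h hd h0.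
  rewrite scale_pairD mulr1 mulr0 add0r /pint /=.
  have Dd (z : R) : is_derive z 1 (fun z => (prim (fun t => G (h + a, t)) z
        - prim (fun t => G (a, t)) z) - h * prim (fun t => G1 (a, t)) z)
      ((G (h + a, z) - G (a, z)) - h * G1 (a, z)).
    have E1 := @is_derive_prim _ _ z (continuous_slice2 (a := h + a) cG).
    have E2 := @is_derive_prim _ _ z (continuous_slice2 (a := a) cG).
    have E3 := @is_derive_prim _ _ z (continuous_slice2 (a := a) cG1).
    have E4 := @is_deriveB _ _ _ _ _ _ _ _ _ E1 E2.
    have E5 := @is_deriveZ _ _ _ _ h _ _ _ E3.
    exact: (@is_deriveB _ _ _ _ _ _ _ _ _ E4 E5).
  have := @prim_norm_le R _ _ (`|h| * (e / (`|b| + 1))) b _ Dd.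
  rewrite !prim0 subrr mulr0 subrr => /(_ erefl) H.
  have {}H := H _.
  have K : `|prim (fun t => G (h + a, t)) b - prim (fun t => G (a, t)) b -
      h * prim (fun t => G1 (a, t)) b| <= `|h| * (e / (`|b| + 1)) * `|b|.
    apply: H => y yb.
    have [c cab E] := @mean_value R (fun t => G (t, y)) (fun t => G1 (t, y)) a (h + a)
        (fun x _ => D1 x y).
    rewrite E addrK mulrC -mulrBr normrM ler_wpM2l//; apply/ltW/U => //=.
    move: hd cab; rewrite -!ball_normE /= sub0r normrN.
    by case: (leP a (h + a)) => ah; rewrite !ltr_norml; lra.
  have h1 : 0 < `|h| by rewrite normr_gt0.
  rewrite -[X in X - _](mulKf h0) /GRing.scale /= -mulrBr normrM normfV.
  rewrite mulrC ltr_pdivrMr// distrC; apply: le_lt_trans K _.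
  rewrite -mulrA mulrC ltr_pM2r//.
  by rewrite mulrAC ltr_pdivrMr// ltr_pM2l// ltrDl.
split; first exact: cvgP C.
exact/cvg_lim.
Qed.

(** * The divided difference of |v|^r with respect to v^2 *)

Lemma Ckon_real {R : realType} k (A : set R) (f f1 : R -> R) :
  open A -> (forall x : R, A x -> is_derive x 1 f (f1 x)) -> Ckon k A f1 ->
  Ckon k.+1 A f.
Proof.
move=> oA D F1; apply: (@Ckon_intro _ _ _ _ _ _ (fun v x => f1 x * v)) => //.
- by move=> x /D; exact: is_derive_continuous.
- by move=> v x Ax; apply: (@is_derive_chain1 R R f id) => //; exact: D.
- by move=> v; apply: Ckon_mul => //; exact: Ckon_cst.
Qed.

Lemma open_pos {R : realType} : open [set x : R | 0 < x].
Proof. exact: open_gt. Qed.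

Lemma Ckon_powR {R : realType} k (a : R) : Ckon k [set x : R | 0 < x] (@powR R ^~ a).
Proof.
elim: k a => [|k IH] a.
  by move=> x /= x0; have := is_derive1_powR a x0; exact: is_derive_continuous.
apply: (@Ckon_real _ _ _ _ (fun x => a * x `^ (a - 1))).
- exact: open_pos.
- by apply: Ckon_mul; [exact: open_pos|exact: Ckon_cst|exact: IH].
Qed.

Lemma Ckon_expR {R : realType} k : Ckon k setT (@expR R).
Proof.
elim: k => [|k IH]; first by move=> x _; exact: continuous_expR.
by apply: (Ckon_real openT _ IH) => x _; exact: is_derive_expR.
Qed.

Lemma Ckon_sin_cos {R : realType} k : Ckon k setT (@sin R) /\ Ckon k setT (@cos R).
Proof.
elim: k => [|k [IHs IHc]].
  by split=> x _; [exact: continuous_sin|exact: continuous_cos].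
split; first by apply: (Ckon_real openT _ IHc) => x _; exact: is_derive_sin.
apply: (@Ckon_real _ _ _ _ (fun x => - sin x) openT).
by apply: Ckon_opp => //; exact: openT.
Qed.

Lemma Ckon_id {R : realType} k (A : set R) : open A -> Ckon k A (@idfun R).
Proof. by move=> oA; apply: Ckon_linear => //; move=> x; exact: cvg_id. Qed.

Lemma normr_powR_cvg0 {R : realType} (s : R) : 0 < s ->
  `|x| `^ s @[x --> (0 : R)] --> 0.
Proof.
move=> s0; apply/cvgrPdist_lt => e e0; apply/nbhs_ballP.
exists (e `^ s^-1); first exact: powR_gt0.
move=> x; rewrite /ball_ /= !sub0r !normrN => xe.
rewrite (ger0_norm (powR_ge0 _ _)).
have := gt0_ltr_powR s0 _ _ xe.
rewrite -powRrM mulVf ?gt_eqF// (powRr1 (ltW e0)); apply.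
  by rewrite nnegrE.
by rewrite nnegrE powR_ge0.
Qed.

Lemma normr_powR0 {R : realType} (s : R) : 0 < s -> `|0 : R| `^ s = 0.
Proof. by move=> s0; rewrite normr0 powR0// gt_eqF. Qed.

(** The form |x|^(r-2) x of the derivative covers both signs and the origin. At 0 the difference
    quotient has absolute value |h|^(r-1), which tends to 0. *)
Lemma is_derive_normr_powR {R : realType} (r x : R) : 2 < r ->
  is_derive x 1 (fun y => `|y| `^ r) (r * (`|x| `^ (r - 2) * x)).
Proof.
move=> r2; have sq (y : R) : y != 0 -> `|y| `^ (r - 2) * `|y| = `|y| `^ (r - 1).
  move=> y0; have -> : r - 1 = (r - 2) + 1 by ring.
  rewrite (@powRD _ _ (r - 2) 1); last by rewrite normr_eq0 y0 implybT.
  by rewrite powRr1.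
have [x0|x0|->] := ltgtP x 0.
- have D : is_derive x 1 (fun y : R => (- y) `^ r) (r * (- x) `^ (r - 1) * -1).
    have nx : 0 < - x by lra.
    apply: (@is_derive_chain1 R R (@powR R ^~ r) -%R x 1 _ (-1)).
    exact: is_derive1_powR.
  have -> : r * (`|x| `^ (r - 2) * x) = r * (- x) `^ (r - 1) * -1.
    have xn0 : x != 0 by rewrite lt_eqF.
    by have := sq x xn0; rewrite !ltr0_norm// => <-; ring.
  apply: near_eq_is_derive D; near=> y.
  by rewrite ltr0_norm//; near: y; exact: lt_nbhsl.
- have D := is_derive1_powR r x0.
  have -> : r * (`|x| `^ (r - 2) * x) = r * x `^ (r - 1).
    have xn0 : x != 0 by rewrite gt_eqF.
    by have := sq x xn0; rewrite !gtr0_norm// => <-.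
  apply: near_eq_is_derive D; near=> y.
  by rewrite gtr0_norm//; near: y; exact: lt_nbhsr.
- rewrite !mulr0; have r1 : 0 < r - 1 by lra.
  have C : (fun h : R => h^-1 *: (`|h *: (1 : R) + 0| `^ r - `|0 : R| `^ r)) @ (0 : R)^' --> (0 : R).
    rewrite normr_powR0; last by lra.
    apply/cvgrPdist_lt => e e0.
    have /cvgrPdist_lt /(_ e e0) := cvg_dnbhs (normr_powR_cvg0 r1).
    apply: filter_app; near=> h.
    have h0 : h != 0 by near: h; exact: nbhs_dnbhs_neq.
    rewrite /GRing.scale /= mulr1 addr0 subr0 !sub0r !normrN normrM normfV.
    rewrite !(ger0_norm (powR_ge0 _ _)); congr (_ < _).
    have -> : `|h| `^ r = `|h| * `|h| `^ (r - 1) by rewrite mulr_powRB1//; lra.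
    by rewrite mulKf// normr_eq0.
  split; first exact: cvgP C.
  exact/cvg_lim.
Unshelve. all: by end_near. Qed.

Lemma continuous_normr_powR {R : realType} (s : R) : 0 < s ->
  continuous (fun x : R => `|x| `^ s).
Proof.
move=> s0 x; have [->|x0] := eqVneq x 0.
  by rewrite /continuous_at normr_powR0//; exact: normr_powR_cvg0.
apply: (@continuous_comp _ _ _ (fun x : R => `|x|) (@powR R ^~ s)).
  exact: norm_continuous.
by apply: (Ckon_cont (Ckon_powR 0 s)); rewrite /= normr_gt0.
Qed.

Lemma Ckon_normr_powR {R : realType} (r : R) : 2 < r ->
  Ckon 1 setT (fun x : R => `|x| `^ r).
Proof.
move=> r2; apply: (Ckon_real openT (fun x _ => is_derive_normr_powR x r2)) => x _.
apply: continuousM; first exact: cst_continuous.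
apply: continuousM; last exact: cvg_id.
by apply: continuous_normr_powR; lra.
Qed.

(* (1 - y^m) / (m (1 - y)), with its continuous extension at y = 1. *)
Definition powR_dd {R : realType} (m y : R) : R :=
  if y == 1 then 1 else (1 - y `^ m) / (m * (1 - y)).

Lemma mean_value_ball {R : realType} (f df : R -> R) (a d e : R) : f a = 0 ->
  (forall x : R, ball a d x -> is_derive x 1 f (df x)) ->
  (forall x, ball a d x -> `|df x| <= e * `|x - a| \/ `|df x| <= e) ->
  forall x, ball a d x -> exists2 c, ball a d c &
    `|c - a| <= `|x - a| /\ f x = df c * (x - a).
Proof.
move=> fa D _ x xd.
have H z : Num.min a x <= z <= Num.max a x -> ball a d z /\ `|z - a| <= `|x - a|.
  move: xd; rewrite -!ball_normE /= => xd zx.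
  have : `|z - a| <= `|x - a|.
    case: (leP a x) zx => ax /andP[h1 h2].
      by rewrite !ger0_norm; lra.
    by rewrite !ler0_norm; lra.
  by move=> h; split=> //; rewrite distrC (le_lt_trans h)// distrC.
have [z /H[]|c cx E] := @mean_value R f df a x; first by move=> ? _; exact: D.
have [cd ca] := H c cx; exists c => //; split=> //.
by move: E; rewrite fa subr0.
Qed.

Lemma Ckon_powR_dd {R : realType} (m : R) : 1 < m ->
  Ckon 1 [set y : R | 0 < y] (powR_dd m).
Proof.
move=> m1; set B := [set y : R | 0 < y].
pose A := B `&` [set y | y != 1].
have oA : open A by apply: openI; [exact: open_pos|exact: open_neq].
pose l := (m - 1) / 2.
(* [N] is the second-order Taylor remainder of y^m at 1, with derivatives [N1] and [N2]; away from 1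
   the remainder [f] equals N / (m (y - 1)). *)
pose N (y : R) := y `^ m - 1 - m * (y - 1) - m * l * (y - 1) ^+ 2.
pose N1 (y : R) := m * y `^ (m - 1) - m - m * (m - 1) * (y - 1).
pose N2 (y : R) := m * (m - 1) * (y `^ (m - 1 - 1) - 1).
have pw a : Ckon 2 B (@powR R ^~ a) by exact: Ckon_powR.
have D1 (y : R) : 0 < y -> is_derive y 1 N (N1 y).
  move=> y0; have := is_derive1_powR m y0 => Dp.
  apply: is_derive_eq; by rewrite /N1 /l /GRing.scale /=; field.
have D2 (y : R) : 0 < y -> is_derive y 1 N1 (N2 y).
  move=> y0; have := is_derive1_powR (m - 1) y0 => Dp.
  apply: is_derive_eq; by rewrite /N2 /GRing.scale /=; ring.
pose f (y : R) := powR_dd m y - 1 - l * (y - 1).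
have fE y : y != 1 -> f y = N y / (m * (y - 1)).
  move=> y1; rewrite /f /powR_dd (negbTE y1) /N; field.
  by rewrite !subr_eq0 y1 [1 == y]eq_sym y1 gt_eqF//; lra.
have DfA (y : R) : A y -> is_derive y 1 f
    (N1 y / (m * (y - 1)) - N y / (m * (y - 1) ^+ 2)).
  move=> [/= y0 y1]; have Dn := D1 y y0.
  have Dd : is_derive y 1 (fun z : R => m * (z - 1)) m.
    by apply: is_derive_eq; rewrite /GRing.scale /=; ring.
  have n0 : m * (y - 1) != 0 by rewrite mulf_neq0 ?subr_eq0// gt_eqF//; lra.
  have Di : is_derive y 1 (fun z : R => (m * (z - 1))^-1) (- (m * (y - 1)) ^- 2 * m).
    split; first by apply: derivableV => //; have [] := Dd.
    by rewrite deriveV//; have [_ ->] := Dd.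
  have := @is_deriveM _ _ _ _ _ _ _ _ Dn Di => Dm.
  apply: (@near_eq_is_derive _ _ _ (N * (fun z : R => (m * (z - 1))^-1))%R).
    by apply: filterS (open_nbhs_nbhs (conj oA (conj y0 y1))) => z [_ z1]; rewrite fE.
  apply: is_derive_eq; rewrite /GRing.scale /=; field.
  by rewrite subr_eq0 y1 gt_eqF//; lra.
have FA : Ckon 1 A f.
  apply: (Ckon_real oA DfA) => y [y0 y1].
  have n1 : m * (y - 1) != 0 by rewrite mulf_neq0 ?subr_eq0// gt_eqF//; lra.
  have n2 : m * (y - 1) ^+ 2 != 0 by rewrite expr2 mulrA mulf_neq0// subr_eq0.
  have c1 : {for y, continuous (fun z : R => z - 1)}.
    by apply: continuousB; [exact: cvg_id|exact: cst_continuous].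
  have c2 : {for y, continuous (fun z : R => m * (z - 1))}.
    by apply: continuousM => //; exact: cst_continuous.
  have c3 : {for y, continuous (fun z : R => m * (z - 1) ^+ 2)}.
    apply: continuousM; first exact: cst_continuous.
    by rewrite /=; apply: continuousM.
  apply: continuousB; apply: continuousM.
  - exact: is_derive_continuous (D2 y y0).
  - exact: (cvgV n1 c2).
  - exact: is_derive_continuous (D1 y y0).
  - exact: (cvgV n2 c3).
have B1 : B 1 by rewrite /B /=.
(* Since [N2] tends to 0 at 1, two applications of the mean value theorem give [N1] = o(|y - 1|) and
   [N] = o(|y - 1|^2), exactly the orders lost by dividing in f and f'. *)
have key e : 0 < e -> \forall y \near (1 : R),
    0 < y /\ `|N1 y| <= e * `|y - 1| /\ `|N y| <= e * `|y - 1| ^+ 2.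
  move=> e0.
  have C2 : N2 @ (1 : R) --> 0.
    have : {for 1, continuous N2}.
      apply: continuousM; first exact: cst_continuous.
      apply: continuousB; last exact: cst_continuous.
      exact: Ckon_cont (pw _) B1.
    by rewrite /prop_for /continuous_at /N2 powR1 subrr mulr0.
  have nB : \forall y \near (1 : R), B y by exact: open_nbhs_nbhs (conj open_pos B1).
  have : nbhs (1 : R) (fun y => B y /\ `|N2 y| < e).
    have nN : \forall y \near (1 : R), `|N2 y| < e.
      move/cvgrPdist_lt : C2 => /(_ e e0); apply: filterS => y.
      by rewrite sub0r normrN.
    exact: filterI nB nN.
  move=> /nbhs_ballP [d /= d0 H].
  apply/nbhs_ballP; exists d => //= y yd.
  have K1 (z : R) : ball (1 : R) d z -> `|N1 z| <= e * `|z - 1|.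
    move=> zd; have [||x /H[_ xe]|c cd [_ ->]] := @mean_value_ball R N1 N2 1 d e _ _ _ z zd.
    - by rewrite /N1 powR1; ring.
    - by move=> x /H[x0 _]; exact: D2.
    - by right; exact: ltW.
    - by rewrite normrM ler_wpM2r// ltW//; have [] := H c cd.
  split; first by have [] := H y yd.
  split; first exact: K1.
  have [||x /K1 xe|c cd [cy ->]] := @mean_value_ball R N N1 1 d e _ _ _ y yd.
  - by rewrite /N powR1; ring.
  - by move=> x /H[x0 _]; exact: D1.
  - by left.
  - rewrite normrM expr2 mulrA ler_wpM2r//; apply: le_trans (K1 c cd) _.
    by rewrite ler_wpM2l// ltW.
have V0 : vanishes 1 A 1 f.
  split.
    apply/cvgrPdist_lt => e e0; rewrite near_withinE.
    have : \forall y \near (1 : R), `|y - 1| < 1.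
      apply/nbhs_ballP; exists 1 => //= y.
      by rewrite -ball_normE /= distrC.
    apply: filterS2 (key e e0) => y [y0 [_ Ny]] y1 [_ /= yn1].
    have d0 : 0 < `|y - 1| by rewrite normr_gt0 subr_eq0.
    rewrite sub0r normrN fE// normrM normfV normrM (gtr0_norm (_ : 0 < m)); last by lra.
    rewrite ltr_pdivrMr; last by rewrite mulr_gt0//; lra.
    apply: le_lt_trans Ny _; rewrite expr2 ltr_pM2l// ltr_pM2r//; lra.
  move=> v; split=> //; apply/cvgrPdist_lt => e e0; rewrite near_withinE.
  have e1 : 0 < e / (2 * (`|v| + 1)) by rewrite divr_gt0// mulr_gt0// ltr_pwDr.
  apply: filterS (key _ e1) => y [y0 [N1y Ny]] [_ /= yn1].
  have d0 : 0 < `|y - 1| by rewrite normr_gt0 subr_eq0.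
  have n1 : y - 1 != 0 by rewrite subr_eq0.
  have Dv : 'D_v f y = (N1 y / (m * (y - 1)) - N y / (m * (y - 1) ^+ 2)) * v.
    have Ay : A y by [].
    by have [_ <-] := @is_derive_chain1 R R f id y v _ v (@is_derive_id _ _ _ _) (DfA y Ay).
  rewrite sub0r normrN Dv normrM.
  have m0 : 0 < m by lra.
  have b1 : `|N1 y / (m * (y - 1))| <= e / (2 * (`|v| + 1)).
    rewrite normrM normfV normrM (gtr0_norm m0) ler_pdivrMr ?mulr_gt0//.
    by apply: le_trans N1y _; rewrite ler_pM2l// ler_peMl//; lra.
  have b2 : `|N y / (m * (y - 1) ^+ 2)| <= e / (2 * (`|v| + 1)).
    rewrite normrM normfV normrM (gtr0_norm m0) normrX ler_pdivrMr ?mulr_gt0 ?exprn_gt0//.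
    by apply: le_trans Ny _; rewrite ler_pM2l// ler_peMl//; lra.
  have := le_trans (ler_normB _ _) (lerD b1 b2) => b3.
  apply: le_lt_trans (ler_wpM2r (normr_ge0 v) b3) _.
  have -> : (e / (2 * (`|v| + 1)) + e / (2 * (`|v| + 1))) * `|v| = e * `|v| / (`|v| + 1).
    by field; rewrite gt_eqF// ltr_pwDr.
  by rewrite ltr_pdivrMr ?ltr_pwDr// ltr_pM2l// ltrDl.
have [Fb _] : Ckon 1 B f /\ ((0 < 1)%N -> forall z0 v, B z0 -> ~ A z0 -> is_derive z0 v f 0).
  apply: (Ckon_glue oA open_pos) => //.
  - by move=> z [].
  - move=> z Bz nAz; have -> : z = 1 by apply/eqP/negPn/negP => z1; apply: nAz.
    by rewrite /f /powR_dd eqxx; ring.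
  - move=> z Bz nAz v; have -> : z = 1 by apply/eqP/negPn/negP => z1; apply: nAz.
    have [->|v0] := eqVneq v 0.
      by right; apply: nearW => h [_ /=]; rewrite scaler0 add0r eqxx.
    left; have nB : \forall h \near (0 : R)^', B (h *: v + 1).
      exact: cvg_dnbhs (@cvg_line R R 1 v) _ (open_nbhs_nbhs (conj open_pos B1)).
    near=> h; split; first by near: h.
    have h0 : h != 0 by near: h; exact: nbhs_dnbhs_neq.
    by rewrite /= -subr_eq0 addrK mulf_neq0.
  - move=> z Bz nAz; have -> : z = 1 by apply/eqP/negPn/negP => z1; apply: nAz.
    exact: V0.
have oB : open B by exact: open_pos.
have fE2 y : B y -> f y + (1 + l * (y - 1)) = powR_dd m y by move=> _; rewrite /f; ring.
apply: (Ckon_eq oB fE2); apply: (Ckon_add oB Fb).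
apply: (Ckon_add oB (Ckon_cst _ _ _)); apply: (Ckon_mul oB (Ckon_cst _ _ _)).
exact: (Ckon_sub_fun oB (Ckon_id _ oB) (Ckon_cst _ _ _)).
Unshelve. all: by end_near. Qed.

(** The ratio of the potential difference (1 - |v|^r) / r to the harmonic one (1 - v^2) / 2. The
    value 1 is its limit as v^2 tends to 1. It equals [powR_dd (r / 2)] at v^2. *)
Definition kap {R : realType} (r v : R) : R :=
  if v ^+ 2 == 1 then 1 else (1 - `|v| `^ r) / (r / 2 * (1 - v ^+ 2)).

Lemma sqr_powR_half {R : realType} (r v : R) : (v ^+ 2) `^ (r / 2) = `|v| `^ r.
Proof.
have -> : v ^+ 2 = `|v| `^ 2%:R by rewrite powR_mulrn// real_normK// num_real.
by rewrite -powRrM; congr (_ `^ _); field.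
Qed.

Lemma kap_mul {R : realType} (r v : R) : r != 0 ->
  r / 2 * (1 - v ^+ 2) * kap r v = 1 - `|v| `^ r.
Proof.
move=> r0; rewrite /kap; case: eqP => [v1|/eqP v1].
  by rewrite -sqr_powR_half v1 powR1 !subrr mulr0 mul0r.
rewrite mulrCA mulfV ?mulr1// mulf_neq0//; last by rewrite subr_eq0 eq_sym.
by rewrite mulf_neq0// invr_neq0// pnatr_eq0.
Qed.

(** Below, |v|^r <= v^2 for |v| <= 1. Above, with y = v^2 and m = r / 2, the mean value theorem
    gives 1 - y^m <= m (1 - y). *)
Lemma kap_bounds {R : realType} (r v : R) : 2 < r -> `|v| <= 1 ->
  2 / r <= kap r v <= 1.
Proof.
move=> r2 v1; rewrite /kap; case: eqP => [_|/eqP v2].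
  by rewrite lexx andbT ler_pdivrMr ?mul1r ?ltW//; lra.
have vv : v ^+ 2 = `|v| ^+ 2 by rewrite real_normK// num_real.
have y1 : v ^+ 2 < 1.
  by rewrite lt_neqAle v2 vv expr_le1.
have d0 : 0 < 1 - v ^+ 2 by lra.
have d1 : 0 < r / 2 * (1 - v ^+ 2) by rewrite mulr_gt0//; lra.
have y0 : 0 <= v ^+ 2 by exact: sqr_ge0.
rewrite ler_pdivlMr// ler_pdivrMr// mul1r; apply/andP; split.
  have -> : 2 / r * (r / 2 * (1 - v ^+ 2)) = 1 - v ^+ 2 by field; rewrite gt_eqF//; lra.
  rewrite lerD2l lerN2 vv; have [->|vn0] := eqVneq v 0.
    by rewrite normr0 expr0n powR0// gt_eqF//; lra.
  rewrite -powR_mulrn//; apply: ger_powR; first by rewrite normr_gt0 vn0.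
  exact: ltW.
rewrite -sqr_powR_half; set y := v ^+ 2 in y0 y1 d0 *; set m := r / 2.
have m1 : 1 < m by rewrite /m; lra.
have [->|yn0] := eqVneq y 0.
  by rewrite powR0 ?subr0 ?mulr1 ?ltW// gt_eqF//; lra.
have {}y0 : 0 < y by rewrite lt_neqAle eq_sym yn0.
have [|c /andP[yc c1] E] := @mean_value R (@powR R ^~ m) (fun x => m * x `^ (m - 1)) y 1.
  by move=> x; rewrite (min_l (ltW y1)) (max_r (ltW y1)) => /andP[yx _]; apply: is_derive1_powR; lra.
move: yc c1; rewrite (min_l (ltW y1)) (max_r (ltW y1)) => yc c1.
rewrite powR1 in E; rewrite E ler_wpM2r//; first exact: ltW.
rewrite ler_piMr//; first by lra.
have E1 : 1 `^ (m - 1) = 1 :> R by rewrite powR1.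
apply: (le_trans (_ : c `^ (m - 1) <= 1 `^ (m - 1))); last by rewrite E1.
by apply: ge0_ler_powR => //; rewrite ?nnegrE; lra.
Qed.

(** Two overlapping charts: for v <> 0 the removable singularity at v^2 = 1 is handled by [powR_dd],
    and for |v| < 1 the denominator is nonzero and the smoothness of |v|^r at 0 is what counts. *)
Lemma Ckon_kap {R : realType} (r : R) : 2 < r -> Ckon 1 setT (kap r).
Proof.
move=> r2; have r0 : r != 0 by rewrite gt_eqF//; lra.
have oT : open (setT : set R) by exact: openT.
have oA : open [set v : R | v != 0] by exact: open_neq.
pose B := [set v : R | `|v| < 1].
have oB : open B.
  have -> : B = [set v : R | -1 < v] `&` [set v | v < 1].
    by apply/seteqP; split=> v; rewrite /B /= ltr_norml => /andP.
  by apply: openI; [exact: open_gt|exact: open_lt].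
have Csq (A : set R) : open A -> Ckon 1 A (fun v : R => v ^+ 2).
  move=> oA'; have := Ckon_mul oA' (Ckon_id 1 oA') (Ckon_id 1 oA').
  by apply: Ckon_eq => // v _; rewrite expr2.
apply: (@Ckon_sub _ _ _ _ _ ([set v : R | v != 0] `|` B)).
  move=> v _; have [->|v0] := eqVneq v 0; [right|by left].
  by rewrite /B /= normr0.
apply: Ckon_setU.
  apply: (@Ckon_eq _ _ _ _ _ (powR_dd (r / 2) \o (fun v => v ^+ 2))) => //.
    by move=> v _; rewrite /powR_dd /kap /= sqr_powR_half.
  apply: (@Ckon_comp1 _ _ _ _ [set y : R | 0 < y]) => //.
  - by apply: Ckon_powR_dd; lra.
  - exact: Csq.
  - by move=> v /= v0; rewrite exprn_even_gt0.
have Bv v : B v -> 1 - v ^+ 2 != 0.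
  move=> vB; rewrite subr_eq0 eq_sym lt_eqF//.
  have -> : v ^+ 2 = `|v| ^+ 2 by rewrite real_normK// num_real.
  by rewrite expr_lt1.
apply: (@Ckon_eq _ _ _ _ _ (fun v : R => (1 - `|v| `^ r) * (r / 2 * (1 - v ^+ 2))^-1)) => //.
  move=> v vB; rewrite /kap; case: eqP => // v1.
  by have := Bv v vB; rewrite v1 subrr eqxx.
apply: Ckon_mul => //.
  apply: Ckon_sub_fun => //; first exact: Ckon_cst.
  by apply: (@Ckon_sub _ _ _ _ _ setT) => //; exact: Ckon_normr_powR.
apply: Ckon_inv => //.
  by move=> v vB; rewrite mulf_neq0//; [rewrite mulf_neq0// invr_neq0// pnatr_eq0|exact: Bv].
apply: Ckon_mul => //; first exact: Ckon_cst.
by apply: Ckon_sub_fun => //; [exact: Ckon_cst|exact: Csq].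
Qed.

(** Obtained by differentiating the product identity [kap_mul], which avoids separating the case v^2
    = 1. It recovers the force from the divided difference and is the source of the nonlinear terms
    in the oscillator equation. *)
Lemma kap_derive {R : realType} (r v : R) : 2 < r ->
  (1 - v ^+ 2) * 'D_1 (kap r) v / 2 - v * kap r v = - (`|v| `^ (r - 2) * v).
Proof.
move=> r2; have r0 : r != 0 by rewrite gt_eqF//; lra.
have Dk := @Ckon_is_derive R R R 0 setT (kap r) 1 v (Ckon_kap r2) I.
have D0 : is_derive v 1 (fun v : R => r / 2 * (1 - v ^+ 2)) (- (r * v)).
  by apply: is_derive_eq; rewrite /GRing.scale /=; field.
have D1 := @is_deriveM _ _ _ _ _ _ _ _ D0 Dk.
have D2 : is_derive v 1 (fun v : R => 1 - `|v| `^ r) (- (r * (`|v| `^ (r - 2) * v))).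
  have := is_derive_normr_powR v r2 => D.
  by have := @is_deriveB R R R (fun=> 1 : R) (fun y : R => `|y| `^ r) v 1 0 _
       (is_derive_cst (1 : R) v 1) D; rewrite sub0r.
have E : ((fun v : R => r / 2 * (1 - v ^+ 2)) * kap r)%R = (fun v : R => 1 - `|v| `^ r).
  by apply/funext => x; rewrite -(kap_mul x r0).
have := D1; rewrite E => -[_]; have [_ ->] := D2; rewrite /GRing.scale /= => H.
have -> : - (`|v| `^ (r - 2) * v) = - (r * (`|v| `^ (r - 2) * v)) / r by field.
by rewrite H; field.
Qed.

Lemma kap_derive_bound {R : realType} (r : R) : 2 < r ->
  exists2 C, 0 <= C & forall v, `|v| <= 1 -> `|'D_1 (kap r) v| <= C.
Proof.
move=> r2.
have m11 : -1 <= 1 :> R by lra.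
have [|c' _ H] := @EVT_max R (fun v => `|'D_1 (kap r) v|) (-1) 1 m11.
  apply: continuous_subspaceT => v.
  apply: (@continuous_comp _ _ _ ('D_1 (kap r)) (fun x : R => `|x|));
    last exact: norm_continuous.
  exact: (@Ckon_D R R R 0 setT (kap r) 1 (Ckon_kap r2)).
exists `|'D_1 (kap r) c'| => // v v1; apply: H.
by rewrite in_itv /= -ler_norml.
Qed.

(** * The speed in phase-plane coordinates *)

(* For w = exp(eta) sin(theta) with z = (eta, theta), energy conservation gives
   dtheta/dt = sqrt (1 + potX 0 z); potX n is the n-th derivative in eta. *)
Definition potX {R : realType} (p q : R) (n : nat) (z : R * R) : R :=
  (p - 1) ^+ n * (kap (p + 1) (sin z.2) * expR ((p - 1) * z.1)) +
  (q - 1) ^+ n * (kap (q + 1) (sin z.2) * expR ((q - 1) * z.1)).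

(** The reciprocal dt/dtheta of the angular speed. Its square times 1 + [potX] is 1, the form in
    which energy conservation is used throughout. *)
Definition slow {R : realType} (p q : R) (z : R * R) : R :=
  (1 + potX p q 0 z) `^ (- 2^-1).

Definition slow1 {R : realType} (p q : R) (z : R * R) : R :=
  - 2^-1 * (slow p q z ^+ 3 * potX p q 1 z).

Definition slow2 {R : realType} (p q : R) (z : R * R) : R :=
  3 / 4 * (slow p q z ^+ 5 * potX p q 1 z ^+ 2)
  - 2^-1 * (slow p q z ^+ 3 * potX p q 2 z).

Lemma norm_sin_le1 {R : realType} (x : R) : `|sin x| <= 1.
Proof. by rewrite ler_norml sin_geN1 sin_le1. Qed.

Lemma kap_sin_bounds {R : realType} (r x : R) : 1 < r ->
  2 / (r + 1) <= kap (r + 1) (sin x) <= 1.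
Proof. by move=> r1; apply: kap_bounds; [lra|exact: norm_sin_le1]. Qed.

Lemma kap_sin_gt0 {R : realType} (r x : R) : 1 < r -> 0 < kap (r + 1) (sin x).
Proof.
move=> r1; have /andP[h _] := kap_sin_bounds x r1.
by apply: lt_le_trans h; rewrite divr_gt0//; lra.
Qed.

Lemma potX_gt0 {R : realType} (p q : R) n z : 1 < p -> p < q -> 0 < potX p q n z.
Proof.
move=> p1 pq; have q1 : 1 < q by lra.
have hp : 0 < p - 1 by lra. have hq : 0 < q - 1 by lra.
by rewrite addr_gt0// !mulr_gt0 ?exprn_gt0 ?expR_gt0 ?kap_sin_gt0.
Qed.

Lemma potX_le {R : realType} (p q : R) n z : 1 < p -> p < q ->
  (p - 1) ^+ n * potX p q 0 z <= potX p q n z <= (q - 1) ^+ n * potX p q 0 z.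
Proof.
move=> p1 pq; have q1 : 1 < q by lra.
have hp : 0 <= p - 1 by lra. have hq : 0 <= q - 1 by lra.
have h : (p - 1) ^+ n <= (q - 1) ^+ n by rewrite lerXn2r ?nnegrE//; lra.
rewrite /potX !expr0 !mul1r !mulrDr lerD2l lerD2r.
by rewrite !ler_wpM2r// mulr_ge0 ?expR_ge0 ?ltW ?kap_sin_gt0.
Qed.

Lemma potX0_le2 {R : realType} (p q : R) z : 1 < p -> p < q -> z.1 <= 0 ->
  potX p q 0 z <= 2 * expR ((p - 1) * z.1).
Proof.
move=> p1 pq z0; have q1 : 1 < q by lra.
have /andP[_ h1] := kap_sin_bounds z.2 p1; have /andP[_ h2] := kap_sin_bounds z.2 q1.
have e1 : expR ((q - 1) * z.1) <= expR ((p - 1) * z.1) by rewrite ler_expR; nra.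
have e0 := expR_gt0 ((q - 1) * z.1); have e2 := expR_gt0 ((p - 1) * z.1).
by rewrite /potX !expr0 !mul1r; nra.
Qed.

Lemma potX0_ge {R : realType} (p q : R) z : 1 < p -> p < q ->
  2 / (p + 1) * expR ((p - 1) * z.1) <= potX p q 0 z /\
  2 / (q + 1) * expR ((q - 1) * z.1) <= potX p q 0 z.
Proof.
move=> p1 pq; have q1 : 1 < q by lra.
have /andP[h1 _] := kap_sin_bounds z.2 p1; have /andP[h2 _] := kap_sin_bounds z.2 q1.
have k1 := kap_sin_gt0 z.2 p1; have k2 := kap_sin_gt0 z.2 q1.
have e0 := expR_gt0 ((q - 1) * z.1); have e2 := expR_gt0 ((p - 1) * z.1).
rewrite /potX !expr0 !mul1r; split.
  by apply: ler_wpDr; [rewrite mulr_ge0// ltW|rewrite ler_pM2r].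
by apply: ler_wpDl; [rewrite mulr_ge0// ltW|rewrite ler_pM2r].
Qed.

Lemma slow_gt0 {R : realType} (p q : R) z : 1 < p -> p < q -> 0 < slow p q z.
Proof. by move=> p1 pq; rewrite powR_gt0// addr_gt0// potX_gt0. Qed.

Lemma slow_sqr {R : realType} (p q : R) z : 1 < p -> p < q ->
  slow p q z ^+ 2 * (1 + potX p q 0 z) = 1.
Proof.
move=> p1 pq; have X0 := potX_gt0 0 z p1 pq.
rewrite -powR_mulrn ?powR_ge0// -powRrM.
have -> : - 2^-1 * 2%:R = -1 :> R by field.
by rewrite powR_inv1 ?mulVf// ?gt_eqF//; lra.
Qed.

Lemma slow_lt1 {R : realType} (p q : R) z : 1 < p -> p < q -> slow p q z < 1.
Proof.
move=> p1 pq; have X0 := potX_gt0 0 z p1 pq; have g0 := slow_gt0 z p1 pq.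
have g2 := slow_sqr z p1 pq; rewrite ltNge; apply/negP => g1.
have g3 : 1 <= slow p q z ^+ 2 by rewrite exprn_ege1.
by nra.
Qed.

(** For amplitude at most 1, [potX] is at most 2, so the square of [slow] is at least 1/3; the
    weaker bound 1/3 for [slow] itself avoids a root. *)
Lemma slow_ge3 {R : realType} (p q : R) z : 1 < p -> p < q -> z.1 <= 0 ->
  3^-1 <= slow p q z.
Proof.
move=> p1 pq z0; have g0 := slow_gt0 z p1 pq; have g1 := slow_lt1 z p1 pq.
have g2 := slow_sqr z p1 pq; have X2 := potX0_le2 p1 pq z0.
have e1 : expR ((p - 1) * z.1) <= 1 by rewrite -[leRHS]expR0 ler_expR mulr_ge0_le0//; lra.
have X0 := potX_gt0 0 z p1 pq.
rewrite -[_^-1]mul1r ler_pdivrMr//; nra.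
Qed.

(** Each eta derivative of [potX] is at most a power of q - 1 times [potX], and slow^2 [potX] <= 1
    absorbs that factor. The bounds are therefore uniform in eta, for large amplitudes as well;
    [slow2_bound] works in the same way. *)
Lemma slow1_bounds {R : realType} (p q : R) z : 1 < p -> p < q ->
  - (q - 1) <= slow1 p q z < 0.
Proof.
move=> p1 pq; have g0 := slow_gt0 z p1 pq; have g1 := slow_lt1 z p1 pq.
have g2 := slow_sqr z p1 pq; have X0 := potX_gt0 0 z p1 pq.
have X1 := potX_gt0 1 z p1 pq; have /andP[_ X2] := potX_le 1 z p1 pq.
rewrite expr1 in X2; rewrite /slow1.
set g := slow p q z in g0 g1 g2 *; set x0 := potX p q 0 z in g2 X0 X2 *.
set x1 := potX p q 1 z in X1 X2 *.
have gx : g ^+ 2 * x0 <= 1 by rewrite -g2 ler_wpM2l ?sqr_ge0//; lra.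
have gx1 : g ^+ 3 * x1 <= (q - 1).
  have h1 : g ^+ 3 * x1 <= g ^+ 2 * ((q - 1) * x0).
    apply: ler_pM => //; [exact/exprn_ge0/ltW|exact: ltW|].
    by rewrite exprS ger_pMl ?exprn_gt0// ltW.
  apply: le_trans h1 _; rewrite mulrCA ger_pMr//; lra.
have g3 : 0 < g ^+ 3 * x1 by rewrite mulr_gt0// exprn_gt0.
by apply/andP; split; lra.
Qed.

Lemma slow2_bound {R : realType} (p q : R) z : 1 < p -> p < q ->
  `|slow2 p q z| <= 2 * (q - 1) ^+ 2.
Proof.
move=> p1 pq; have g0 := slow_gt0 z p1 pq; have g1 := slow_lt1 z p1 pq.
have g2 := slow_sqr z p1 pq; have X0 := potX_gt0 0 z p1 pq.
have X1 := potX_gt0 1 z p1 pq; have /andP[_ X1'] := potX_le 1 z p1 pq.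
have X2 := potX_gt0 2 z p1 pq; have /andP[_ X2'] := potX_le 2 z p1 pq.
rewrite expr1 in X1'; rewrite /slow2.
set g := slow p q z in g0 g1 g2 *; set x0 := potX p q 0 z in g2 X0 X1' X2' *.
set x1 := potX p q 1 z in X1 X1' *; set x2 := potX p q 2 z in X2 X2' *.
have gx : g ^+ 2 * x0 <= 1 by rewrite -g2 ler_wpM2l ?sqr_ge0//; lra.
have gx0 : 0 <= g ^+ 2 * x0 by rewrite mulr_ge0 ?exprn_ge0 ?ltW.
have q2 : 0 < (q - 1) ^+ 2 by rewrite exprn_gt0//; lra.
have h1 : g ^+ 5 * x1 ^+ 2 <= (q - 1) ^+ 2.
  have : g ^+ 5 * x1 ^+ 2 <= g ^+ 4 * ((q - 1) * x0) ^+ 2.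
    apply: ler_pM; [exact/exprn_ge0/ltW|exact/exprn_ge0/ltW| |].
      by rewrite exprS ger_pMl ?exprn_gt0// ltW.
    by rewrite lerXn2r// nnegrE; [exact: ltW|apply: le_trans X1'; exact: ltW].
  move=> h; apply: le_trans h _.
  have -> : g ^+ 4 * ((q - 1) * x0) ^+ 2 = (q - 1) ^+ 2 * (g ^+ 2 * x0) ^+ 2 by ring.
  by rewrite ger_pMr// expr_le1.
have h2 : g ^+ 3 * x2 <= (q - 1) ^+ 2.
  have : g ^+ 3 * x2 <= g ^+ 2 * ((q - 1) ^+ 2 * x0).
    apply: ler_pM => //; [exact/exprn_ge0/ltW|exact: ltW|].
    by rewrite exprS ger_pMl ?exprn_gt0// ltW.
  by move=> h; apply: le_trans h _; rewrite mulrCA ger_pMr.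
have h3 : 0 < g ^+ 5 * x1 ^+ 2 by rewrite mulr_gt0// exprn_gt0.
have h4 : 0 < g ^+ 3 * x2 by rewrite mulr_gt0// exprn_gt0.
by rewrite ler_norml; apply/andP; split; lra.
Qed.

Lemma is_derive_fst {R : realType} (z v : R * R) : is_derive z v fst v.1.
Proof. by apply: (@is_derive_affine R (R * R)%type R R id fst fst). Qed.

Lemma is_derive_snd {R : realType} (z v : R * R) : is_derive z v snd v.2.
Proof. by apply: (@is_derive_affine R (R * R)%type R R id snd snd). Qed.

Lemma Ckon_fst {R : realType} k (A : set (R * R)) : open A -> Ckon k A (@fst R R).
Proof. by move=> oA; apply: Ckon_linear => //; move=> x; exact: cvg_fst. Qed.

Lemma Ckon_snd {R : realType} k (A : set (R * R)) : open A -> Ckon k A (@snd R R).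
Proof. by move=> oA; apply: Ckon_linear => //; move=> x; exact: cvg_snd. Qed.

Lemma is_derive_potX {R : realType} (p q : R) n z :
  is_derive z (dir1 R) (potX p q n) (potX p q n.+1 z).
Proof.
have E a : is_derive z (dir1 R) (fun z => expR ((a - 1) * z.1))
    (expR ((a - 1) * z.1) * (a - 1)).
  apply: (@is_derive_chain1 R _ (@expR R) (fun z => (a - 1) * z.1)).
  have := @is_deriveZ _ _ _ _ (a - 1) _ _ _ (is_derive_fst z (dir1 R)).
  by rewrite /= /GRing.scale /= mulr1.
have K a : is_derive z (dir1 R) (fun z => kap (a + 1) (sin z.2)) 0.
  have E0 := @is_derive_affine R (R * R)%type R R (fun x => kap (a + 1) (sin x))
    snd snd z (dir1 R) 0.
  by apply: E0 => //=; exact: is_derive0.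
have P a : is_derive z (dir1 R) (fun z => (a - 1) ^+ n *
      (kap (a + 1) (sin z.2) * expR ((a - 1) * z.1)))
    ((a - 1) ^+ n.+1 * (kap (a + 1) (sin z.2) * expR ((a - 1) * z.1))).
  have M := @is_deriveM _ _ _ _ _ _ _ _ (K a) (E a).
  have Z := @is_deriveZ _ _ _ _ ((a - 1) ^+ n) _ _ _ M.
  by apply: is_derive_eq; rewrite /GRing.scale /= exprS; ring.
exact: (@is_deriveD _ _ _ _ _ _ _ _ _ (P p) (P q)).
Qed.

Lemma Ckon_potX {R : realType} (p q : R) n : 1 < p -> p < q ->
  Ckon 1 setT (potX p q n).
Proof.
move=> p1 pq; have oT : open (setT : set (R * R)) by exact: openT.
have P a : 1 < a -> Ckon 1 setT (fun z : R * R => (a - 1) ^+ n *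
    (kap (a + 1) (sin z.2) * expR ((a - 1) * z.1))).
  move=> a1; apply: (Ckon_mul oT (Ckon_cst _ _ _)); apply: (Ckon_mul oT).
    have a2 : 2 < a + 1 by lra.
    apply: (Ckon_comp1 oT (Ckon_kap a2) _ (fun _ _ => I)).
    apply: (Ckon_comp1 oT (Ckon_sin_cos 1).1 _ (fun _ _ => I)).
    exact: Ckon_snd.
  apply: (Ckon_comp1 oT (Ckon_expR 1) _ (fun _ _ => I)).
  by apply: (Ckon_mul oT (Ckon_cst _ _ _)); exact: Ckon_fst.
by apply: (Ckon_add oT); apply: P => //; lra.
Qed.

Lemma Ckon_slow {R : realType} (p q : R) : 1 < p -> p < q ->
  Ckon 1 setT (slow p q).
Proof.
move=> p1 pq; have oT : open (setT : set (R * R)) by exact: openT.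
apply: (Ckon_comp1 oT (Ckon_powR 1 (- 2^-1))).
  exact: (Ckon_add oT (Ckon_cst _ _ _) (Ckon_potX _ p1 pq)).
by move=> z _ /=; rewrite addr_gt0// potX_gt0.
Qed.

Lemma powR_neg3half {R : realType} (x : R) : 0 < x ->
  x `^ (- 2^-1 - 1) = (x `^ (- 2^-1)) ^+ 3.
Proof.
move=> x0; rewrite -powR_mulrn ?powR_ge0// -powRrM; congr (_ `^ _).
by field.
Qed.

Lemma is_derive_slow {R : realType} (p q : R) z v dx : 1 < p -> p < q ->
  is_derive z v (potX p q 0) dx ->
  is_derive z v (slow p q) (- 2^-1 * (slow p q z ^+ 3 * dx)).
Proof.
move=> p1 pq Dx; have X0 := potX_gt0 0 z p1 pq.
have Q0 : 0 < 1 + potX p q 0 z by lra.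
have D0 : is_derive z v (fun z => 1 + potX p q 0 z) dx.
  have := @is_deriveD _ _ _ (fun=> 1 : R) _ z v 0 _ (is_derive_cst (1 : R) z v) Dx.
  by rewrite add0r.
have := is_derive_chain1 D0 (is_derive1_powR (- 2^-1) Q0).
by rewrite powR_neg3half// -mulrA.
Qed.

Lemma is_derive_slow1 {R : realType} (p q : R) z : 1 < p -> p < q ->
  is_derive z (dir1 R) (slow p q) (slow1 p q z).
Proof. by move=> p1 pq; apply: is_derive_slow => //; exact: is_derive_potX. Qed.

Lemma is_derive_slow2 {R : realType} (p q : R) z : 1 < p -> p < q ->
  is_derive z (dir1 R) (slow1 p q) (slow2 p q z).
Proof.
move=> p1 pq; have Ds := is_derive_slow1 z p1 pq; have Dx := is_derive_potX p q 1 z.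
have D3 := @is_deriveX _ _ _ 3 _ _ _ Ds.
have M := @is_deriveM _ _ _ _ _ _ _ _ D3 Dx.
have Z := @is_deriveZ _ _ _ _ (- 2^-1) _ _ _ M.
by apply: is_derive_eq; rewrite /slow1 /slow2 /GRing.scale /= exprfctE /=; field.
Qed.

Lemma Ckon_slow1 {R : realType} (p q : R) : 1 < p -> p < q ->
  Ckon 1 setT (slow1 p q).
Proof.
move=> p1 pq; have oT : open (setT : set (R * R)) by exact: openT.
have Cs := Ckon_slow p1 pq.
apply: (Ckon_mul oT (Ckon_cst _ _ _)); apply: (Ckon_mul oT _ (Ckon_potX _ p1 pq)).
apply: (Ckon_eq oT _ (Ckon_mul oT Cs (Ckon_mul oT Cs Cs))) => z _.
by rewrite !exprS expr0 mulr1.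
Qed.

Lemma continuous_slow2 {R : realType} (p q : R) : 1 < p -> p < q ->
  continuous (slow2 p q).
Proof.
move=> p1 pq z; have Cs := Ckon_cont (Ckon_slow p1 pq) (I : setT z).
have C n : {for z, continuous (potX p q n)} := Ckon_cont (Ckon_potX n p1 pq) (I : setT z).
have CX n : {for z, continuous (fun z => slow p q z ^+ n)}.
  by apply: (@continuous_comp _ _ _ (slow p q) (fun x => x ^+ n)) => //;
    exact: exprn_continuous.
apply: (@continuousB _ _ _ (fun z => 3 / 4 * (slow p q z ^+ 5 * potX p q 1 z ^+ 2))
  (fun z => 2^-1 * (slow p q z ^+ 3 * potX p q 2 z)) z);
  apply: continuousM; try exact: cst_continuous;
  apply: continuousM; try exact: CX; last exact: C.
apply: (@continuous_comp _ _ _ (potX p q 1) (fun x => x ^+ 2)); first exact: C.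
exact: exprn_continuous.
Qed.

(** The theta derivative of [potX] is a bounded factor times the two exponentials, each of which is
    at most a multiple of [potX] because [kap] is bounded below. Again slow^2 [potX] <= 1 makes the
    bound independent of eta. *)
Lemma slow_dir2_bound {R : realType} (p q : R) : 1 < p -> p < q ->
  exists2 C, 0 <= C & forall z, `|'D_(dir2 R) (slow p q) z| <= C.
Proof.
move=> p1 pq; have q1 : 1 < q by lra.
have p2 : 2 < p + 1 by lra. have q2 : 2 < q + 1 by lra.
have [Cp Cp0 Hp] := kap_derive_bound p2; have [Cq Cq0 Hq] := kap_derive_bound q2.
pose m := Cp * ((p + 1) / 2) + Cq * ((q + 1) / 2).
have m0 : 0 <= m by rewrite addr_ge0// mulr_ge0//; lra.
exists m => // z.
pose K a := 'D_1 (kap (a + 1)) (sin z.2) * cos z.2.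
have DK a : 2 < a + 1 -> is_derive z (dir2 R) (fun z => kap (a + 1) (sin z.2)) (K a).
  move=> a2; apply: (@is_derive_affine R (R * R)%type R R (kap (a + 1) \o sin)
    snd snd z (dir2 R) (K a)) => //=.
  apply: (@is_derive_chain1 R R (kap (a + 1)) sin).
  exact: (@Ckon_is_derive R R R 0 setT (kap (a + 1)) 1 _ (Ckon_kap a2) I).
have DE a : is_derive z (dir2 R) (fun z => expR ((a - 1) * z.1)) 0.
  have E0 := @is_derive_affine R (R * R)%type R R (fun x => expR ((a - 1) * x))
    fst fst z (dir2 R) 0.
  by apply: E0 => //=; exact: is_derive0.
have P a : 2 < a + 1 -> is_derive z (dir2 R) (fun z => (a - 1) ^+ 0 *
      (kap (a + 1) (sin z.2) * expR ((a - 1) * z.1))) (K a * expR ((a - 1) * z.1)).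
  move=> a2; have M := @is_deriveM _ _ _ _ _ _ _ _ (DK a a2) (DE a).
  have Z := @is_deriveZ _ _ _ _ ((a - 1) ^+ 0) _ _ _ M.
  by apply: is_derive_eq; rewrite /GRing.scale /=; ring.
have DX := @is_deriveD _ _ _ _ _ _ _ _ _ (P p p2) (P q q2).
have [_ ->] := is_derive_slow p1 pq DX.
have g0 := slow_gt0 z p1 pq; have g1 := slow_lt1 z p1 pq.
have g2 := slow_sqr z p1 pq; have X0 := potX_gt0 0 z p1 pq.
have Kb a C : 0 <= C -> (forall v : R, `|v| <= 1 -> `|'D_1 (kap (a + 1)) v| <= C) ->
    `|K a| <= C.
  move=> C0 H; rewrite normrM -[leRHS]mulr1; apply: ler_pM => //.
    exact/H/norm_sin_le1.
  by rewrite ler_norml cos_geN1 cos_le1.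
have [E1 E2] := potX0_ge z p1 pq.
set x0 := potX p q 0 z in X0 g2 E1 E2; set g := slow p q z in g0 g1 g2 *.
have Eb a : 1 < a -> 2 / (a + 1) * expR ((a - 1) * z.1) <= x0 ->
    expR ((a - 1) * z.1) <= (a + 1) / 2 * x0.
  move=> a1 h; have a0 : 0 < (a + 1) / 2 by lra.
  rewrite -ler_pdivrMl//; apply: le_trans h; rewrite ler_pM2r ?expR_gt0//.
  by rewrite invf_div.
have Ep := Eb p p1 E1; have Eq := Eb q q1 E2.
have H : `|K p * expR ((p - 1) * z.1) + K q * expR ((q - 1) * z.1)| <= m * x0.
  have HB a C (e y : R) : 0 <= C -> `|K a| <= C -> 0 <= e -> e <= y ->
      `|K a * e| <= C * y.
    by move=> C0 KC e0 ey; rewrite normrM (ger0_norm e0) ler_pM.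
  have -> : m * x0 = Cp * ((p + 1) / 2 * x0) + Cq * ((q + 1) / 2 * x0).
    by rewrite /m; ring.
  apply: le_trans (ler_normD _ _) _; apply: lerD.
    by apply: HB => //; exact: Kb.
  by apply: HB => //; exact: Kb.
rewrite normrM normrN normfV (ger0_norm (_ : 0 <= 2)) ?ler0n//.
rewrite normrM (@ger0_norm _ (g ^+ 3)); last exact/exprn_ge0/ltW.
have gx : g ^+ 2 * x0 <= 1 by rewrite -g2 ler_wpM2l ?sqr_ge0//; lra.
have H3 : g ^+ 3 * `|K p * expR ((p - 1) * z.1) + K q * expR ((q - 1) * z.1)| <= m.
  apply: (@le_trans _ _ (g ^+ 2 * (m * x0))).
    apply: ler_pM => //; first exact/exprn_ge0/ltW.
    by rewrite exprS ger_pMl ?exprn_gt0// ltW.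
  by rewrite mulrCA ler_piMr.
have : 0 <= g ^+ 3 * `|K p * expR ((p - 1) * z.1) + K q * expR ((q - 1) * z.1)|.
  by rewrite mulr_ge0// exprn_ge0 ?ltW.
by lra.
Qed.

(** * Elapsed time and period *)

Definition time {R : realType} (p q : R) : R * R -> R := pint (slow p q).

Definition per {R : realType} (p q h : R) : R := time p q (h, 2 * pi).

Lemma Ckon_cont0 {R : realType} k (f : R * R -> R) : Ckon k setT f -> continuous f.
Proof. by move=> F z; exact: (Ckon_cont F I). Qed.

Lemma Ckon_pint_slow1 {R : realType} (p q : R) : 1 < p -> p < q ->
  Ckon 1 setT (pint (slow1 p q)).
Proof.
move=> p1 pq; have c1 := Ckon_cont0 (Ckon_slow1 p1 pq).
have c2 := continuous_slow2 p1 pq.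
apply: (@Ckon_partials R 0 setT _ (pint (slow2 p q)) (slow1 p q) openT).
- by move=> z _; apply: is_derive_pint1 => // y; exact: is_derive_slow2.
- by move=> z _; exact: is_derive_pint2.
- by move=> z _; exact: continuous_pint.
- by move=> z _; exact: continuous_pint.
- by move=> z _; exact: c1.
Qed.

Lemma is_derive_time1 {R : realType} (p q : R) z : 1 < p -> p < q ->
  is_derive z (dir1 R) (time p q) (pint (slow1 p q) z).
Proof.
move=> p1 pq; apply: is_derive_pint1.
- exact: Ckon_cont0 (Ckon_slow p1 pq).
- exact: Ckon_cont0 (Ckon_slow1 p1 pq).
- by move=> y; exact: is_derive_slow1.
Qed.

Lemma is_derive_time2 {R : realType} (p q : R) z : 1 < p -> p < q ->
  is_derive z (dir2 R) (time p q) (slow p q z).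
Proof. by move=> p1 pq; apply: is_derive_pint2; exact: Ckon_cont0 (Ckon_slow p1 pq). Qed.

(** One derivative is gained over [slow]: the theta derivative of [time] is [slow] itself, which is
    C^1, and the eta derivative is the integral of [slow1], which is C^1 because [slow1] and [slow2]
    are continuous. *)
Lemma Ckon_time {R : realType} (p q : R) : 1 < p -> p < q -> Ckon 2 setT (time p q).
Proof.
move=> p1 pq; apply: (@Ckon_partials R 1 setT _ (pint (slow1 p q)) (slow p q) openT).
- by move=> z _; exact: is_derive_time1.
- by move=> z _; exact: is_derive_time2.
- by move=> z _; apply: continuous_pint; exact: Ckon_cont0 (Ckon_slow p1 pq).
- exact: Ckon_pint_slow1.
- exact: Ckon_slow.
Qed.

Lemma is_derive_time_slice {R : realType} (p q h x : R) : 1 < p -> p < q ->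
  is_derive x 1 (fun y => time p q (h, y)) (slow p q (h, x)).
Proof.
move=> p1 pq; apply: (@is_derive_prim R (fun y => slow p q (h, y))).
by apply: continuous_slice2; exact: Ckon_cont0 (Ckon_slow p1 pq).
Qed.

Lemma time0 {R : realType} (p q h : R) : time p q (h, 0) = 0.
Proof. exact: prim0. Qed.

Lemma time_lt {R : realType} (p q h x y : R) : 1 < p -> p < q -> x < y ->
  time p q (h, x) < time p q (h, y).
Proof.
move=> p1 pq xy; rewrite -subr_gt0.
have [c _ ->] := @mean_value R (fun y => time p q (h, y)) _ x y
  (fun z _ => is_derive_time_slice h z p1 pq).
by rewrite mulr_gt0 ?subr_gt0// slow_gt0.
Qed.

Lemma time_inj {R : realType} (p q h x y : R) : 1 < p -> p < q ->
  time p q (h, x) = time p q (h, y) -> x = y.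
Proof.
move=> p1 pq E; have [xy|xy|//] := ltgtP x y.
  by have := time_lt h p1 pq xy; rewrite E ltxx.
by have := time_lt h p1 pq xy; rewrite E ltxx.
Qed.

(** [slow] depends on theta through sin(theta) only, so the gain over one turn has zero derivative
    in the starting angle. *)
Lemma time_2pi {R : realType} (p q h x : R) : 1 < p -> p < q ->
  time p q (h, x + 2 * pi) = time p q (h, x) + per p q h.
Proof.
move=> p1 pq; have D (y : R) : is_derive y 1
    (fun y => time p q (h, y + 2 * pi) - time p q (h, y)) 0.
  have D1 := is_derive_time_slice h y p1 pq.
  have D2 : is_derive y 1 (fun y => time p q (h, y + 2 * pi)) (slow p q (h, y) * 1).
    apply: (@is_derive_chain1 R R (fun y => time p q (h, y)) (fun y => y + 2 * pi)).
      by apply: is_derive_eq; rewrite addr0.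
    have := is_derive_time_slice h (y + 2 * pi) p1 pq.
    by congr is_derive; rewrite /slow /potX /= mulr_natl sinD2pi.
  have := @is_deriveB _ _ _ _ _ _ _ _ _ D2 D1.
  by rewrite mulr1 subrr.
have := @is_derive_0_eq R _ x 0 (fun y _ => D y).
by rewrite add0r time0 subr0 => E; rewrite /per -E; ring.
Qed.

Lemma time_surj {R : realType} (p q h t : R) : 1 < p -> p < q ->
  exists x, time p q (h, x) = t.
Proof.
move=> p1 pq; have q1 : 1 < q by lra.
(* As [kap] <= 1, this bounds 1 + [potX], and with [slow] < 1 the energy identity gives slow >= 1 /
   m at this fixed amplitude. Angles of size m |t| then suffice for the intermediate value
   theorem. *)
pose m := 1 + (expR ((p - 1) * h) + expR ((q - 1) * h)).
have e1 := expR_gt0 ((p - 1) * h); have e2 := expR_gt0 ((q - 1) * h).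
have m1 : 1 <= m by rewrite /m; lra.
have lb x : m^-1 <= slow p q (h, x).
  have g0 := slow_gt0 (h, x) p1 pq; have g1 := slow_lt1 (h, x) p1 pq.
  have g2 := slow_sqr (h, x) p1 pq.
  have Xm : 1 + potX p q 0 (h, x) <= m.
    have /andP[_ h1] := kap_sin_bounds x p1; have /andP[_ h2] := kap_sin_bounds x q1.
    rewrite /m /potX !expr0 !mul1r /= lerD2l lerD//; by rewrite ger_pMl.
  have X0 := potX_gt0 0 (h, x) p1 pq.
  rewrite -[_^-1]mul1r ler_pdivrMr//; last by lra.
  rewrite -g2 expr2 -mulrA ler_pM2l//.
  apply: (@le_trans _ _ (slow p q (h, x) * m)); first by rewrite ler_pM2l.
  by rewrite ger_pMl ?ltW//; lra.
have m0 : 0 < m by lra.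
pose b := m * `|t|.
have b0 : 0 <= b by rewrite mulr_ge0// ltW.
have B x : time p q (h, x) = slow p q (h, x) * 0 + time p q (h, x) by rewrite mulr0 add0r.
have up : `|t| <= time p q (h, b).
  have [c _] := @mean_value R (fun y => time p q (h, y)) _ 0 b
    (fun z _ => is_derive_time_slice h z p1 pq).
  rewrite time0 !subr0 => ->; apply: (@le_trans _ _ (m^-1 * b)).
    by rewrite /b mulKf// gt_eqF.
  by rewrite ler_wpM2r.
have lo : time p q (h, - b) <= - `|t|.
  have [c _] := @mean_value R (fun y => time p q (h, y)) _ 0 (- b)
    (fun z _ => is_derive_time_slice h z p1 pq).
  rewrite time0 !subr0 mulrN => ->; rewrite lerN2; apply: (@le_trans _ _ (m^-1 * b)).
    by rewrite /b mulKf// gt_eqF.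
  by rewrite ler_wpM2r.
have bb : - b <= b by lra.
have [||x _ xt] := @IVT R (fun y => time p q (h, y)) (- b) b t bb.
- apply: continuous_subspaceT => x; exact: is_derive_continuous (is_derive_time_slice h x p1 pq).
- have := ler_norm t; have := lerNnormlW (lexx `|t|) => t1 t2.
  by rewrite ge_min le_max; apply/andP; split; apply/orP; [left|right]; lra.
by exists x.
Qed.

Lemma time_abs_ge {R : realType} (p q h x : R) : 1 < p -> p < q -> h <= 0 ->
  `|x| <= 3 * `|time p q (h, x)|.
Proof.
move=> p1 pq h0.
have [c _] := @mean_value R (fun y => time p q (h, y)) _ 0 x
    (fun z _ => is_derive_time_slice h z p1 pq).
rewrite time0 !subr0 => ->; have g3 := @slow_ge3 R p q (h, c) p1 pq h0.
rewrite normrM (ger0_norm (_ : 0 <= slow p q (h, c))); last by lra.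
by rewrite mulrA ler_peMl//; lra.
Qed.

Lemma pi2_gt0 {R : realType} : 0 < 2 * pi :> R.
Proof. by rewrite mulr_gt0// pi_gt0. Qed.

Lemma per_bounds {R : realType} (p q h : R) : 1 < p -> p < q ->
  0 < per p q h < 2 * pi.
Proof.
move=> p1 pq; have P := @pi2_gt0 R.
have [c _] := @mean_value R (fun y => time p q (h, y)) _ 0 (2 * pi)
    (fun z _ => is_derive_time_slice h z p1 pq).
rewrite time0 !subr0 /per => ->.
have g0 := slow_gt0 (h, c) p1 pq; have g1 := slow_lt1 (h, c) p1 pq.
by rewrite mulr_gt0//= gtr_pMl.
Qed.

Lemma is_derive_per {R : realType} (p q h : R) : 1 < p -> p < q ->
  is_derive h 1 (per p q) (pint (slow1 p q) (h, 2 * pi)).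
Proof.
move=> p1 pq; have D := is_derive_time1 (h, 2 * pi) p1 pq.
have {}D : is_derive (h *: dir1 R + (0, 2 * pi)) (dir1 R) (time p q)
   (pint (slow1 p q) (h, 2 * pi)) by rewrite scale_pairD mulr1 mulr0 addr0 add0r.
have E : (fun x : R => time p q (x *: dir1 R + (0, 2 * pi))) = per p q.
  by apply/funext => x; rewrite /per scale_pairD mulr1 mulr0 addr0 add0r.
rewrite -E; exact: (@is_derive_line R _ R _ (0, 2 * pi) (dir1 R) h _).1 D.
Qed.

Lemma is_derive_pint_slice {R : realType} (G : R * R -> R) h (x : R) : continuous G ->
  is_derive x 1 (fun y => pint G (h, y)) (G (h, x)).
Proof.
by move=> cG; apply: (@is_derive_prim R (fun y => G (h, y))); exact: continuous_slice2.
Qed.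

Lemma pint0 {R : realType} (G : R * R -> R) h : pint G (h, 0) = 0.
Proof. exact: prim0. Qed.

Lemma pint_slow1_lt0 {R : realType} (p q h x : R) : 1 < p -> p < q -> 0 < x ->
  pint (slow1 p q) (h, x) < 0.
Proof.
move=> p1 pq x0; have c1 := Ckon_cont0 (Ckon_slow1 p1 pq).
have [c _] := @mean_value R (fun y => pint (slow1 p q) (h, y)) _ 0 x
    (fun z _ => is_derive_pint_slice h z c1).
rewrite pint0 !subr0 => ->; rewrite nmulr_rlt0//.
by have /andP[] := slow1_bounds (h, c) p1 pq.
Qed.

Lemma per_lt {R : realType} (p q h k : R) : 1 < p -> p < q -> h < k ->
  per p q k < per p q h.
Proof.
move=> p1 pq hk; rewrite -subr_lt0.
have [c _ ->] := @mean_value R (per p q) _ h k (fun z _ => is_derive_per z p1 pq).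
by rewrite nmulr_rlt0 ?subr_gt0//; apply: pint_slow1_lt0 => //; exact: pi2_gt0.
Qed.

Lemma is_derive_per2 {R : realType} (p q h : R) : 1 < p -> p < q ->
  is_derive h 1 (fun h => pint (slow1 p q) (h, 2 * pi)) (pint (slow2 p q) (h, 2 * pi)).
Proof.
move=> p1 pq; have D : is_derive (h *: dir1 R + (0, 2 * pi)) (dir1 R) (pint (slow1 p q))
   (pint (slow2 p q) (h, 2 * pi)).
  rewrite scale_pairD mulr1 mulr0 addr0 add0r; apply: is_derive_pint1.
  - exact: Ckon_cont0 (Ckon_slow1 p1 pq).
  - exact: continuous_slow2.
  - by move=> y; exact: is_derive_slow2.
have E : (fun x : R => pint (slow1 p q) (x *: dir1 R + (0, 2 * pi))) =
    (fun x => pint (slow1 p q) (x, 2 * pi)).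
  by apply/funext => x; rewrite scale_pairD mulr1 mulr0 addr0 add0r.
rewrite -E; exact: (@is_derive_line R _ R _ (0, 2 * pi) (dir1 R) h _).1 D.
Qed.

Lemma continuous_per2 {R : realType} (p q : R) : 1 < p -> p < q ->
  continuous (fun h => pint (slow2 p q) (h, 2 * pi)).
Proof.
move=> p1 pq h; apply: (@continuous_comp _ _ _ (fun h => (h, 2 * pi)) (pint (slow2 p q))).
  by apply: continuous_pair => /=; [exact: cvg_id|exact: cst_continuous].
by apply: continuous_pint; exact: continuous_slow2.
Qed.

Lemma Ckon_per {R : realType} (p q : R) : 1 < p -> p < q -> Ckon 2 setT (per p q).
Proof.
move=> p1 pq; have oT : open (setT : set R) by exact: openT.
apply: (Ckon_real oT (fun h _ => is_derive_per h p1 pq)).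
apply: (Ckon_real oT (fun h _ => is_derive_per2 h p1 pq)) => h _.
exact: continuous_per2.
Qed.

Lemma expRN_le {R : realType} (t : R) : 0 <= t -> expR (- t) <= (1 + t)^-1.
Proof.
move=> t0; rewrite expRN lef_pV2 ?posrE ?expR_gt0//; last by lra.
exact: expR_ge1Dx.
Qed.

(** The period tends to 2 pi as the amplitude tends to 0: slow >= slow^2 = 1 / (1 + [potX]) >= 1 -
    [potX]. *)
Lemma per_lower {R : realType} (p q h : R) : 1 < p -> p < q -> h <= 0 ->
  2 * pi * (1 - 2 * expR ((p - 1) * h)) <= per p q h.
Proof.
move=> p1 pq h0; have P := @pi2_gt0 R.
have [c _] := @mean_value R (fun y => time p q (h, y)) _ 0 (2 * pi)
    (fun z _ => is_derive_time_slice h z p1 pq).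
rewrite time0 !subr0 /per => ->; rewrite mulrC ler_pM2r//.
have g0 := slow_gt0 (h, c) p1 pq; have g1 := slow_lt1 (h, c) p1 pq.
have g2 := slow_sqr (h, c) p1 pq; have X0 := potX_gt0 0 (h, c) p1 pq.
have := @potX0_le2 R p q (h, c) p1 pq h0 => /= X2; nra.
Qed.

(** The period tends to 0 as the amplitude grows: slow^2 [potX] <= 1, and [potX] dominates a
    multiple of exp((q-1) h). *)
Lemma per_upper {R : realType} (p q h : R) : 1 < p -> p < q ->
  per p q h ^+ 2 <= (2 * pi) ^+ 2 * ((q + 1) / 2 * expR (- ((q - 1) * h))).
Proof.
move=> p1 pq; have P := @pi2_gt0 R.
have [c _] := @mean_value R (fun y => time p q (h, y)) _ 0 (2 * pi)
    (fun z _ => is_derive_time_slice h z p1 pq).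
rewrite time0 !subr0 /per => ->; rewrite exprMn mulrC ler_pM2l ?exprn_gt0//.
have g0 := slow_gt0 (h, c) p1 pq; have g2 := slow_sqr (h, c) p1 pq.
have [_ /= X2] := potX0_ge (h, c) p1 pq; have X0 := potX_gt0 0 (h, c) p1 pq.
have e0 := expR_gt0 ((q - 1) * h).
have G2 : 0 < slow p q (h, c) ^+ 2 by rewrite exprn_gt0.
rewrite expRN ler_pdivlMr//; set W := expR _ in X2 e0 *.
have hW : W <= (q + 1) / 2 * potX p q 0 (h, c).
  by rewrite -ler_pdivrMl ?invf_div//; lra.
apply: (le_trans (ler_wpM2l (ltW G2) hW)).
have -> : slow p q (h, c) ^+ 2 * ((q + 1) / 2 * potX p q 0 (h, c)) =
   (q + 1) / 2 * (1 - slow p q (h, c) ^+ 2) by rewrite -[X in X - _]g2; ring.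
by rewrite ger_pMr; lra.
Qed.

Global Opaque prim pint time per.

(** Intermediate value theorem between a small amplitude, where [per_lower] puts the period above
    the target, and a large one, where [per_upper] puts it below. *)
Lemma per_surj {R : realType} (p q y : R) : 1 < p -> p < q -> 0 < y < 1 ->
  exists h, per p q h = 2 * pi * y.
Proof.
move=> p1 pq /andP[y0 y1]; have P := @pi2_gt0 R.
have p0 : 0 < p - 1 by lra. have q0 : 0 < q - 1 by lra.
have d0 : 0 < 1 - y by lra.
(* With (p-1) a = -t, [per_lower] asks for exp(-t) <= (1 - y) / 2, and exp(-t) <= 1 / (1 + t). *)
have [t t0 tE] : exists2 t, 0 < t & (1 + t)^-1 <= (1 - y) / 2.
  exists (2 / (1 - y)); first by rewrite divr_gt0.
  have -> : 1 + 2 / (1 - y) = (3 - y) / (1 - y) by field; rewrite gt_eqF.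
  by rewrite invf_div ler_pdivrMr; [nra|lra].
have [a a0 aE] : exists2 a, a < 0 & (p - 1) * a = - t.
  exists (- (t / (p - 1))); first by rewrite oppr_lt0 divr_gt0.
  by field; rewrite gt_eqF.
have ha : 2 * pi * y <= per p q a.
  apply: le_trans (per_lower p1 pq (ltW a0)); rewrite ler_pM2l// aE.
  have := expRN_le (ltW t0); lra.
have y2 : 0 < y ^+ 2 by rewrite exprn_gt0.
(* With (q-1) b = s, [per_upper] asks for (q+1)/2 exp(-s) <= y^2; here exp(-s) is estimated by 1 /
   s. *)
have [s s0 sE] : exists2 s, 0 < s & (q + 1) / 2 * s^-1 = y ^+ 2.
  exists ((q + 1) / (2 * y ^+ 2)); first by rewrite divr_gt0//; [lra|rewrite mulr_gt0].
  by field; rewrite !gt_eqF//; lra.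
have [b b0 bE] : exists2 b, 0 < b & (q - 1) * b = s.
  exists (s / (q - 1)); first by rewrite divr_gt0.
  by field; rewrite gt_eqF.
have hs : (q + 1) / 2 * expR (- s) <= y ^+ 2.
  have h2 : (1 + s)^-1 <= s^-1 by rewrite lef_pV2 ?posrE//; lra.
  by rewrite -sE ler_pM2l; [exact: le_trans (expRN_le (ltW s0)) h2|lra].
have hb : per p q b <= 2 * pi * y.
  have Py0 : 0 <= 2 * pi * y by rewrite mulr_ge0// ltW.
  have hb2 : per p q b ^+ 2 <= (2 * pi * y) ^+ 2.
    apply: le_trans (per_upper b p1 pq) _; rewrite bE [leRHS]exprMn.
    by rewrite ler_pM2l ?exprn_gt0.
  rewrite leNgt; apply/negP => hlt.
  by have := ltr_pM Py0 Py0 hlt hlt; rewrite -!expr2 ltNge hb2.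
have ab : a <= b by apply: ltW; exact: lt_trans b0.
have cp : {within `[a, b], continuous (per p q)}.
  apply: continuous_subspaceT => h.
  exact: is_derive_continuous (is_derive_per h p1 pq).
have hm : Num.min (per p q a) (per p q b) <= 2 * pi * y <=
    Num.max (per p q a) (per p q b).
  rewrite ge_min le_max; apply/andP; split; apply/orP; [by right|by left].
by have [h _ hE] := IVT ab cp hm; exists h.
Qed.

(** * The angle as a function of time *)

(** The inverse of [time] at fixed eta. For 1 < p < q the default 0 is never taken, by [time_surj],
    and the choice is unique by [time_inj]. *)
Definition theta {R : realType} (p q : R) (z : R * R) : R :=
  xget 0 [set x | time p q (z.1, x) = z.2].

Lemma thetaP {R : realType} (p q : R) z : 1 < p -> p < q ->
  time p q (z.1, theta p q z) = z.2.
Proof.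
move=> p1 pq; have [x xE] := time_surj z.1 z.2 p1 pq.
by rewrite /theta; case: xgetP => [y _ //|/(_ x)]; rewrite /= xE.
Qed.

Lemma theta_eq {R : realType} (p q h t x : R) : 1 < p -> p < q ->
  time p q (h, x) = t -> theta p q (h, t) = x.
Proof.
move=> p1 pq E; apply: (@time_inj R p q h) => //.
by rewrite E; exact: (@thetaP R p q (h, t)).
Qed.

Lemma theta_2pi {R : realType} (p q h t : R) : 1 < p -> p < q ->
  theta p q (h, t + per p q h) = theta p q (h, t) + 2 * pi.
Proof.
move=> p1 pq; apply: theta_eq => //; rewrite time_2pi//; congr (_ + _).
exact: (@thetaP R p q (h, t)).
Qed.

Lemma theta_norm_le {R : realType} (p q h t : R) : 1 < p -> p < q -> h <= 0 ->
  `|theta p q (h, t)| <= 3 * `|t|.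
Proof.
move=> p1 pq h0; have E := @thetaP R p q (h, t) p1 pq; rewrite /= in E.
by have := time_abs_ge (theta p q (h, t)) p1 pq h0; rewrite E.
Qed.

(** By strict monotonicity in the angle, [theta] lies within e of x as soon as the time at x - e is
    below and the time at x + e above the prescribed one, and these are open conditions. *)
Lemma continuous_theta {R : realType} (p q : R) : 1 < p -> p < q ->
  continuous (theta p q).
Proof.
move=> p1 pq z; apply/cvgrPdist_lt => e e0; set x := theta p q z.
have E : time p q (z.1, x) = z.2 by exact: thetaP.
have C y : {for z, continuous (fun w => time p q (w.1, y) - w.2)}.
  apply: continuousB; last exact: cvg_snd.
  apply: (@continuous_comp _ _ _ (fun w => (w.1, y)) (time p q)).
    by apply: continuous_pair; [exact: cvg_fst|exact: cst_continuous].
  exact: (Ckon_cont (Ckon_time p1 pq) I).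
have l1 : time p q (z.1, x - e) - z.2 < 0.
  by rewrite subr_lt0 -[ltRHS]E; apply: time_lt => //; lra.
have l2 : 0 < time p q (z.1, x + e) - z.2.
  by rewrite subr_gt0 -[ltLHS]E; apply: time_lt => //; lra.
have N1 : \forall w \near z, time p q (w.1, x - e) - w.2 < 0 by exact: (cvgr_lt _ (C (x - e)) _ l1).
have N2 : \forall w \near z, 0 < time p q (w.1, x + e) - w.2 by exact: (cvgr_gt _ (C (x + e)) _ l2).
apply: filterS2 N1 N2 => w; rewrite subr_lt0 subr_gt0 => w1 w2.
have Ew := thetaP w p1 pq; set y := theta p q w in Ew *.
rewrite -[in w.2]Ew in w1; rewrite -[in w.2]Ew in w2.
have M a b : time p q (w.1, a) < time p q (w.1, b) -> a < b.
  move=> ab; rewrite ltNge; apply/negP; rewrite le_eqVlt => /orP[/eqP ba|ba].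
    by move: ab; rewrite ba ltxx.
  by have := time_lt w.1 p1 pq ba; rewrite ltNge (ltW ab).
have a1 := M _ _ w1; have a2 := M _ _ w2; clearbody x y.
by move: a1 a2; rewrite ltr_norml; clear => a1 a2; apply/andP; split; lra.
Qed.

(** Makes the defect of [slow] and its eta derivatives comparable to the one quantity [potX] for
    amplitudes at most 1. The constants come from slow >= 1/3 and slow^2 >= 1/3: 1 - slow = slow^2
    [potX] / (1 + slow) gives 1/6, and slow^3 / 2 >= 1/54. *)
Lemma slow_cmp {R : realType} (p q h x : R) : 1 < p -> p < q -> h <= 0 ->
  [/\ potX p q 0 (h, x) / 6 <= 1 - slow p q (h, x) <= potX p q 0 (h, x),
      (p - 1) / 54 * potX p q 0 (h, x) <= - slow1 p q (h, x)
        <= (q - 1) / 2 * potX p q 0 (h, x)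
    & - (2 * (q - 1) ^+ 2 * potX p q 0 (h, x)) <= slow2 p q (h, x)
        <= 2 * (q - 1) ^+ 2 * potX p q 0 (h, x)].
Proof.
move=> p1 pq h0; set z := (h, x).
have g0 := slow_gt0 z p1 pq; have g1 := slow_lt1 z p1 pq.
have g3 : 3^-1 <= slow p q z by exact: slow_ge3.
have g2 := slow_sqr z p1 pq; have X0 := potX_gt0 0 z p1 pq.
have X2 : potX p q 0 z <= 2.
  apply: le_trans (@potX0_le2 R p q z p1 pq h0) _ => /=.
  have : expR ((p - 1) * h) <= 1 by rewrite -[leRHS]expR0 ler_expR mulr_ge0_le0//; lra.
  lra.
have Y1 := potX_gt0 1 z p1 pq; have /andP[Y1'' Y1'] := potX_le 1 z p1 pq.
have Y2 := potX_gt0 2 z p1 pq; have /andP[_ Y2'] := potX_le 2 z p1 pq.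
rewrite !expr1 in Y1' Y1''; rewrite /slow1 /slow2.
set g := slow p q z in g0 g1 g2 g3 *; set x0 := potX p q 0 z in X0 X2 g2 Y1' Y1'' Y2' *.
set x1 := potX p q 1 z in Y1 Y1' Y1'' *; set x2 := potX p q 2 z in Y2 Y2' *.
have q0 : 0 < q - 1 by lra.
have q2 : 0 < (q - 1) ^+ 2 by rewrite exprn_gt0.
have gg : 3^-1 <= g ^+ 2.
  rewrite -[_^-1]mul1r ler_pdivrMr// -[leLHS]g2 ler_wpM2l ?sqr_ge0//; lra.
have gx : g ^+ 2 * x0 <= x0 by rewrite ger_pMl// expr_le1// ltW.
have gx3 : x0 / 3 <= g ^+ 2 * x0 by rewrite mulrC ler_pM2r.
have e1 : (1 - g) * (1 + g) = g ^+ 2 * x0 by rewrite (_ : g ^+ 2 * x0 = 1 - g ^+ 2); [ring|rewrite -[X in X - _]g2; ring].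
have g33 : 27^-1 <= g ^+ 3.
  have -> : 27^-1 = 3^-1 ^+ 3 :> R by field.
  by rewrite lerXn2r ?nnegrE ?invr_ge0// ltW.
have g31 : g ^+ 3 <= 1 by rewrite exprn_ile1// ltW.
have g51 : g ^+ 5 <= 1 by rewrite exprn_ile1// ltW.
have g30 : 0 < g ^+ 3 by rewrite exprn_gt0.
have g50 : 0 < g ^+ 5 by rewrite exprn_gt0.
have h1 : g ^+ 3 * x1 <= (q - 1) * x0.
  by apply: le_trans Y1'; rewrite ger_pMl.
have h2 : 27^-1 * ((p - 1) * x0) <= g ^+ 3 * x1.
  by apply: ler_pM => //; rewrite mulr_ge0 ?(ltW X0)//; lra.
have h3 : g ^+ 5 * x1 ^+ 2 <= 2 * ((q - 1) ^+ 2 * x0).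
  apply: (@le_trans _ _ (x1 ^+ 2)); first by rewrite ger_pMl ?exprn_gt0.
  apply: (@le_trans _ _ (((q - 1) * x0) ^+ 2)).
    by rewrite lerXn2r// nnegrE ltW// mulr_gt0.
  have -> : ((q - 1) * x0) ^+ 2 = x0 * ((q - 1) ^+ 2 * x0) by ring.
  by rewrite ler_pM2r// mulr_gt0.
have h4 : g ^+ 3 * x2 <= (q - 1) ^+ 2 * x0.
  by apply: le_trans Y2'; rewrite ger_pMl.
have h5 : 0 < g ^+ 5 * x1 ^+ 2 by rewrite mulr_gt0// exprn_gt0.
have h6 : 0 < g ^+ 3 * x2 by rewrite mulr_gt0.
split; apply/andP; split; try lra; nra.
Qed.

(** Integration of [slow_cmp] over one turn, with the integral [A] of [potX] as intermediary: A / 6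
    <= D <= A. The factor 12 is 2 times 6. These bounds on logarithmic derivatives of D need no
    expansion of the period. *)
Lemma per_cmp {R : realType} (p q h : R) : 1 < p -> p < q -> h <= 0 ->
  let D := 2 * pi - per p q h in
  [/\ (p - 1) / 54 * D <= - pint (slow1 p q) (h, 2 * pi),
      `|pint (slow2 p q) (h, 2 * pi)| <= 12 * (q - 1) ^+ 2 * D
    & (2 * pi) / (3 * (p + 1)) * expR ((p - 1) * h) <= D].
Proof.
move=> p1 pq h0 D; have P0 : 0 <= 2 * pi :> R by rewrite ltW// pi2_gt0.
have c0 := Ckon_cont0 (Ckon_potX 0 p1 pq).
have c1 := Ckon_cont0 (Ckon_slow1 p1 pq); have c2 := continuous_slow2 p1 pq.
pose A := pint (potX p q 0) (h, 2 * pi).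
have DA (k : R) (x : R) : is_derive x 1 (fun y => k * pint (potX p q 0) (h, y))
    (k * potX p q 0 (h, x)).
  exact: (@is_deriveZ _ _ _ _ k _ _ _ (is_derive_pint_slice h x c0)).
have A0 k : k * pint (potX p q 0) (h, 0) = 0 by rewrite pint0 mulr0.
have DT (x : R) : is_derive x 1 (fun y => y - time p q (h, y)) (1 - slow p q (h, x)).
  apply: (@is_deriveB _ _ _ id (fun y => time p q (h, y))).
  exact: is_derive_time_slice.
have T0 : 0 - time p q (h, 0) = 0 by rewrite time0 subr0.
have D1 (x : R) := is_derive_pint_slice h x c1.
have D2 (x : R) := is_derive_pint_slice h x c2.
have DN1 (x : R) : is_derive x 1 (fun y => - pint (slow1 p q) (h, y)) (- slow1 p q (h, x)).
  exact: (@is_deriveN _ _ _ _ _ _ _ (D1 x)).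
have N0 : - pint (slow1 p q) (h, 0) = 0 by rewrite pint0 oppr0.
have cmp x := slow_cmp x p1 pq h0.
have DA6 : 6^-1 * A <= D.
  apply: (prim_le (A0 _) T0 (DA _) DT P0) => x _.
  by have [/andP[+ _] _ _] := cmp x; lra.
have DA1 : D <= 1 * A.
  apply: (prim_le T0 (A0 _) DT (DA _) P0) => x _.
  by have [/andP[_ +] _ _] := cmp x; lra.
have B1 : (p - 1) / 54 * A <= - pint (slow1 p q) (h, 2 * pi).
  apply: (prim_le (A0 _) N0 (DA _) DN1 P0) => x _.
  by have [_ /andP[+ _] _] := cmp x.
have B2 : pint (slow2 p q) (h, 2 * pi) <= 2 * (q - 1) ^+ 2 * A.
  apply: (prim_le (pint0 _ _) (A0 _) D2 (DA _) P0) => x _.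
  by have [_ _ /andP[_ +]] := cmp x.
have B3 : - (2 * (q - 1) ^+ 2) * A <= pint (slow2 p q) (h, 2 * pi).
  apply: (prim_le (A0 _) (pint0 _ _) (DA _) D2 P0) => x _.
  by have [_ _ /andP[+ _]] := cmp x; rewrite mulNr.
have DL (x : R) : is_derive x 1 (fun y => (2 / (p + 1) * expR ((p - 1) * h)) * y)
    (2 / (p + 1) * expR ((p - 1) * h)).
  have := @is_deriveZ _ _ _ _ (2 / (p + 1) * expR ((p - 1) * h)) _ _ _ (is_derive_id x (1 : R)).
  by rewrite /GRing.scale /= mulr1.
have B4 : (2 / (p + 1) * expR ((p - 1) * h)) * (2 * pi) <= 1 * A.
  apply: (prim_le (mulr0 _) (A0 _) DL (DA _) P0) => x _.
  by rewrite mul1r; have [] := potX0_ge (h, x) p1 pq.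
have q2 : 0 <= (q - 1) ^+ 2 by exact: sqr_ge0.
split.
- by apply: le_trans B1; rewrite ler_pM2l; lra.
- have : 2 * (q - 1) ^+ 2 * A <= 12 * (q - 1) ^+ 2 * D.
    have -> : 12 * (q - 1) ^+ 2 * D = 2 * (q - 1) ^+ 2 * (6 * D) by ring.
    by rewrite ler_wpM2l ?mulr_ge0//; lra.
  by rewrite ler_norml => ?; apply/andP; split; lra.
- apply: le_trans DA6; have -> : 2 * pi / (3 * (p + 1)) * expR ((p - 1) * h) =
    6^-1 * (2 / (p + 1) * expR ((p - 1) * h) * (2 * pi)).
    by field; rewrite gt_eqF//; lra.
  by rewrite ler_pM2l ?invr_gt0// -[A]mul1r.
Qed.

(** * The amplitude as a function of the radius *)

Lemma per_derive_lt0 {R : realType} (p q h : R) : 1 < p -> p < q ->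
  pint (slow1 p q) (h, 2 * pi) < 0.
Proof. by move=> p1 pq; apply: pint_slow1_lt0 => //; exact: pi2_gt0. Qed.

(** Pointwise solutions come from [per_surj]; strict monotonicity of the period makes the chosen
    function continuous, and the negative derivative of the period then makes it C^2 by the implicit
    function theorem. *)
Lemma amplitude_exists {R : realType} (p q : R) (m : R -> R) : 1 < p -> p < q ->
  Ckon 2 [set s : R | 0 < s] m -> (forall s, 0 < s -> 0 < m s < 1) ->
  exists h : R -> R, Ckon 2 [set s : R | 0 < s] h /\
    forall s, 0 < s -> per p q (h s) = 2 * pi * (1 - m s).
Proof.
move=> p1 pq Cm m01; set P := [set s : R | 0 < s].
have oP : open P by exact: open_pos.
have ex s : exists h, 0 < s -> per p q h = 2 * pi * (1 - m s).
  have [s0|s0] := pselect (0 < s); last by exists 0.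
  have /andP[m0 m1] := m01 s s0.
  have m2 : 0 < 1 - m s < 1 by apply/andP; split; lra.
  by have [h hE] := per_surj p1 pq m2; exists h.
have [h hE] := choice ex; exists h; split; last exact: hE.
have Cc : Ckon 2 P (fun s => 2 * pi * (1 - m s)).
  apply: (Ckon_mul oP (Ckon_cst _ _ _)).
  exact: (Ckon_sub_fun oP (Ckon_cst _ _ _) Cm).
have oT : open (setT : set (R * R)) by exact: openT.
(* The period is read as a function of two variables with a dummy first one, to fit the shape of
   [Ckon_implicit]. *)
have CF : Ckon 2 setT (fun z : R * R => per p q z.2).
  exact: (@Ckon_comp1 R _ 2 setT setT (per p q) snd oT (Ckon_per p1 pq) (Ckon_snd 2 oT)).
have DF z : is_derive z (dir2 R) (fun z : R * R => per p q z.2)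
    (pint (slow1 p q) (z.2, 2 * pi)).
  have := is_derive_chain1 (is_derive_snd z (dir2 R)) (is_derive_per z.2 p1 pq).
  by rewrite mulr1.
apply: (@Ckon_implicit R R 2 P setT (fun z => per p q z.2) (fun=> 0) h
  (fun s => 2 * pi * (1 - m s)) oP oT CF (Ckon_cst _ _ _) Cc _ _ hE _).1 => //; last first.
  by move=> z _; have [_ ->] := DF z; rewrite lt_eqF//; exact: per_derive_lt0.
move=> s s0; apply/cvgrPdist_lt => e e0.
have C : {for s, continuous (fun s => 2 * pi * (1 - m s))} := Ckon_cont Cc s0.
have l1 : per p q (h s + e) < 2 * pi * (1 - m s).
  by rewrite -(hE s s0); apply: per_lt => //; rewrite ltrDl.
have l2 : 2 * pi * (1 - m s) < per p q (h s - e).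
  by rewrite -(hE s s0); apply: per_lt => //; rewrite gtrBl.
have N1 : \forall t \near s, per p q (h s + e) < 2 * pi * (1 - m t) by exact: (cvgr_gt _ C _ l1).
have N2 : \forall t \near s, 2 * pi * (1 - m t) < per p q (h s - e) by exact: (cvgr_lt _ C _ l2).
have N3 : \forall t \near s, P t by exact: open_nbhs_nbhs.
apply: filterS3 N1 N2 N3 => t t1 t2 t0.
rewrite -(hE t t0) in t1; rewrite -(hE t t0) in t2.
have M a b : per p q a < per p q b -> b < a.
  move=> ab; rewrite ltNge; apply/negP; rewrite le_eqVlt => /orP[/eqP ba|ba].
    by move: ab; rewrite ba ltxx.
  by have := per_lt p1 pq ba; rewrite ltNge (ltW ab).
have a1 := M _ _ t1; have a2 := M _ _ t2.
by move: a1 a2; rewrite ltr_norml; clear => a1 a2; apply/andP; split; lra.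
Qed.

(** * Behaviour of the amplitude near the origin *)

Lemma near_norm_lt {R : realType} {T : Type} {F : set_system T} {FF : Filter F}
    (f : T -> R) (e : R) :
  f @ F --> (0 : R) -> 0 < e -> \forall x \near F, `|f x| < e.
Proof.
move=> /cvgrPdist_lt H e0; apply: filterS (H e e0) => x.
by rewrite sub0r normrN.
Qed.

(** The last bound is the Landau-Glaeser inequality for a nonnegative function with |U''| <= 1. The
    bound on U comes from integrating twice from 0, where U and U' tend to 0; on the way |U'| <= s
    is obtained, which keeps the test point of the last bound in the half-line s > 0. *)
Lemma nonneg_C2_bounds {R : realType} (U U1 U2 : R -> R) :
  (forall s : R, 0 < s -> is_derive s 1 U (U1 s)) ->
  (forall s : R, 0 < s -> is_derive s 1 U1 (U2 s)) ->
  (forall s : R, 0 < s -> 0 <= U s) ->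
  U s @[s --> 0^'+] --> 0 -> U1 s @[s --> 0^'+] --> 0 -> U2 s @[s --> 0^'+] --> 0 ->
  \forall s \near 0^'+, [/\ `|U2 s| <= 1, U s <= s ^+ 2 & U1 s ^+ 2 <= 4 * U s].
Proof.
move=> D1 D2 U0 cU cU1 cU2.
have [d /= d0 H2] : exists2 d, 0 < d & forall s, 0 < s -> s < d -> `|U2 s| <= 1.
  have : \forall s \near 0^'+, `|U2 s| < 1 by exact: (near_norm_lt cU2 ltr01).
  rewrite near_withinE => /nbhs_ballP[d /= d0 H]; exists d => // s s0 sd.
  by apply: ltW; apply: H => //; rewrite -ball_normE /= sub0r normrN gtr0_norm.
have B1 s : 0 < s -> s < d -> `|U1 s| <= s.
  move=> s0 sd; apply/ler_addgt0Pr => e e0.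
  have N : \forall t \near 0^'+, `|U1 t| < e by exact: (near_norm_lt cU1 e0).
  near (0 : R)^'+ => t.
  have t0 : 0 < t by near: t; exact: nbhs_right_gt.
  have ts : t < s by near: t; exact: nbhs_right_lt.
  have te : `|U1 t| < e by near: t.
  have [x|c] := @mean_value R U1 U2 t s.
    by rewrite (min_l (ltW ts)) => /andP[xt _]; apply: D2; lra.
  rewrite (min_l (ltW ts)) (max_r (ltW ts)) => /andP[tc cs] E.
  have c1 : `|U2 c| <= 1 by apply: H2; lra.
  have -> : U1 s = U1 t + U2 c * (s - t) by rewrite -E; ring.
  apply: le_trans (ler_normD _ _) _; rewrite normrM addrC lerD//; last exact: ltW.
  rewrite (ger0_norm (_ : 0 <= s - t)) ?subr_ge0 ?(ltW ts)//.
  apply: (@le_trans _ _ (1 * (s - t))); last by lra.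
  by rewrite ler_pM2r ?subr_gt0.
have B2 s : 0 < s -> s < d -> U s <= s ^+ 2.
  move=> s0 sd; apply/ler_addgt0Pr => e e0.
  have N : \forall t \near 0^'+, `|U t| < e by exact: (near_norm_lt cU e0).
  near (0 : R)^'+ => t.
  have t0 : 0 < t by near: t; exact: nbhs_right_gt.
  have ts : t < s by near: t; exact: nbhs_right_lt.
  have te : `|U t| < e by near: t.
  have [x|c] := @mean_value R U U1 t s.
    by rewrite (min_l (ltW ts)) => /andP[xt _]; apply: D1; lra.
  rewrite (min_l (ltW ts)) (max_r (ltW ts)) => /andP[tc cs] E.
  have c0 : 0 < c by lra.
  have cd : c < d by lra.
  have c1 := B1 c c0 cd.
  have c2 : U1 c <= s by apply: le_trans (ler_norm _) _; lra.
  have -> : U s = U1 c * (s - t) + U t by rewrite -E; ring.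
  apply: lerD; last by apply: le_trans (ler_norm _) (ltW te).
  by rewrite expr2; apply: (@le_trans _ _ (s * (s - t))); [rewrite ler_pM2r ?subr_gt0|rewrite ler_pM2l//; lra].
have B3 s : 0 < s -> s < d / 2 -> U1 s ^+ 2 <= 4 * U s.
  move=> s0 sd; have sd' : s < d by lra.
  (* This [t] minimises U + U' t + t^2, an upper bound of U(s + t); nonnegativity there gives U -
     U'^2 / 4 >= 0. Since |t| <= s / 2 and s < d / 2, the point s + t stays between 0 and d. *)
  have b1 := B1 s s0 sd'; pose t := - (U1 s / 2).
  have tb : `|t| <= s / 2 by rewrite normrN normrM normfV (@ger0_norm _ 2)// ler_pM2r ?invr_gt0.
  have st0 : 0 < s + t by move: tb; rewrite ler_norml => /andP[]; lra.
  have [x|c cx E] := @mean_value R U U1 s (s + t).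
    by move=> /andP[xs _]; apply: D1; apply: lt_le_trans xs; rewrite lt_min s0.
  have cs : `|c - s| <= `|t| /\ 0 < c < d.
    move: cx tb; rewrite ler_norml; case: (leP s (s + t)) => st /andP[c1 c2] /andP[t1 t2].
      by rewrite !ger0_norm; [split; [lra|apply/andP; split; lra]|lra|lra].
    by rewrite !ler0_norm; [split; [lra|apply/andP; split; lra]|lra|lra].
  have [ct /andP[c0 cd]] := cs.
  have [x|c' cx' E'] := @mean_value R U1 U2 s c.
    by move=> /andP[xs _]; apply: D2; apply: lt_le_trans xs; rewrite lt_min s0.
  have c'd : `|U2 c'| <= 1.
    by move: cx'; case: (leP s c) => sc /andP[c1 c2]; apply: H2; lra.
  have E1 : U1 c * t <= U1 s * t + t ^+ 2.
    have -> : U1 c = U1 s + U2 c' * (c - s) by rewrite -E'; ring.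
    rewrite mulrDl lerD2l; apply: le_trans (ler_norm _) _.
    rewrite !normrM -[t ^+ 2]ger0_norm ?sqr_ge0// normrX expr2.
    rewrite ler_wpM2r// -[leRHS]mul1r; exact: ler_pM.
  have U3 := U0 _ st0.
  have E3 : U (s + t) = U s + U1 c * t by rewrite -[LHS](subrK (U s)) E; ring.
  have H : 0 <= U s + (U1 s * t + t ^+ 2) by rewrite E3 in U3; lra.
  have H' : U1 s * t + t ^+ 2 = - (U1 s ^+ 2 / 4) by rewrite /t; field.
  by rewrite H' in H; lra.
near=> s; have s0 : 0 < s by near: s; exact: nbhs_right_gt.
have sd : s < d / 2 by near: s; apply: nbhs_right_lt; rewrite divr_gt0.
have sd' : s < d by lra.
split; [exact: H2|exact: B2|exact: B3].
Unshelve. all: by end_near. Qed.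

Lemma is_derive_val2 {R : realType} {V W : normedModType R} (f g : V -> W) z v a b :
  (\forall x \near z, f x = g x) -> is_derive z v f a -> is_derive z v g b -> a = b.
Proof. by move=> fg [_ <-] [_ <-]; exact: near_eq_derive. Qed.

(** The relation defining [h], differentiated once and twice near [s]. *)
Lemma amplitude_derive {R : realType} (p q : R) (m h : R -> R) : 1 < p -> p < q ->
  Ckon 2 [set s : R | 0 < s] m -> Ckon 2 [set s : R | 0 < s] h ->
  (forall s, 0 < s -> per p q (h s) = 2 * pi * (1 - m s)) ->
  forall s : R, 0 < s ->
    pint (slow1 p q) (h s, 2 * pi) * 'D_1 h s = - (2 * pi * 'D_1 m s) /\
    pint (slow2 p q) (h s, 2 * pi) * 'D_1 h s ^+ 2
      + pint (slow1 p q) (h s, 2 * pi) * 'D_1 ('D_1 h) s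
    = - (2 * pi * 'D_1 ('D_1 m) s).
Proof.
move=> p1 pq Cm Ch hE; set P := [set s : R | 0 < s].
have near_pos (s : R) : 0 < s -> \forall x \near s, P x.
  by move=> s0; apply: open_nbhs_nbhs; split=> //; exact: open_pos.
have Dh (s : R) (s0 : P s) := @Ckon_is_derive R R R 1 P h 1 s Ch s0.
have Dh2 (s : R) (s0 : P s) := @Ckon_is_derive R R R 0 P ('D_1 h) 1 s (Ckon_D (1 : R) Ch) s0.
have Dm (s : R) (s0 : P s) := @Ckon_is_derive R R R 1 P m 1 s Cm s0.
have Dm2 (s : R) (s0 : P s) := @Ckon_is_derive R R R 0 P ('D_1 m) 1 s (Ckon_D (1 : R) Cm) s0.
have F1 (s : R) : 0 < s ->
    pint (slow1 p q) (h s, 2 * pi) * 'D_1 h s = - (2 * pi * 'D_1 m s).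
  move=> s0; have A1 := is_derive_chain1 (Dh s s0) (is_derive_per (h s) p1 pq).
  have A2 : is_derive s 1 (fun s => 2 * pi * (1 - m s)) (- (2 * pi * 'D_1 m s)).
    have B1 := @is_deriveB _ _ _ _ _ _ _ _ _ (is_derive_cst (1 : R) s (1 : R)) (Dm s s0).
    have B2 := @is_deriveZ _ _ _ _ (2 * pi) _ _ _ B1.
    by rewrite sub0r scalerN in B2.
  apply: (is_derive_val2 _ A1 A2); apply: filterS (near_pos s s0) => x x0.
  exact: hE.
move=> s s0; split; first exact: F1.
have A1 := is_derive_chain1 (Dh s s0) (is_derive_per2 (h s) p1 pq).
have A2 := @is_deriveM _ _ _ _ _ _ _ _ A1 (Dh2 s s0).
have A3 : is_derive s 1 (fun s => - (2 * pi * 'D_1 m s)) (- (2 * pi * 'D_1 ('D_1 m) s)).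
  exact: (@is_deriveN _ _ _ _ _ _ _ (@is_deriveZ _ _ _ _ (2 * pi) _ _ _ (Dm2 s s0))).
have <- := is_derive_val2 _ A2 A3.
  by rewrite /GRing.scale /=; ring.
by apply: filterS (near_pos s s0) => x x0; exact: F1.
Qed.

(** The values at one point: [u] stands for m^r, [L1] and [L2] for the first two derivatives of the
    period at [h], [P] for 2 pi. Since m'/m = u' / (r u), the bound u'^2 <= 4 u controls (m'/m)^2 u,
    and with |u''| <= 1 also (m''/m) u. Dividing by [L1], of size at least [c1] P m, transfers both
    bounds to h' and h''. *)
Lemma amplitude_algebra {R : realType} (r c1 c2 u u1 u2 m0 m1 m2 h1 h2 L1 L2 P : R) :
  0 < r -> 0 < c1 -> 0 <= c2 -> 0 < u -> 0 < m0 -> 0 < P ->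
  u1 * m0 = r * u * m1 -> u2 * m0 + u1 * m1 = r * (u1 * m1 + u * m2) ->
  L1 * h1 = - (P * m1) -> L2 * h1 ^+ 2 + L1 * h2 = - (P * m2) ->
  c1 * (P * m0) <= - L1 -> `|L2| <= c2 * (P * m0) ->
  `|u2| <= 1 -> u1 ^+ 2 <= 4 * u ->
  h1 ^+ 2 * u <= 4 / (r * c1) ^+ 2 /\
  `|h2| * u <= ((r^-1 + `|1 - r| * (4 / r ^+ 2)) + c2 * (4 / (r * c1) ^+ 2)) / c1.
Proof.
move=> r0 c10 c20 u0 m00 P0 E1 E2 E3 E4 B1 B2 B3 B4.
have rn : r != 0 by rewrite gt_eqF. have un : u != 0 by rewrite gt_eqF.
have mn : m0 != 0 by rewrite gt_eqF. have Pn : P != 0 by rewrite gt_eqF.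
have l0 : 0 < c1 * (P * m0) by rewrite !mulr_gt0.
have Ln : L1 != 0 by rewrite lt_eqF//; lra.
have cn : c1 != 0 by rewrite gt_eqF.
have F1 : m1 = u1 * m0 / (r * u) by rewrite E1; field; rewrite ?rn ?un ?mn ?Pn ?cn ?Ln ?(gt_eqF nL0)//.
have F2 : m2 = (u2 * m0 + (1 - r) * u1 * m1) / (r * u).
  have -> : u2 * m0 + (1 - r) * u1 * m1 = (u2 * m0 + u1 * m1) - r * (u1 * m1) by ring.
  by rewrite E2; field; rewrite ?rn ?un ?mn ?Pn ?cn ?Ln ?(gt_eqF nL0)//.
have G1 : h1 = - (P * m1) / L1 by rewrite -E3; field.
have G2 : h2 = - (P * m2 + L2 * h1 ^+ 2) / L1.
  have -> : P * m2 = - (L2 * h1 ^+ 2 + L1 * h2) by rewrite E4 opprK.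
  by field.
have nL : c1 * (P * m0) <= `|L1| by rewrite -normrN; apply: le_trans B1 (ler_norm _).
have nL0 : 0 < `|L1| by apply: lt_le_trans nL.
have H1 : h1 ^+ 2 * u <= 4 / (r * c1) ^+ 2.
  have -> : h1 ^+ 2 * u = u1 ^+ 2 / (r ^+ 2 * u) * ((P * m0) ^+ 2 / `|L1| ^+ 2).
    by rewrite G1 F1 real_normK ?num_real//; field; rewrite ?rn ?un ?mn ?Pn ?cn ?Ln ?(gt_eqF nL0)//.
  have -> : 4 / (r * c1) ^+ 2 = 4 / r ^+ 2 * (c1 ^-2) by field; rewrite ?rn ?un ?mn ?Pn ?cn ?Ln ?(gt_eqF nL0)//.
  apply: ler_pM.
  - by rewrite divr_ge0 ?sqr_ge0// mulr_ge0 ?sqr_ge0// ltW.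
  - by rewrite divr_ge0 ?sqr_ge0.
  - rewrite ler_pdivrMr ?mulr_gt0 ?exprn_gt0//; apply: le_trans B4 _.
    by rewrite mulrA divfK ?expf_neq0.
  - have -> : (P * m0) ^+ 2 / `|L1| ^+ 2 = c1 ^- 2 * ((c1 * (P * m0)) ^+ 2 / `|L1| ^+ 2).
      by field; rewrite ?rn ?un ?mn ?Pn ?cn ?Ln ?(gt_eqF nL0)//.
    rewrite ger_pMr ?invr_gt0 ?exprn_gt0// ler_pdivrMr ?exprn_gt0// mul1r.
    by rewrite lerXn2r ?nnegrE// ltW.
split=> //.
have H3 : `|m2| / m0 * u <= r^-1 + `|1 - r| * (4 / r ^+ 2).
  have -> : `|m2| / m0 * u = `|m2 / m0 * u|.
    by rewrite !normrM normfV (gtr0_norm m00) (gtr0_norm u0).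
  have -> : m2 / m0 * u = u2 / r + (1 - r) * (u1 ^+ 2 / u / r ^+ 2).
    by rewrite F2 F1; field; rewrite ?rn ?un ?mn ?Pn ?cn ?Ln ?(gt_eqF nL0)//.
  apply: le_trans (ler_normD _ _) _; apply: lerD.
    by rewrite normrM normfV (gtr0_norm r0) ler_piMl// invr_ge0 ltW.
  rewrite normrM ler_wpM2l// ger0_norm; last first.
    by rewrite !divr_ge0 ?sqr_ge0// ltW.
  by rewrite ler_pM2r ?invr_gt0 ?exprn_gt0// ler_pdivrMr.
have Pm : 0 < P * m0 by rewrite mulr_gt0.
have H4 : `|h2| * u <= (`|m2| / m0 * u + c2 * (h1 ^+ 2 * u)) / c1.
  have -> : (`|m2| / m0 * u + c2 * (h1 ^+ 2 * u)) / c1 =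
    (P * `|m2| + c2 * (P * m0) * h1 ^+ 2) / (c1 * (P * m0)) * u.
    by field; rewrite ?rn ?un ?mn ?Pn ?cn ?Ln ?(gt_eqF nL0)//.
  rewrite ler_pM2r// G2 normrM normfV normrN; apply: ler_pM => //.
    apply: le_trans (ler_normD _ _) _; rewrite (normrM P) (normrM L2) (gtr0_norm P0) lerD2l.
    by rewrite (ger0_norm (sqr_ge0 h1)) ler_wpM2r ?sqr_ge0.
  by rewrite lef_pV2 ?posrE.
apply: le_trans H4 _; rewrite ler_pM2r ?invr_gt0//; apply: lerD => //.
by rewrite ler_wpM2l.
Qed.

(** [amplitude_algebra] only bounds U h'^2 and U |h''|. The gain is in exp(h) <= c5 U m^(a - r) with
    a = 1/(p-1) and r = 1/(q-1): as p < q, the exponent a - r is positive and the last factor tends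
    to 0. The same factor and U <= s^2 give the rate against s^2. *)
Lemma amplitude_asymp {R : realType} (p q : R) (m h : R -> R) : 1 < p -> p < q ->
  Ckon 2 [set s : R | 0 < s] m -> Ckon 2 [set s : R | 0 < s] h ->
  (forall s, 0 < s -> 0 < m s < 1) ->
  (forall s, 0 < s -> per p q (h s) = 2 * pi * (1 - m s)) ->
  m s @[s --> 0^'+] --> 0 ->
  let U s := m s `^ (q - 1)^-1 in
  U s @[s --> 0^'+] --> 0 -> 'D_1 U s @[s --> 0^'+] --> 0 ->
  'D_1 ('D_1 U) s @[s --> 0^'+] --> 0 ->
  forall e, 0 < e -> \forall s \near 0^'+,
    [/\ h s <= 0, expR (h s) * 'D_1 h s ^+ 2 <= e,
        expR (h s) * `|'D_1 ('D_1 h) s| <= e & expR (h s) <= e * s ^+ 2].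
Proof.
move=> p1 pq Cm Ch m01 hE cm U cU cU1 cU2 e e0; set P := [set s : R | 0 < s].
pose r := (q - 1)^-1; have r0 : 0 < r by rewrite invr_gt0; lra.
have oP : open P by exact: open_pos.
have near_pos (s : R) : 0 < s -> \forall x \near s, P x.
  by move=> s0; apply: open_nbhs_nbhs; split.
have mP s : P s -> [set y : R | 0 < y] (m s) by move=> /m01/andP[].
have CU : Ckon 2 P U := Ckon_comp1 oP (Ckon_powR 2 r) Cm mP.
have DU (s : R) (s0 : P s) := @Ckon_is_derive R R R 1 P U 1 s CU s0.
have DU2 (s : R) (s0 : P s) := @Ckon_is_derive R R R 0 P ('D_1 U) 1 s (Ckon_D (1 : R) CU) s0.
have Dm (s : R) (s0 : P s) := @Ckon_is_derive R R R 1 P m 1 s Cm s0.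
have Dm2 (s : R) (s0 : P s) := @Ckon_is_derive R R R 0 P ('D_1 m) 1 s (Ckon_D (1 : R) Cm) s0.
have F1 (s : R) : P s -> 'D_1 U s * m s = r * U s * 'D_1 m s.
  move=> s0; have ms := mP s s0.
  have [_ ->] := is_derive_chain1 (Dm s s0) (is_derive1_powR r ms).
  rewrite /U -(mulr_powRB1 (ltW ms) r0); rewrite -/r; ring.
have F2 (s : R) : P s -> 'D_1 ('D_1 U) s * m s + 'D_1 U s * 'D_1 m s =
    r * ('D_1 U s * 'D_1 m s + U s * 'D_1 ('D_1 m) s).
  move=> s0; have A1 := @is_deriveM _ _ _ _ _ _ _ _ (DU2 s s0) (Dm s s0).
  have A2 := @is_deriveM _ _ _ _ _ _ _ _ (DU s s0) (Dm2 s s0).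
  have A3 := @is_deriveZ _ _ _ _ r _ _ _ A2.
  have NE : \forall x \near s, ('D_1 U * m)%R x = (r \*: (U * 'D_1 m)%R) x.
    apply: filterS (near_pos s s0) => x x0.
    have -> : (r \*: (U * 'D_1 m)%R) x = r * (U x * 'D_1 m x) by [].
    have -> : ('D_1 U * m)%R x = 'D_1 U x * m x by [].
    by rewrite F1// mulrA.
  have := is_derive_val2 NE A1 A3; rewrite /GRing.scale /=.
  move: ('D_1 U s) ('D_1 m s) ('D_1 ('D_1 U) s) ('D_1 ('D_1 m) s) (U s) (m s).
  move=> x1 x2 x3 x4 x5 x6 H; have -> : x3 * x6 + x1 * x2 = x1 * x2 + x6 * x3 by ring.
  by rewrite H; ring.
have U0 (s : R) : P s -> 0 < U s by move=> s0; rewrite powR_gt0//; exact: mP.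
have B := @nonneg_C2_bounds R U ('D_1 U) ('D_1 ('D_1 U)) DU DU2
  (fun s s0 => ltW (U0 s s0)) cU cU1 cU2.
have pi0 := @pi2_gt0 R.
have N0 : \forall s \near 0^'+, h s <= 0.
  (* The period decreases, so h(s) > 0 would force 2 pi (1 - m) < per(0); this is excluded once m is
     below the threshold. *)
  have d0 : 0 < 1 - per p q 0 / (2 * pi).
    have /andP[_ h1] := per_bounds 0 p1 pq.
    by rewrite subr_gt0 ltr_pdivrMr// mul1r.
  apply: filterS2 (near_norm_lt cm d0) (nbhs_right_gt 0) => s s1 s0.
  rewrite leNgt; apply/negP => hs; have := per_lt p1 pq hs; rewrite (hE s s0).
  have := le_lt_trans (ler_norm _) s1; rewrite ltrBrDl -ltrBrDr => h2 h3.
  by move: h2; rewrite ltr_pdivrMr// mulrC => h2; have := lt_trans h2 h3; rewrite ltxx.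
pose c1 := (p - 1) / 54; pose c2 := 12 * (q - 1) ^+ 2.
have c10 : 0 < c1 by rewrite /c1; lra.
have c20 : 0 <= c2 by rewrite mulr_ge0// sqr_ge0.
pose K1 := 4 / (r * c1) ^+ 2.
pose K2 := ((r^-1 + `|1 - r| * (4 / r ^+ 2)) + c2 * (4 / (r * c1) ^+ 2)) / c1.
have K10 : 0 <= K1 by rewrite divr_ge0// sqr_ge0.
have K20 : 0 <= K2.
  apply: divr_ge0; last exact: ltW.
  apply: addr_ge0; last by rewrite mulr_ge0.
  apply: addr_ge0; first by rewrite invr_ge0 ltW.
  by rewrite mulr_ge0// divr_ge0// sqr_ge0.
pose a := (p - 1)^-1; have a0 : 0 < a by rewrite invr_gt0; lra.
(* The last bound of [per_cmp], with D = 2 pi m, reads exp((p-1) h) <= 3 (p+1) m; the power [a] of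
   it gives exp(h) <= c5 m^a. *)
pose c5 := (3 * (p + 1)) `^ a; have c50 : 0 < c5 by rewrite powR_gt0//; lra.
have ar : 0 < a - r by rewrite subr_gt0 ltf_pV2 ?posrE; lra.
have cd : `|m s| `^ (a - r) @[s --> 0^'+] --> 0.
  exact: (cvg_comp _ _ cm (normr_powR_cvg0 ar)).
have e1 : 0 < e / (c5 * (K1 + K2 + 1)).
  by rewrite divr_gt0// mulr_gt0// ltr_pwDr// addr_ge0.
have N1 : \forall s \near 0^'+, `|(`|m s| `^ (a - r))| < e / (c5 * (K1 + K2 + 1)).
  exact: (near_norm_lt cd e1).
have p10 : 0 < p - 1 by rewrite subr_gt0.
have p30 : 0 < 3 * (p + 1) by rewrite mulr_gt0// addr_gt0// (lt_trans _ p1).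
have K1K : K1 <= K1 + K2 + 1 by rewrite -addrA lerDl addr_ge0.
have K2K : K2 <= K1 + K2 + 1 by rewrite addrAC lerDr addr_ge0.
have K0K : 1 <= K1 + K2 + 1 by rewrite lerDr addr_ge0.
have N2 : \forall s \near (0 : R)^'+, 0 < s by exact: nbhs_right_gt.
apply: filterS3 B N0 (filterI N1 N2) => s [B1 B2 B3] hs0 [md s0].
have ms := mP s s0; have us := U0 s s0.
have [L1 L2 L3] := per_cmp p1 pq hs0.
have DE : 2 * pi - per p q (h s) = 2 * pi * m s by rewrite (hE s s0); ring.
rewrite DE in L1 L2 L3.
have [A1 A2] := amplitude_derive p1 pq Cm Ch hE s0.
have [H1 H2] := amplitude_algebra r0 c10 c20 us ms pi0 (F1 s s0) (F2 s s0) A1 A2 L1 L2 B1 B3.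
have E : expR (h s) <= c5 * U s * m s `^ (a - r).
  have -> : expR (h s) = expR ((p - 1) * h s) `^ a.
    by rewrite -expRM mulrAC mulfV ?mul1r// gt_eqF.
  have -> : c5 * U s * m s `^ (a - r) = (3 * (p + 1) * m s) `^ a.
    rewrite (powRM _ (ltW p30) (ltW ms)).
    rewrite -mulrA -powRD ?(gt_eqF ms) ?implybT//; congr (_ * _ `^ _).
    by rewrite -/r; ring.
  apply: ge0_ler_powR; rewrite ?nnegrE ?(ltW a0) ?expR_ge0//.
    by apply: mulr_ge0; [exact: ltW|exact: (ltW ms)].
  rewrite -(ler_pM2l pi0) mulrCA; move: L3.
  rewrite mulrAC (ler_pdivrMr _ _ p30).
  by rewrite [X in _ <= X -> _]mulrC.
set M := m s `^ (a - r) in E; have M0 : 0 < M by rewrite powR_gt0.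
have {}md : c5 * (K1 + K2 + 1) * M <= e.
  have K0 : 0 < c5 * (K1 + K2 + 1) by rewrite mulr_gt0// ltr_pwDr// addr_ge0.
  rewrite mulrC -ler_pdivlMr//; move: md.
  by rewrite (gtr0_norm ms) (gtr0_norm M0) => /ltW.
have Me k : 0 <= k -> k <= K1 + K2 + 1 -> c5 * M * k <= e.
  move=> k0 kK; apply: le_trans md; rewrite mulrAC ler_pM2r// ler_pM2l//.
split=> //.
- apply: (@le_trans _ _ (c5 * M * K1)); last exact: Me.
  apply: (@le_trans _ _ (c5 * U s * M * 'D_1 h s ^+ 2)).
    by rewrite ler_wpM2r ?sqr_ge0.
  have -> : c5 * U s * M * 'D_1 h s ^+ 2 = c5 * M * ('D_1 h s ^+ 2 * U s) by ring.
  by rewrite ler_pM2l ?mulr_gt0.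
- apply: (@le_trans _ _ (c5 * M * K2)); last exact: Me.
  apply: (@le_trans _ _ (c5 * U s * M * `|'D_1 ('D_1 h) s|)).
    by rewrite ler_wpM2r.
  have -> : c5 * U s * M * `|'D_1 ('D_1 h) s| = c5 * M * (`|'D_1 ('D_1 h) s| * U s) by ring.
  by rewrite ler_pM2l ?mulr_gt0.
- apply: (@le_trans _ _ (c5 * M * 1 * s ^+ 2)); last first.
    by rewrite ler_pM2r ?exprn_gt0//; exact: Me.
  apply: le_trans E _; rewrite mulr1 mulrAC ler_pM2l// mulr_gt0//.
Qed.

(** * Functions with controlled growth of derivatives *)

Definition evb {R : realType} {T : Type} (F : set_system T) (f : T -> R) : Prop :=
  exists M : R, \forall x \near F, `|f x| <= M.

Definition Os {R : realType} {T : Type} (F : set_system T) (E a : T -> R) : Prop :=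
  (fun x => E x * a x) @ F --> (0 : R).

(** For positive E this says a = o(E^(-1/2)), squared to avoid roots and absolute values; [Os] says
    a = o(E^(-1)). *)
Definition Hs {R : realType} {T : Type} (F : set_system T) (E a : T -> R) : Prop :=
  (fun x => E x * a x ^+ 2) @ F --> (0 : R).

Lemma cvg0_le {R : realType} {T : Type} {F : set_system T} {FF : Filter F} (f g : T -> R) :
  (\forall x \near F, `|f x| <= g x) -> g @ F --> (0 : R) -> f @ F --> (0 : R).
Proof.
move=> fg /cvgrPdist_lt g0; apply/cvgrPdist_lt => e e0.
apply: filterS2 fg (g0 e e0) => x fx gx; rewrite sub0r normrN.
by apply: le_lt_trans fx _; apply: le_lt_trans (ler_norm _) _; rewrite sub0r normrN in gx.
Qed.

Section growth.
Context {R : realType} {T : Type} {F : set_system T} {FF : Filter F}.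

Lemma cvg0_mull (k : R) (f : T -> R) :
  f @ F --> (0 : R) -> (fun x => k * f x) @ F --> (0 : R).
Proof.
move=> f0; have H1 : (fun _ : T => k) @ F --> k by exact: cvg_cst.
by have := cvgM H1 f0; rewrite mulr0; exact.
Qed.

Lemma cvg0_norm (f : T -> R) :
  f @ F --> (0 : R) -> (fun x => `|f x|) @ F --> (0 : R).
Proof. by move=> f0; have := cvg_norm f0; rewrite normr0; exact. Qed.

Lemma cvg0_add (f g : T -> R) :
  f @ F --> (0 : R) -> g @ F --> (0 : R) -> (fun x => f x + g x) @ F --> (0 : R).
Proof. by move=> f0 g0; have := cvgD f0 g0; rewrite addr0; exact. Qed.

Lemma evb_cst (k : R) : evb F (fun=> k).
Proof. by exists `|k|; exact: nearW. Qed.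

Lemma evb_add (a b : T -> R) :
  evb F a -> evb F b -> evb F (fun x => a x + b x).
Proof.
move=> [M HM] [N HN]; exists (M + N); apply: filterS2 HM HN => x h1 h2.
exact: le_trans (ler_normD _ _) (lerD h1 h2).
Qed.

Lemma evb_opp (a : T -> R) :
  evb F a -> evb F (fun x => - a x).
Proof. by move=> [M HM]; exists M; apply: filterS HM => x; rewrite normrN. Qed.

Lemma evb_mul (a b : T -> R) :
  evb F a -> evb F b -> evb F (fun x => a x * b x).
Proof.
move=> [M HM] [N HN]; exists (M * N); apply: filterS2 HM HN => x h1 h2.
by rewrite normrM ler_pM.
Qed.

Lemma evb_eq (a b : T -> R) :
  (\forall x \near F, a x = b x) -> evb F a -> evb F b.
Proof. by move=> ab [M HM]; exists M; apply: filterS2 ab HM => x ->. Qed.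

Lemma Os_eq (E a b : T -> R) :
  (\forall x \near F, a x = b x) -> Os F E a -> Os F E b.
Proof. by move=> ab; apply: cvg_near_eq; apply: filterS ab => x ->. Qed.

Lemma Hs_eq (E a b : T -> R) :
  (\forall x \near F, a x = b x) -> Hs F E a -> Hs F E b.
Proof. by move=> ab; apply: cvg_near_eq; apply: filterS ab => x ->. Qed.

Lemma Os_add (E a b : T -> R) :
  Os F E a -> Os F E b -> Os F E (fun x => a x + b x).
Proof.
move=> Oa Ob; have H : (fun x => E x * a x + E x * b x) @ F --> (0 : R).
  exact: (cvg0_add Oa Ob).
by apply: (cvg_near_eq _ H); apply: nearW => x; rewrite mulrDr.
Qed.

Lemma Os_opp (E a : T -> R) :
  Os F E a -> Os F E (fun x => - a x).
Proof.
move=> Oa; have H : (fun x => - (E x * a x)) @ F --> (0 : R).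
  by have := cvgN Oa; rewrite oppr0; exact.
by apply: (cvg_near_eq _ H); apply: nearW => x; rewrite mulrN.
Qed.

Lemma Os_bmul (E c a : T -> R) :
  evb F c -> Os F E a -> Os F E (fun x => c x * a x).
Proof.
move=> [M HM] Oa; apply: (@cvg0_le _ _ _ _ _ (fun x => `|M| * `|E x * a x|)).
  apply: filterS HM => x h; rewrite mulrCA normrM ler_wpM2r//.
  exact: le_trans h (ler_norm _).
exact: (cvg0_mull _ (cvg0_norm Oa)).
Qed.

Lemma Hs_bmul (E c a : T -> R) :
  evb F c -> Hs F E a -> Hs F E (fun x => c x * a x).
Proof.
move=> cb Ha; have H : Os F E (fun x => (c x * c x) * a x ^+ 2).
  by apply: Os_bmul => //; exact: evb_mul.
by apply: (cvg_near_eq _ H); apply: nearW => x; ring.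
Qed.

Lemma Hs_add (E a b : T -> R) :
  Hs F E a -> Hs F E b -> Hs F E (fun x => a x + b x).
Proof.
move=> Ha Hb.
apply: (@cvg0_le _ _ _ _ _ (fun x => 2 * `|E x * a x ^+ 2| + 2 * `|E x * b x ^+ 2|)).
  apply: nearW => x; rewrite !(@normrM _ (E x)) !(mulrCA 2) -mulrDr ler_wpM2l//.
  rewrite !(ger0_norm (sqr_ge0 _)).
  by have := sqr_ge0 (a x - b x); nra.
by apply: cvg0_add; apply: cvg0_mull; exact: cvg0_norm.
Qed.

Lemma Hs_opp (E a : T -> R) :
  Hs F E a -> Hs F E (fun x => - a x).
Proof. by apply: cvg_near_eq; apply: nearW => x; rewrite sqrrN. Qed.

(** By 2 |a b| <= a^2 + b^2. This is how products of two first derivatives, which occur in every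
    second derivative below, reach the size allowed for second derivatives. *)
Lemma Hs_Os (E a b : T -> R) :
  Hs F E a -> Hs F E b -> Os F E (fun x => a x * b x).
Proof.
move=> Ha Hb; apply: (@cvg0_le _ _ _ _ _ (fun x => `|E x * a x ^+ 2| + `|E x * b x ^+ 2|)).
  apply: nearW => x; rewrite !(@normrM _ (E x)) -mulrDr ler_wpM2l//.
  rewrite normrM !normrX.
  by have := sqr_ge0 (`|a x| - `|b x|); have := normr_ge0 (a x); have := normr_ge0 (b x); nra.
by apply: cvg0_add; exact: cvg0_norm.
Qed.

Lemma Os_bnd (E a : T -> R) :
  E @ F --> (0 : R) -> evb F a -> Os F E a.
Proof.
move=> Ec ab; have O1 : Os F E (fun=> 1).
  by apply: (cvg_near_eq _ Ec); apply: nearW => x; rewrite mulr1.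
by apply: (Os_eq _ (Os_bmul ab O1)); apply: nearW => x; rewrite mulr1.
Qed.

Lemma Hs_bnd (E a : T -> R) :
  E @ F --> (0 : R) -> evb F a -> Hs F E a.
Proof.
move=> Ec ab; apply: (cvg_near_eq _ (Os_bnd Ec (evb_mul ab ab))).
by apply: nearW => x; rewrite expr2.
Qed.

Lemma Os_Hs (E a : T -> R) :
  E @ F --> (0 : R) -> Hs F E a -> Os F E a.
Proof.
move=> Ec Ha; apply: (Os_eq _ (Hs_Os (Hs_bnd Ec (evb_cst 1)) Ha)).
by apply: nearW => x; rewrite mul1r.
Qed.

End growth.

(* First derivatives are o(E^(-1/2)) and second derivatives o(E^(-1)) along F: the
   rates at which E f still vanishes to second order. *)
Definition tame12 {R : realType} {V : normedModType R} (F : set_system V) (E f : V -> R) :=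
  (forall v, Hs F E ('D_v f)) /\ (forall v w, Os F E ('D_w ('D_v f))).

Lemma D_mul {R : realType} {V : normedModType R} k (A : set V) (f g : V -> R) v x :
  Ckon k.+1 A f -> Ckon k.+1 A g -> A x ->
  'D_v (fun y => f y * g y) x = f x * 'D_v g x + g x * 'D_v f x.
Proof.
move=> Cf Cg Ax.
by have [_ ->] := @is_deriveM _ _ f g _ _ _ _ (Ckon_is_derive v Cf Ax) (Ckon_is_derive v Cg Ax).
Qed.

Lemma D_add {R : realType} {V : normedModType R} k (A : set V) (f g : V -> R) v x :
  Ckon k.+1 A f -> Ckon k.+1 A g -> A x ->
  'D_v (fun y => f y + g y) x = 'D_v f x + 'D_v g x.
Proof.
move=> Cf Cg Ax.
by have [_ ->] := @is_deriveD _ _ _ f g _ _ _ _ (Ckon_is_derive v Cf Ax) (Ckon_is_derive v Cg Ax).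
Qed.

Lemma D_eq {R : realType} {V : normedModType R} (A : set V) (f g : V -> R) v x :
  open A -> (forall y, A y -> f y = g y) -> A x -> 'D_v f x = 'D_v g x.
Proof.
move=> oA fg Ax; apply: near_eq_derive.
by apply: filterS (open_nbhs_nbhs (conj oA Ax)) => y; exact: fg.
Qed.

Lemma D2_mul {R : realType} {V : normedModType R} (A : set V) (f g : V -> R) v w x :
  open A -> Ckon 2 A f -> Ckon 2 A g -> A x ->
  'D_w ('D_v (fun y => f y * g y)) x =
    f x * 'D_w ('D_v g) x + 'D_w f x * 'D_v g x
    + (g x * 'D_w ('D_v f) x + 'D_w g x * 'D_v f x).
Proof.
move=> oA Cf Cg Ax; have Cf1 := CkonW Cf; have Cg1 := CkonW Cg.
rewrite (@D_eq _ _ A _ (fun y => f y * 'D_v g y + g y * 'D_v f y) w x oA _ Ax); last first.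
  by move=> y Ay; exact: (D_mul v Cf1 Cg1 Ay).
have C1 : Ckon 1 A (fun y => f y * 'D_v g y) by exact: (Ckon_mul oA Cf1 (Ckon_D v Cg)).
have C2 : Ckon 1 A (fun y => g y * 'D_v f y) by exact: (Ckon_mul oA Cg1 (Ckon_D v Cf)).
rewrite (D_add w C1 C2 Ax) (D_mul w Cf1 (Ckon_D v Cg) Ax) (D_mul w Cg1 (Ckon_D v Cf) Ax).
by rewrite ['D_v g x * _]mulrC ['D_v f x * _]mulrC.
Qed.

Lemma D_comp1 {R : realType} {V : normedModType R} k (A : set V) (B : set R)
    (f : R -> R) (a : V -> R) v x :
  Ckon k.+1 B f -> Ckon k.+1 A a -> A x -> B (a x) ->
  'D_v (f \o a) x = 'D_1 f (a x) * 'D_v a x.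
Proof.
move=> Cf Ca Ax Bx.
by have [_ ->] := is_derive_chain1 (Ckon_is_derive v Ca Ax)
  (@Ckon_is_derive R R R k B f 1 (a x) Cf Bx).
Qed.

Lemma D2_comp1 {R : realType} {V : normedModType R} (A : set V) (B : set R)
    (f : R -> R) (a : V -> R) v w x :
  open A -> Ckon 2 B f -> Ckon 2 A a -> (forall y, A y -> B (a y)) -> A x ->
  'D_w ('D_v (f \o a)) x =
    'D_1 f (a x) * 'D_w ('D_v a) x + 'D_v a x * ('D_1 ('D_1 f) (a x) * 'D_w a x).
Proof.
move=> oA Cf Ca AB Ax.
rewrite (@D_eq _ _ A _ (fun y => 'D_1 f (a y) * 'D_v a y) w x oA _ Ax); last first.
  by move=> y Ay; exact: (D_comp1 v Cf Ca Ay (AB _ Ay)).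
have C1 : Ckon 1 A ('D_1 f \o a).
  exact: (Ckon_comp1 oA (Ckon_D (1 : R) Cf) (CkonW Ca) AB).
rewrite (D_mul w C1 (Ckon_D v Ca) Ax); congr (_ + _ * _).
exact: (D_comp1 w (Ckon_D (1 : R) Cf) (CkonW Ca) Ax (AB _ Ax)).
Qed.

Lemma tame12_mul {R : realType} {V : normedModType R} (A : set V) (z0 : V)
    (E f g : V -> R) :
  open A ->
  Ckon 2 A f -> Ckon 2 A g -> evb (within A (nbhs z0)) f -> evb (within A (nbhs z0)) g ->
  tame12 (within A (nbhs z0)) E f -> tame12 (within A (nbhs z0)) E g ->
  tame12 (within A (nbhs z0)) E (fun x => f x * g x).
Proof.
move=> oA Cf Cg bf bg [f1 f2] [g1 g2].
have nA : \forall x \near within A (nbhs z0), A x by exact: withinT.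
split=> [v|v w].
  apply: (@Hs_eq _ _ _ _ _ (fun x => f x * 'D_v g x + g x * 'D_v f x)).
    by apply: filterS nA => x Ax; rewrite (D_mul v (CkonW Cf) (CkonW Cg) Ax).
  by apply: Hs_add => //; apply: Hs_bmul.
apply: (@Os_eq _ _ _ _ _ (fun x => f x * 'D_w ('D_v g) x + 'D_w f x * 'D_v g x
    + (g x * 'D_w ('D_v f) x + 'D_w g x * 'D_v f x))).
  by apply: filterS nA => x Ax; rewrite (D2_mul v w oA Cf Cg Ax).
exact: (Os_add (Os_add (Os_bmul bf (g2 v w)) (Hs_Os (f1 w) (g1 v))) (Os_add (Os_bmul bg (f2 v w)) (Hs_Os (g1 w) (f1 v)))).
Qed.

(** Differentiating exp(h) only multiplies it by derivatives of h. So each derivative up to order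
    two is exp(h) times a sum of products of bounded factors, single derivatives of order at most
    two, and pairs of first derivatives; all of these are o(exp(-h)). *)
Lemma tame_vanishes {R : realType} {V : normedModType R} (A : set V) (z0 : V)
    (h f : V -> R) :
  open A -> Ckon 2 A h -> Ckon 2 A f ->
  expR (h x) @[x --> within A (nbhs z0)] --> (0 : R) ->
  evb (within A (nbhs z0)) f ->
  tame12 (within A (nbhs z0)) (fun x => expR (h x)) h ->
  tame12 (within A (nbhs z0)) (fun x => expR (h x)) f ->
  vanishes 2 A z0 (fun x => expR (h x) * f x).
Proof.
move=> oA Ch Cf Ec bf [h1 h2] [f1 f2].
have nA : \forall x \near within A (nbhs z0), A x by exact: withinT.
have Ce : Ckon 2 A (fun x => expR (h x)) by exact: (Ckon_comp1 oA (Ckon_expR 2) Ch (fun _ _ => I)).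
have De v x : A x -> 'D_v (fun x => expR (h x)) x = expR (h x) * 'D_v h x.
  by move=> Ax; have [_ ->] := is_derive_chain1 (Ckon_is_derive v Ch Ax) (is_derive_expR (h x)).
have Df v x : A x -> 'D_v (fun x => expR (h x) * f x) x =
    expR (h x) * (f x * 'D_v h x + 'D_v f x).
  by move=> Ax; rewrite (D_mul v (CkonW Ce) (CkonW Cf) Ax) De//; ring.
have Cg v : Ckon 1 A (fun x => f x * 'D_v h x + 'D_v f x).
  apply: (Ckon_add oA); last exact: Ckon_D.
  exact: (Ckon_mul oA (CkonW Cf) (Ckon_D v Ch)).
split; first exact: Os_bnd.
move=> v; split.
  apply: (@cvg_near_eq _ _ _ _ (fun x => expR (h x) * (f x * 'D_v h x + 'D_v f x))).
    by apply: filterS nA => x Ax; rewrite Df.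
  exact: (Os_add (Os_bmul bf (Os_Hs Ec (h1 v))) (Os_Hs Ec (f1 v))).
move=> w; split; last by [].
apply: (@cvg_near_eq _ _ _ _ (fun x => expR (h x) *
   (f x * ('D_v h x * 'D_w h x) + 'D_v f x * 'D_w h x +
    (f x * 'D_w ('D_v h) x + 'D_w f x * 'D_v h x) + 'D_w ('D_v f) x))).
  apply: filterS nA => x Ax.
  rewrite [RHS](@D_eq _ _ A _ (fun x => expR (h x) * (f x * 'D_v h x + 'D_v f x)) w x oA _ Ax);
    last exact: (Df v).
  rewrite (D_mul w (CkonW Ce) (Cg v) Ax) De//.
  have C1 : Ckon 1 A (fun y => f y * 'D_v h y) by exact: (Ckon_mul oA (CkonW Cf) (Ckon_D v Ch)).
  rewrite (D_add w C1 (Ckon_D v Cf) Ax) (D_mul w (CkonW Cf) (Ckon_D v Ch) Ax).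
  move: (expR (h x)) (f x) ('D_w ('D_v h) x) ('D_w ('D_v f) x) ('D_v h x) ('D_w h x).
  by move: ('D_v f x) ('D_w f x) => *; ring.
exact: (Os_add (Os_add (Os_add (Os_bmul bf (Hs_Os (h1 v) (h1 w))) (Hs_Os (f1 v) (h1 w)))
  (Os_add (Os_bmul bf (h2 v w)) (Hs_Os (f1 w) (h1 v)))) (f2 v w)).
Qed.

Lemma evb_continuous {R : realType} {V : normedModType R} (A : set V) (z0 : V) (f : V -> R) :
  {for z0, continuous f} -> evb (within A (nbhs z0)) f.
Proof.
move=> cf; exists (`|f z0| + 1).
have : \forall x \near z0, `|f x| < `|f z0| + 1.
  have /cvgrPdist_lt /(_ 1 ltr01) := cf; apply: filterS => x h.
  rewrite -[f x](addrNK (f z0)); apply: le_lt_trans (ler_normD _ _) _.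
  by rewrite addrC ltrD2l distrC.
by move=> H; apply: cvg_within; apply: filterS H => x /ltW.
Qed.

Lemma tame12_smooth {R : realType} {V : normedModType R} (A : set V) (z0 : V)
    (E f : V -> R) : E @ within A (nbhs z0) --> (0 : R) ->
  Ckon 2 setT f -> tame12 (within A (nbhs z0)) E f.
Proof.
move=> Ec Cf; split=> [v|v w].
  apply: Hs_bnd => //; apply: evb_continuous.
  exact: (Ckon_cont (Ckon_D v Cf) I).
apply: Os_bnd => //; apply: evb_continuous.
exact: (Ckon_cont (Ckon_D w (Ckon_D v Cf)) I).
Qed.

Lemma tame12_comp {R : realType} {V : normedModType R} (A : set V) (z0 : V)
    (E : V -> R) (f : R -> R) (a : V -> R) :
  open A -> Ckon 2 setT f -> Ckon 2 A a ->
  evb (within A (nbhs z0)) ('D_1 f \o a) ->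
  evb (within A (nbhs z0)) ('D_1 ('D_1 f) \o a) ->
  tame12 (within A (nbhs z0)) E a -> tame12 (within A (nbhs z0)) E (f \o a).
Proof.
move=> oA Cf Ca b1 b2 [a1 a2].
have nA : \forall x \near within A (nbhs z0), A x by exact: withinT.
split=> [v|v w].
  apply: (@Hs_eq _ _ _ _ _ (fun x => ('D_1 f \o a) x * 'D_v a x)).
    by apply: filterS nA => x Ax; rewrite (D_comp1 v Cf Ca Ax I).
  exact: Hs_bmul.
apply: (@Os_eq _ _ _ _ _ (fun x => ('D_1 f \o a) x * 'D_w ('D_v a) x +
   ('D_1 ('D_1 f) \o a) x * ('D_v a x * 'D_w a x))).
  apply: filterS nA => x Ax; rewrite (D2_comp1 v w oA Cf Ca (fun _ _ => I) Ax) /=.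
  by congr (_ + _); rewrite mulrCA.
exact: (Os_add (Os_bmul b1 (a2 v w)) (Os_bmul b2 (Hs_Os (a1 v) (a1 w)))).
Qed.

(** * The angle along tame arguments *)

Lemma near_all {T : topologicalType} (z : T) (P : T -> Prop) :
  (forall y, P y) -> \forall y \near z, P y.
Proof. by move=> H; apply: nearW. Qed.

Lemma pint_norm_le {R : realType} (G : R * R -> R) (c : R) (z : R * R) :
  continuous G -> (forall y, `|G y| <= c) -> `|pint G z| <= c * `|z.2|.
Proof.
move=> cG Gc; rewrite [z]surjective_pairing /=.
apply: (@prim_norm_le R (fun y => pint G (z.1, y)) (fun y => G (z.1, y))).
- exact: pint0.
- by move=> y; exact: is_derive_pint_slice.
- by move=> y _; exact: Gc.
Qed.

Lemma pint_slow1_derive1 {R : realType} (p q : R) (z : R * R) : 1 < p -> p < q ->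
  is_derive z (dir1 R) (pint (slow1 p q)) (pint (slow2 p q) z).
Proof.
move=> p1 pq; apply: is_derive_pint1.
- by move=> y; exact: (Ckon_cont (Ckon_slow1 p1 pq) I).
- exact: continuous_slow2.
- by move=> y; exact: is_derive_slow2.
Qed.

Lemma pint_slow1_derive2 {R : realType} (p q : R) (z : R * R) : 1 < p -> p < q ->
  is_derive z (dir2 R) (pint (slow1 p q)) (slow1 p q z).
Proof.
move=> p1 pq; apply: is_derive_pint2.
by move=> y; exact: (Ckon_cont (Ckon_slow1 p1 pq) I).
Qed.

(* Differentiating the identity slow * D theta = D beta - (d time / d eta) * D eta
   expresses the second derivatives of theta without a quotient. *)
Lemma theta_tame {R : realType} (V : normedModType R) (p q : R) (A : set V) (z0 : V)
    (E eta beta : V -> R) : 1 < p -> p < q -> open A ->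
  Ckon 2 A eta -> Ckon 2 A beta ->
  (\forall z \near within A (nbhs z0), eta z <= 0) ->
  evb (within A (nbhs z0)) beta ->
  tame12 (within A (nbhs z0)) E eta -> tame12 (within A (nbhs z0)) E beta ->
  let b := fun z => theta p q (eta z, beta z) in
  [/\ Ckon 2 A b, evb (within A (nbhs z0)) b & tame12 (within A (nbhs z0)) E b].
Proof.
move=> p1 pq oA Ce Cb e0 [Mb HMb] [e1 e2] [b1 b2] b.
have q1 : 1 < q by exact: lt_trans pq.
have nA : \forall x \near within A (nbhs z0), A x by exact: withinT.
have [C Db] : Ckon 2 A b /\ ((0 < 2)%N -> forall x v : V, A x ->
    is_derive x v b (('D_v beta x - 'D_(dir1 R) (time p q) (eta x, b x) * 'D_v eta x)
      / 'D_(dir2 R) (time p q) (eta x, b x))).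
  apply: (@Ckon_implicit R V 2 A setT (time p q) eta b beta oA openT (Ckon_time p1 pq) Ce Cb).
  - move=> x Ax; rewrite /b.
    apply: (@continuous_comp _ _ _ (fun x => (eta x, beta x)) (theta p q)).
      exact: (continuous_pair (Ckon_cont Ce Ax) (Ckon_cont Cb Ax)).
    exact: continuous_theta.
  - by [].
  - by move=> x Ax; rewrite /b (thetaP (eta x, beta x) p1 pq).
  - move=> z _; rewrite (@derive_val _ _ _ _ _ _ _ (is_derive_time2 z p1 pq)).
    exact: lt0r_neq0 (slow_gt0 _ p1 pq).
have s0 x : slow p q (eta x, b x) != 0 by exact: lt0r_neq0 (slow_gt0 _ p1 pq).
(* Amplitudes at most 1 have slow >= 1/3, hence the angle is at most three times the elapsed
   time. *)
have bb : evb (within A (nbhs z0)) b.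
  exists (3 * Mb); apply: filterS2 e0 HMb => x ex bx.
  by apply: le_trans (theta_norm_le (beta x) p1 pq ex) _; rewrite ler_pM2l.
have bs : evb (within A (nbhs z0)) (fun x => (slow p q (eta x, b x))^-1).
  exists 3; apply: filterS e0 => x ex.
  rewrite ger0_norm ?invr_ge0 ?(ltW (slow_gt0 _ p1 pq))//.
  have h : 3^-1 <= slow p q (eta x, b x) by exact: slow_ge3.
  by rewrite -[leRHS]invrK lef_pV2 ?posrE ?invr_gt0 ?(slow_gt0 _ p1 pq).
have b1s : evb (within A (nbhs z0)) (fun x => slow1 p q (eta x, b x)).
  exists (q - 1); apply: nearW => x; have /andP[l1 l2] := slow1_bounds (eta x, b x) p1 pq.
  by rewrite ler_norml l1 /= (le_trans (ltW l2))// subr_ge0 ltW.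
have bds : evb (within A (nbhs z0)) (fun x => 'D_(dir2 R) (slow p q) (eta x, b x)).
  have [c _ Hc] := slow_dir2_bound p1 pq.
  by exists c; apply: nearW => x; exact: Hc.
have bpint (G : R * R -> R) c : continuous G -> (forall z, `|G z| <= c) ->
    evb (within A (nbhs z0)) (fun x => pint G (eta x, b x)).
  move=> cG Gc; have [N HN] := bb; exists (`|c| * N); apply: filterS HN => x bx.
  apply: le_trans (pint_norm_le (c := `|c|) _ cG _) _.
    by move=> y; apply: le_trans (Gc y) (ler_norm _).
  by rewrite ler_wpM2l.
have bP : evb (within A (nbhs z0)) (fun x => pint (slow1 p q) (eta x, b x)).
  apply: (bpint _ (q - 1)).
    by move=> y; exact: (Ckon_cont (Ckon_slow1 p1 pq) I).
  move=> z; have /andP[l1 l2] := slow1_bounds z p1 pq.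
  by rewrite ler_norml l1 /= (le_trans (ltW l2))// subr_ge0 ltW.
have bP2 : evb (within A (nbhs z0)) (fun x => pint (slow2 p q) (eta x, b x)).
  apply: (bpint _ (2 * (q - 1) ^+ 2)).
    exact: continuous_slow2.
  by move=> z; exact: slow2_bound.
have Dbv x v : A x -> 'D_v b x =
    (slow p q (eta x, b x))^-1 * ('D_v beta x - pint (slow1 p q) (eta x, b x) * 'D_v eta x).
  move=> Ax; rewrite (@derive_val _ _ _ _ _ _ _ (Db isT x v Ax)).
  rewrite (@derive_val _ _ _ _ _ _ _ (is_derive_time2 (eta x, b x) p1 pq)).
  rewrite (@derive_val _ _ _ _ _ _ _ (is_derive_time1 (eta x, b x) p1 pq)).
  exact: mulrC.
have t1 v : Hs (within A (nbhs z0)) E ('D_v b).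
  apply: (@Hs_eq _ _ _ _ _ (fun x => (slow p q (eta x, b x))^-1 *
     ('D_v beta x + - (pint (slow1 p q) (eta x, b x) * 'D_v eta x)))).
    by apply: filterS nA => x Ax; rewrite Dbv.
  exact: (Hs_bmul bs (Hs_add (b1 v) (Hs_opp (Hs_bmul bP (e1 v))))).
split; [exact: C|exact: bb|split; first exact: t1] => v w.
have Dse x : A x -> is_derive x w (fun x => slow p q (eta x, b x))
    (slow1 p q (eta x, b x) * 'D_w eta x + 'D_(dir2 R) (slow p q) (eta x, b x) * 'D_w b x).
  move=> Ax; apply: (@is_derive_chain2 R V (slow p q) (slow1 p q) ('D_(dir2 R) (slow p q)) eta b).
  - by apply: near_all => z; exact: is_derive_slow1.
  - by apply: near_all => z; exact: (@Ckon_is_derive _ _ _ 0 setT _ _ _ (Ckon_slow p1 pq) I).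
  - exact: (Ckon_cont (Ckon_slow1 p1 pq) I).
  - exact: (Ckon_cont (Ckon_D (dir2 R) (Ckon_slow p1 pq)) I).
  - exact: (Ckon_is_derive w Ce Ax).
  - exact: (Ckon_is_derive w C Ax).
have DPe x : A x -> is_derive x w (fun x => pint (slow1 p q) (eta x, b x))
    (pint (slow2 p q) (eta x, b x) * 'D_w eta x + slow1 p q (eta x, b x) * 'D_w b x).
  move=> Ax; apply: (@is_derive_chain2 R V (pint (slow1 p q)) (pint (slow2 p q)) (slow1 p q) eta b).
  - by apply: near_all => z; exact: pint_slow1_derive1.
  - by apply: near_all => z; exact: pint_slow1_derive2.
  - by apply: continuous_pint; exact: continuous_slow2.
  - exact: (Ckon_cont (Ckon_slow1 p1 pq) I).
  - exact: (Ckon_is_derive w Ce Ax).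
  - exact: (Ckon_is_derive w C Ax).
apply: (@Os_eq _ _ _ _ _ (fun x => (slow p q (eta x, b x))^-1 * ('D_w ('D_v beta) x +
   - (pint (slow1 p q) (eta x, b x) * 'D_w ('D_v eta) x) +
   - (pint (slow2 p q) (eta x, b x) * ('D_w eta x * 'D_v eta x)) +
   - (slow1 p q (eta x, b x) * ('D_w b x * 'D_v eta x)) +
   - (slow1 p q (eta x, b x) * ('D_w eta x * 'D_v b x)) +
   - ('D_(dir2 R) (slow p q) (eta x, b x) * ('D_w b x * 'D_v b x))))).
  apply: filterS nA => x Ax.
  have L := @is_deriveM _ _ _ _ _ _ _ _ (Dse x Ax) (Ckon_is_derive w (Ckon_D v C) Ax).
  have Rr := @is_deriveB _ _ _ _ _ _ _ _ _ (Ckon_is_derive w (Ckon_D v Cb) Ax)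
    (@is_deriveM _ _ _ _ _ _ _ _ (DPe x Ax) (Ckon_is_derive w (Ckon_D v Ce) Ax)).
  have := @derive_val _ _ _ _ _ _ _ L.
  rewrite (@D_eq _ _ A ((fun x => slow p q (eta x, b x)) * 'D_v b) ('D_v beta - (fun x => pint (slow1 p q) (eta x, b x)) * 'D_v eta)
     w x oA _ Ax); last first.
    by move=> y Ay; rewrite /= !fctE Dbv// mulrA mulfV ?mul1r.
  rewrite (@derive_val _ _ _ _ _ _ _ Rr) /GRing.scale /=.
  move: (s0 x); move: (slow p q (eta x, b x)) ('D_w ('D_v beta) x) ('D_w ('D_v eta) x) ('D_w ('D_v b) x).
  move: (pint (slow1 p q) (eta x, b x)) (pint (slow2 p q) (eta x, b x)).
  move: (slow1 p q (eta x, b x)) ('D_(dir2 R) (slow p q) (eta x, b x)).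
  move: ('D_w eta x) ('D_w b x) ('D_v eta x) ('D_v b x).
  move=> a1 a2 a3 a4 a5 a6 a7 a8 a9 a10 a11 a12 S0 H.
  apply: (mulfI S0); rewrite (mulVKf S0).
  by apply: (addIr (a4 * (a5 * a1 + a6 * a2))); rewrite -H; ring.
have o1 := fun v w => Hs_Os (e1 v) (e1 w).
apply: (Os_bmul bs); repeat apply: Os_add; try apply: Os_opp.
- exact: b2.
- exact: (Os_bmul bP (e2 v w)).
- exact: (Os_bmul bP2 (Hs_Os (e1 w) (e1 v))).
- exact: (Os_bmul b1s (Hs_Os (t1 w) (e1 v))).
- exact: (Os_bmul b1s (Hs_Os (e1 w) (t1 v))).
- exact: (Os_bmul bds (Hs_Os (t1 w) (t1 v))).
Qed.

(** * Polar coordinates in space *)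

Notation spacetime R := ('cV[R]_3 * R)%type.

Definition off0 (R : realType) : set (spacetime R) := [set z | 0 < enorm z.1].

Arguments off0 R _ : clear implicits.

Definition dirx {R : realType} (j : 'I_3) (z : spacetime R) : R := z.1 j ord0 / enorm z.1.

Notation radius R := (fun z : spacetime R => enorm z.1).

Lemma enorm_ge0 {R : realType} (x : 'cV[R]_3) : 0 <= enorm x.
Proof. exact: sqrtr_ge0. Qed.

Lemma enorm_sqr {R : realType} (x : 'cV[R]_3) : enorm x ^+ 2 = \sum_(i < 3) x i ord0 ^+ 2.
Proof. by rewrite sqr_sqrtr// sumr_ge0// => i _; exact: sqr_ge0. Qed.

Lemma enorm0 {R : realType} : enorm (0 : 'cV[R]_3) = 0.
Proof. by rewrite /enorm big1 ?sqrtr0// => i _; rewrite mxE expr0n. Qed.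

Lemma enorm_eq0 {R : realType} (x : 'cV[R]_3) : enorm x = 0 -> x = 0.
Proof.
move=> x0; apply/colP => i; rewrite mxE; apply/eqP; rewrite -sqrf_eq0.
have := enorm_sqr x; rewrite x0 expr0n /= => /esym/eqP.
by rewrite psumr_eq0 => [/allP/(_ i)|j _]; [apply; rewrite mem_index_enum|exact: sqr_ge0].
Qed.

Lemma enorm_gt0 {R : realType} (x : 'cV[R]_3) : (0 < enorm x) = (x != 0).
Proof.
rewrite lt_neqAle enorm_ge0 andbT eq_sym; congr (~~ _); apply/eqP/eqP => [/enorm_eq0 //|->].
exact: enorm0.
Qed.

Lemma enormZ {R : realType} (a : R) (x : 'cV[R]_3) : enorm (a *: x) = `|a| * enorm x.
Proof.
rewrite /enorm -sqrtr_sqr -sqrtrM ?sqr_ge0// mulr_sumr; congr Num.sqrt.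
by apply: eq_bigr => i _; rewrite mxE exprMn.
Qed.

Lemma coord_le_enorm {R : realType} (x : 'cV[R]_3) j : `|x j ord0| <= enorm x.
Proof.
rewrite -sqrtr_sqr ler_wsqrtr// (bigD1 j)//= lerDl sumr_ge0// => i _; exact: sqr_ge0.
Qed.

Lemma enorm_e1 {R : realType} : enorm (delta_mx 0 0 : 'cV[R]_3) = 1.
Proof.
rewrite /enorm (bigD1 ord0)//= mxE !eqxx expr1n big1 ?addr0 ?sqrtr1// => i i0.
by rewrite mxE (negbTE i0) expr0n.
Qed.

Lemma continuous_coord {R : realType} (j : 'I_3) : continuous (fun z : spacetime R => z.1 j ord0).
Proof.
move=> z; apply: (@continuous_comp _ _ _ fst (fun x : 'cV[R]_3 => x j ord0)).
  exact: cvg_fst.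
exact: coord_continuous.
Qed.

Lemma Ckon_coord {R : realType} k (A : set (spacetime R)) j : open A ->
  Ckon k A (fun z : spacetime R => z.1 j ord0).
Proof.
move=> oA; apply: (Ckon_linear _ oA); first exact: continuous_coord.
by move=> h v z; rewrite /= !mxE.
Qed.

Lemma coord_derive {R : realType} (z v : spacetime R) j :
  'D_v (fun z : spacetime R => z.1 j ord0) z = v.1 j ord0.
Proof.
have L (h : R) (y : spacetime R) : (h *: v + y).1 j ord0 = h *: v.1 j ord0 + y.1 j ord0.
  by rewrite /= !mxE.
by have [_ ->] := @is_derive_affine R (spacetime R) R R id (fun z => z.1 j ord0)
  (fun z => z.1 j ord0) z v _ L (is_derive_id _ _).
Qed.

Lemma Ckon_sum {R : realType} (V W : normedModType R) n k (A : set V) (f : 'I_n -> V -> W) :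
  open A -> (forall i, Ckon k A (f i)) -> Ckon k A (fun z => \sum_(i < n) f i z).
Proof.
move=> oA; elim: n f => [|n IH] f Cf.
  by apply: (Ckon_eq oA _ (Ckon_cst k A (0 : W))) => x _; rewrite big_ord0.
apply: (Ckon_eq oA _ (Ckon_add oA (IH _ (fun i => Cf (widen_ord (leqnSn n) i))) (Cf ord_max))).
by move=> x _; rewrite big_ord_recr.
Qed.

Lemma D_sum {R : realType} (V : normedModType R) n k (A : set V) (f : 'I_n -> V -> R) v x :
  (forall i, Ckon k.+1 A (f i)) -> A x ->
  'D_v (fun z => \sum_(i < n) f i z) x = \sum_(i < n) 'D_v (f i) x.
Proof.
move=> Cf Ax; have -> : (fun z => \sum_(i < n) f i z) = \sum_(i < n) f i.
  by apply/funext => z; rewrite fct_sumE.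
by rewrite derive_sum// => i; have [] := Ckon_is_derive v (Cf i) Ax.
Qed.

Lemma continuous_enorm {R : realType} : continuous (radius R).
Proof.
move=> z; apply: (@continuous_comp _ _ _ (fun z : spacetime R => \sum_(i < 3) z.1 i ord0 ^+ 2) Num.sqrt).
  have C : Ckon 0 setT (fun z : spacetime R => \sum_(i < 3) z.1 i ord0 ^+ 2).
    apply: (Ckon_sum openT) => i; exact: (Ckon_mul openT (Ckon_coord _ i openT) (Ckon_coord _ i openT)).
  exact: (C z I).
exact: sqrt_continuous.
Qed.

Lemma open_off0 {R : realType} : open (off0 R).
Proof. exact: (open_comp (fun z _ => continuous_enorm (x := z)) (@open_gt R 0)). Qed.

Lemma Ckon_enorm {R : realType} k : Ckon k (off0 R) (radius R).
Proof.
have C : Ckon k (off0 R) (fun z : spacetime R => \sum_(i < 3) z.1 i ord0 * z.1 i ord0).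
  apply: (Ckon_sum open_off0) => i.
  by apply: (Ckon_mul open_off0); exact: (Ckon_coord _ _ open_off0).
have S (z : spacetime R) : \sum_(i < 3) z.1 i ord0 * z.1 i ord0 = enorm z.1 ^+ 2.
  by rewrite enorm_sqr; apply: eq_bigr => i _; rewrite expr2.
apply: (Ckon_eq open_off0 _ (Ckon_comp1 open_off0 (Ckon_powR k 2^-1) C _)).
  by move=> z Az; rewrite /= S powR12_sqrt ?sqr_ge0// sqrtr_sqr ger0_norm// enorm_ge0.
by move=> z Az; rewrite /= S exprn_gt0.
Qed.

Lemma enorm_off0 {R : realType} (z : spacetime R) : off0 R z -> enorm z.1 != 0.
Proof. by move=> Az; exact: lt0r_neq0. Qed.

Lemma Ckon_dirx {R : realType} k (j : 'I_3) : Ckon k (off0 R) (dirx j).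
Proof.
apply: (Ckon_mul open_off0 (Ckon_coord _ _ open_off0)).
exact: (Ckon_inv open_off0 (@enorm_off0 R) (Ckon_enorm k)).
Qed.

Lemma dirx_le1 {R : realType} (j : 'I_3) (z : spacetime R) : off0 R z -> `|dirx j z| <= 1.
Proof.
move=> Az; rewrite /dirx normrM normfV (ger0_norm (enorm_ge0 _)) ler_pdivrMr// mul1r.
exact: coord_le_enorm.
Qed.

(** Differentiates |x|^2 as a product and as a sum of squares and compares, instead of
    differentiating the root. *)
Lemma enorm_derive {R : realType} (z v : spacetime R) : off0 R z ->
  'D_v (radius R) z = \sum_(i < 3) dirx i z * v.1 i ord0.
Proof.
have half (S P : R) : 2 * S = P + P -> P = S by move=> *; lra.
move=> Az; have n0 := enorm_off0 Az; have CN := @Ckon_enorm R 1.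
have Cx i : Ckon 1 (off0 R) (fun z : spacetime R => z.1 i ord0).
  exact: (Ckon_coord _ _ open_off0).
have := D_mul v CN CN Az.
rewrite (D_eq v (g := fun z : spacetime R => \sum_(i < 3) z.1 i ord0 * z.1 i ord0) open_off0 _ Az).
  rewrite (D_sum (n := 3) (k := 0) (f := fun i (z : spacetime R) => z.1 i ord0 * z.1 i ord0) v
    (fun i => Ckon_mul open_off0 (Cx i) (Cx i)) Az).
  rewrite (eq_bigr (fun i => 2 * (z.1 i ord0 * v.1 i ord0))); last first.
    by move=> i _; rewrite (D_mul v (Cx i) (Cx i) Az) coord_derive; ring.
  rewrite -mulr_sumr => /half H; apply: (mulfI n0); rewrite H mulr_sumr.
  by apply: eq_bigr => i _; rewrite /dirx; field.
by move=> y _; rewrite -expr2 enorm_sqr; apply: eq_bigr => i _; rewrite expr2.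
Qed.

(** From |x| times [dirx j] = x_j by the product rule; keeping the factor |x| on the left postpones
    the division. *)
Lemma dirx_derive {R : realType} (j : 'I_3) (z v : spacetime R) : off0 R z ->
  enorm z.1 * 'D_v (dirx j) z =
    v.1 j ord0 - dirx j z * 'D_v (radius R) z.
Proof.
move=> Az; have := D_mul v (@Ckon_enorm R 1) (@Ckon_dirx R 1 j) Az.
rewrite (D_eq v (g := fun z : spacetime R => z.1 j ord0) open_off0 _ Az).
  by rewrite coord_derive => ->; rewrite addrK.
by move=> y Ay; rewrite /dirx mulrC divfK// enorm_off0.
Qed.

Lemma enorm_derive2 {R : realType} (z v w : spacetime R) : off0 R z ->
  'D_w ('D_v (radius R)) z = \sum_(i < 3) v.1 i ord0 * 'D_w (dirx i) z.
Proof.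
move=> Az.
rewrite (D_eq w (g := fun z : spacetime R => \sum_(i < 3) v.1 i ord0 * dirx i z) open_off0 _ Az).
  rewrite (D_sum (k := 0) w _ Az).
    apply: eq_bigr => i _; rewrite (D_mul w (Ckon_cst 1 (off0 R) (v.1 i ord0 : R)) (@Ckon_dirx R 1 i) Az).
    by rewrite derive_cst mulr0 addr0.
  by move=> i; exact: (Ckon_mul open_off0 (Ckon_cst _ _ _) (@Ckon_dirx R _ i)).
by move=> y Ay; rewrite (enorm_derive v Ay); apply: eq_bigr => i _; rewrite mulrC.
Qed.

Lemma dirx_derive2 {R : realType} (j : 'I_3) (z v w : spacetime R) : off0 R z ->
  'D_w ('D_v (dirx j)) z = (enorm z.1)^-1 *
    - ('D_w (radius R) z * 'D_v (dirx j) z +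
       (dirx j z * 'D_w ('D_v (radius R)) z +
        'D_v (radius R) z * 'D_w (dirx j) z)).
Proof.
move=> Az; have n0 := enorm_off0 Az.
have CN : Ckon 1 (off0 R) ('D_v (radius R)) by exact: (Ckon_D v (Ckon_enorm 2)).
have Ce : Ckon 1 (off0 R) ('D_v (dirx j)) by exact: (Ckon_D v (@Ckon_dirx R 2 j)).
have Cd : Ckon 1 (off0 R) (@dirx R j) by exact: Ckon_dirx.
have := D_mul w (@Ckon_enorm R 1) Ce Az.
rewrite (D_eq w (g := fun z : spacetime R => v.1 j ord0 +
    -1 * (dirx j z * 'D_v (radius R) z)) open_off0 _ Az); last first.
  by move=> y Ay; rewrite (dirx_derive j v Ay) mulN1r.
have C1 : Ckon 1 (off0 R) (fun z => dirx j z * 'D_v (radius R) z).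
  exact: (Ckon_mul open_off0 Cd CN).
have C0 (c : R) : Ckon 1 (off0 R) (fun=> c) by exact: Ckon_cst.
rewrite (D_add w (C0 (v.1 j ord0)) (Ckon_mul open_off0 (C0 (-1)) C1) Az).
rewrite (D_mul w (C0 (-1)) C1 Az) !derive_cst (D_mul w Cd CN Az).
move: n0; move: (enorm z.1) ('D_w ('D_v (dirx j)) z).
move: ('D_w ('D_v (radius R)) z) ('D_w (radius R) z).
move: ('D_v (radius R) z) ('D_v (dirx j) z) ('D_w (dirx j) z) (dirx j z).
move=> a1 a2 a3 a4 a5 a6 a7 a8 n0 H; apply: (mulfI n0); rewrite (mulVKf n0).
by apply: (addIr (a2 * a6)); rewrite -H; ring.
Qed.

Lemma evb_sum {R : realType} {T : Type} {F : set_system T} {FF : Filter F} n (f : 'I_n -> T -> R) :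
  (forall i, evb F (f i)) -> evb F (fun z => \sum_(i < n) f i z).
Proof.
elim: n f => [|n IH] f Ef.
  by apply: (evb_eq _ (evb_cst 0)); apply: nearW => x; rewrite big_ord0.
apply: (evb_eq _ (evb_add (IH _ (fun i => Ef (widen_ord (leqnSn n) i))) (Ef ord_max))).
by apply: nearW => x; rewrite big_ord_recr.
Qed.

Lemma Hs_sum {R : realType} {T : Type} {F : set_system T} {FF : Filter F} E n (f : 'I_n -> T -> R) :
  (forall i, Hs F E (f i)) -> Hs F E (fun z => \sum_(i < n) f i z).
Proof.
elim: n f => [|n IH] f Ef.
  apply: (cvg_near_eq (f := fun=> 0)); last exact: cvg_cst.
  by apply: nearW => x; rewrite big_ord0 expr0n mulr0.
apply: (Hs_eq _ (Hs_add (IH _ (fun i => Ef (widen_ord (leqnSn n) i))) (Ef ord_max))).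
by apply: nearW => x; rewrite big_ord_recr.
Qed.

(** First derivatives of x/|x| are of order 1/|x| and second ones of order 1/|x|^2, so the single
    input E / |x|^2 -> 0 suffices. *)
Lemma dirx_tame {R : realType} (z0 : spacetime R) (E : spacetime R -> R) :
  Hs (within (off0 R) (nbhs z0)) E (fun z => (enorm z.1)^-1) ->
  [/\ forall j, evb (within (off0 R) (nbhs z0)) (dirx j),
      forall v, evb (within (off0 R) (nbhs z0)) ('D_v (radius R)),
      forall v w, Hs (within (off0 R) (nbhs z0)) E ('D_w ('D_v (radius R)))
    & forall j, tame12 (within (off0 R) (nbhs z0)) E (dirx j)].
Proof.
move=> HN; have nA : \forall x \near within (off0 R) (nbhs z0), off0 R x by exact: withinT.
have b1 j : evb (within (off0 R) (nbhs z0)) (dirx j).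
  by exists 1; apply: filterS nA => z; exact: dirx_le1.
have b2 v : evb (within (off0 R) (nbhs z0)) ('D_v (radius R)).
  apply: (@evb_eq _ _ _ _ (fun z => \sum_(i < 3) dirx i z * v.1 i ord0)).
    by apply: filterS nA => z Az; rewrite enorm_derive.
  by apply: evb_sum => i; exact: (evb_mul (b1 i) (evb_cst _)).
have h1 j v : Hs (within (off0 R) (nbhs z0)) E ('D_v (dirx j)).
  apply: (@Hs_eq _ _ _ _ _ (fun z =>
     (v.1 j ord0 + - (dirx j z * 'D_v (radius R) z)) * (enorm z.1)^-1)).
    by apply: filterS nA => z Az; rewrite -(dirx_derive j v Az) mulrAC divff ?mul1r// enorm_off0.
  exact: (Hs_bmul (evb_add (evb_cst _) (evb_opp (evb_mul (b1 j) (b2 v)))) HN).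
have h2 v w : Hs (within (off0 R) (nbhs z0)) E ('D_w ('D_v (radius R))).
  apply: (@Hs_eq _ _ _ _ _ (fun z => \sum_(i < 3) v.1 i ord0 * 'D_w (dirx i) z)).
    by apply: filterS nA => z Az; rewrite enorm_derive2.
  by apply: Hs_sum => i; exact: (Hs_bmul (evb_cst _) (h1 i w)).
split=> // j; split=> [v|v w]; first exact: h1.
apply: (@Os_eq _ _ _ _ _ (fun z =>
   - ('D_w (radius R) z * ((enorm z.1)^-1 * 'D_v (dirx j) z) +
     (dirx j z * ((enorm z.1)^-1 * 'D_w ('D_v (radius R)) z) +
      'D_v (radius R) z * ((enorm z.1)^-1 * 'D_w (dirx j) z))))).
  apply: filterS nA => z Az; rewrite (dirx_derive2 j v w Az).
  move: (enorm z.1)^-1 ('D_w ('D_v (radius R)) z).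
  move: ('D_w (radius R) z) ('D_v (radius R) z).
  move: ('D_v (dirx j) z) ('D_w (dirx j) z) (dirx j z) => *; ring.
exact: (Os_opp (Os_add (Os_bmul (b2 w) (Hs_Os HN (h1 j v)))
  (Os_add (Os_bmul (b1 j) (Hs_Os HN (h2 v w))) (Os_bmul (b2 v) (Hs_Os HN (h1 j w)))))).
Qed.

Lemma near_enorm {R : realType} (z0 : spacetime R) (P : R -> Prop) : z0.1 = 0 ->
  (\forall s \near 0^'+, P s) -> \forall z \near within (off0 R) (nbhs z0), P (enorm z.1).
Proof.
move=> z00 [e /= e0 H].
have : \forall z \near z0, enorm z.1 < e.
  have /cvgrPdist_lt /(_ e e0) := continuous_enorm (x := z0).
  apply: filterS => z; rewrite z00 enorm0 sub0r normrN ger0_norm// ?enorm_ge0//.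
move=> n; have n2 : \forall z \near within (off0 R) (nbhs z0), enorm z.1 < e.
  exact: cvg_within.
have nA : \forall x \near within (off0 R) (nbhs z0), off0 R x by exact: withinT.
apply: filterS2 nA n2 => z Az ez; apply: H => //=.
by rewrite sub0r normrN ger0_norm ?enorm_ge0.
Qed.

(** Transfers the one-variable rates to space-time: exp(h)/s^2 -> 0 controls the direction x/|x| and
    the derivatives of |x|, the other two rates control h(|x|) through the chain rule. *)
Lemma radial_tame {R : realType} (z0 : spacetime R) (h : R -> R) : z0.1 = 0 ->
  Ckon 2 [set s : R | 0 < s] h ->
  (forall e, 0 < e -> \forall s \near 0^'+, [/\ h s <= 0, expR (h s) * 'D_1 h s ^+ 2 <= e,
      expR (h s) * `|'D_1 ('D_1 h) s| <= e & expR (h s) <= e * s ^+ 2]) ->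
  let F := within (off0 R) (nbhs z0) in
  let E := fun z : spacetime R => expR (h (enorm z.1)) in
  [/\ \forall z \near F, h (enorm z.1) <= 0, E @ F --> (0 : R),
      forall j, evb F (dirx j), forall j, tame12 F E (dirx j)
    & tame12 F E (fun z => h (enorm z.1))].
Proof.
move=> z00 Ch H F E.
have nA : \forall x \near F, off0 R x by exact: withinT.
have cv (G : R -> R) : (forall e, 0 < e -> \forall s \near 0^'+, `|G s| <= e) ->
    (fun z : spacetime R => G (enorm z.1)) @ F --> (0 : R).
  move=> HG; apply/cvgrPdist_le => e /HG /(near_enorm z00); apply: filterS => z.
  by rewrite sub0r normrN.
have pos : \forall s \near (0 : R)^'+, 0 < s by exact: nbhs_right_gt.
have h1 : Hs F E (fun z => (enorm z.1)^-1).
  apply: (cv (fun s => expR (h s) * s^-1 ^+ 2)) => e /H; apply: filterS2 pos => s s0 [_ _ _ le].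
  rewrite (ger0_norm (mulr_ge0 (expR_ge0 _) (sqr_ge0 _))).
  by rewrite exprVn ler_pdivrMr// exprn_gt0.
have [b1 b2 h2 te] := dirx_tame h1.
have h3 : Hs F E (fun z => 'D_1 h (enorm z.1)).
  apply: (cv (fun s => expR (h s) * 'D_1 h s ^+ 2)) => e /H; apply: filterS => s [_ le _ _].
  by rewrite (ger0_norm (mulr_ge0 (expR_ge0 _) (sqr_ge0 _))).
have o3 : Os F E (fun z => 'D_1 ('D_1 h) (enorm z.1)).
  apply: (cv (fun s => expR (h s) * 'D_1 ('D_1 h) s)) => e /H; apply: filterS => s [_ _ le _].
  by rewrite normrM ger0_norm ?expR_ge0.
split.
- by apply: (near_enorm z00 (P := fun s => h s <= 0)); apply: filterS (H 1 ltr01) => s [].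
- have bN : evb F (radius R) by apply: evb_continuous; exact: continuous_enorm.
  apply: (cvg_near_eq _ (Os_bmul (evb_mul bN bN) (h1 : Os F E (fun z => (enorm z.1)^-1 ^+ 2)))).
  apply: filterS nA => z Az; rewrite -expr2 exprVn divff ?mulr1// expf_neq0// enorm_off0//.
- exact: b1.
- exact: te.
split=> [v|v w].
  apply: (@Hs_eq _ _ _ _ _ (fun z => 'D_v (radius R) z * 'D_1 h (enorm z.1))).
    apply: filterS nA => z Az; rewrite mulrC.
    by rewrite -(D_comp1 (B := [set s : R | 0 < s]) v Ch (@Ckon_enorm R 2) Az).
  exact: (Hs_bmul (b2 v) h3).
apply: (@Os_eq _ _ _ _ _ (fun z =>
   'D_1 h (enorm z.1) * 'D_w ('D_v (radius R)) z +
   'D_v (radius R) z * ('D_w (radius R) z *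
     'D_1 ('D_1 h) (enorm z.1)))).
  apply: filterS nA => z Az; symmetry.
  apply: (etrans (D2_comp1 (B := [set s : R | 0 < s]) v w open_off0 Ch (@Ckon_enorm R 2) (fun _ h => h) Az)).
  by congr (_ + _ * _); exact: mulrC.
exact: (Os_add (Hs_Os h3 (h2 v w)) (Os_bmul (b2 v) (Os_bmul (b2 w) o3))).
Qed.

(** * Regularity of the field *)

(** The shift [b] is part of the construction, so one set of lemmas treats the breather and all its
    phase shifts. *)
Definition phase {R : realType} (p q : R) (sg b : 'cV[R]_3 -> R) (h : R -> R) (z : spacetime R) : R :=
  theta p q (h (enorm z.1), sg z.1 * (z.2 + b z.1)).

(* At x = 0 the division yields 0, and the field is multiplied by x there anyway. *)
Definition gain {R : realType} (p q : R) (ta sg b : 'cV[R]_3 -> R) (h : R -> R) (z : spacetime R) : R :=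
  ta z.1 * (expR (h (enorm z.1)) * sin (phase p q sg b h z)) / enorm z.1.

Definition field {R : realType} (p q : R) (ta sg b : 'cV[R]_3 -> R) (h : R -> R)
    (x : 'cV[R]_3) (t : R) : 'cV[R]_3 := gain p q ta sg b h (x, t) *: x.

Lemma Ckon_space {R : realType} k (f : 'cV[R]_3 -> R) : Ck k f ->
  Ckon k setT (fun z : spacetime R => f z.1).
Proof.
move=> /Ckon_setT Cf.
exact: (@Ckon_affine R (spacetime R) 'cV[R]_3 R k setT f fst fst openT
  (fun z => cvg_fst) (fun _ _ _ => erefl) Cf).
Qed.

Lemma is_derive_space {R : realType} (f : spacetime R -> R) (x v : 'cV[R]_3) (t d : R) :
  is_derive (x, t) (v, 0) f d -> is_derive x v (fun y => f (y, t)) d.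
Proof.
apply: (@is_derive_affine R 'cV[R]_3 (spacetime R) R f (fun y => (y, t)) (fun y => (y, 0)) x v).
by move=> h y; congr (_, _); rewrite /= scaler0 add0r.
Qed.

Lemma D1_sin {R : realType} (x : R) : 'D_1 (@sin R) x = cos x.
Proof. by have [_ ->] := is_derive_sin x. Qed.

Lemma D2_sin {R : realType} (x : R) : 'D_1 ('D_1 (@sin R)) x = - sin x.
Proof.
have -> : 'D_1 (@sin R) = cos by apply/funext => y; exact: D1_sin.
by have [_ ->] := is_derive_cos x.
Qed.

Lemma norm_cos_le1 {R : realType} (x : R) : `|cos x| <= 1.
Proof. by rewrite ler_norml cos_geN1 cos_le1. Qed.

Section field_regularity.
Context {R : realType} (p q : R) (ta sg b : 'cV[R]_3 -> R) (h : R -> R).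
Hypotheses (p1 : 1 < p) (pq : p < q).
Hypotheses (Cta : Ck 2 ta) (Csg : Ck 2 sg) (Cb : Ck 2 b).
Hypothesis Ch : Ckon 2 [set s : R | 0 < s] h.
Hypothesis Hh : forall e, 0 < e -> \forall s \near 0^'+, [/\ h s <= 0,
  expR (h s) * 'D_1 h s ^+ 2 <= e, expR (h s) * `|'D_1 ('D_1 h) s| <= e & expR (h s) <= e * s ^+ 2].
Hypotheses (ta_radial : radial ta) (sg_radial : radial sg) (b_radial : radial b).

Lemma Ckon_clock : Ckon 2 setT (fun z : spacetime R => sg z.1 * (z.2 + b z.1)).
Proof.
apply: (Ckon_mul openT (Ckon_space Csg)); apply: (Ckon_add openT _ (Ckon_space Cb)).
apply: (Ckon_linear _ openT); first by move=> z; exact: cvg_snd.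
by [].
Qed.

Lemma Ckon_eta : Ckon 2 (off0 R) (fun z : spacetime R => h (enorm z.1)).
Proof. exact: (Ckon_comp1 (@open_off0 R) Ch (@Ckon_enorm R 2) (fun _ H => H)). Qed.

Lemma Ckon_phase : Ckon 2 (off0 R) (phase p q sg b h).
Proof.
have Cc : Ckon 2 (off0 R) (fun z : spacetime R => sg z.1 * (z.2 + b z.1)).
  exact: (Ckon_sub (@subsetT _ _) Ckon_clock).
have [C _] := @Ckon_implicit R (spacetime R) 2 (off0 R) setT (time p q)
  (fun z : spacetime R => h (enorm z.1)) (phase p q sg b h) _ (@open_off0 R) openT
  (Ckon_time p1 pq) Ckon_eta Cc
  (fun z Az => continuous_comp (continuous_pair (Ckon_cont Ckon_eta Az) (Ckon_cont Cc Az))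
     (continuous_theta p1 pq (x := _)))
  (fun _ _ => I) (fun z _ => thetaP (h (enorm z.1), sg z.1 * (z.2 + b z.1)) p1 pq)
  (fun z _ => etrans (congr1 (fun y => y != 0) (@derive_val _ _ _ _ _ _ _ (is_derive_time2 z p1 pq)))
     (lt0r_neq0 (slow_gt0 z p1 pq))).
exact: C.
Qed.

Lemma Ckon_sin_phase : Ckon 2 (off0 R) (fun z => sin (phase p q sg b h z)).
Proof. exact: (@Ckon_comp1 R (spacetime R) 2 (off0 R) setT sin (phase p q sg b h) (@open_off0 R)
  (@Ckon_sin_cos R 2).1 Ckon_phase (fun _ _ => I)). Qed.

Lemma Ckon_gain : Ckon 2 (off0 R) (gain p q ta sg b h).
Proof.
have o := @open_off0 R.
apply: (Ckon_mul o _ (Ckon_inv o (@enorm_off0 R) (@Ckon_enorm R 2))).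
apply: (Ckon_mul o (Ckon_sub (@subsetT _ _) (Ckon_space Cta))).
apply: (Ckon_mul o _ Ckon_sin_phase).
exact: (@Ckon_comp1 R (spacetime R) 2 (off0 R) setT expR _ o (@Ckon_expR R 2) Ckon_eta (fun _ _ => I)).
Qed.

Lemma notin_off0 (z : spacetime R) : ~ off0 R z -> z.1 = 0.
Proof. by rewrite /off0 /= => /negP; rewrite enorm_gt0 negbK => /eqP. Qed.

(** Each component is exp(h(|x|)) times the product of tau, the sine of the phase and a component of
    x/|x|. These factors are bounded and tame, so [tame_vanishes] applies. *)
Lemma field_vanishes (z0 : spacetime R) j : z0.1 = 0 ->
  vanishes 2 (off0 R) z0 (fun z => field p q ta sg b h z.1 z.2 j ord0).
Proof.
move=> z00; have o := @open_off0 R.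
have [e0 Ec be te teta] := radial_tame z00 Ch Hh.
set F := within _ _ in e0 Ec be te teta; set E := fun z : spacetime R => _ in Ec te teta.
have bndc (f : spacetime R -> R) : Ckon 2 setT f -> evb F f.
  by move=> Cf; apply: evb_continuous; exact: (Ckon_cont Cf I).
have [Cp bp tp] := theta_tame p1 pq o Ckon_eta (Ckon_sub (@subsetT _ _) Ckon_clock) e0
  (bndc _ Ckon_clock) teta (tame12_smooth Ec Ckon_clock).
have bsin : evb F (fun z => sin (phase p q sg b h z)).
  by exists 1; apply: nearW => z; exact: norm_sin_le1.
have tsin : tame12 F E (fun z => sin (phase p q sg b h z)).
  apply: (@tame12_comp R (spacetime R) (off0 R) z0 E sin (phase p q sg b h) o (@Ckon_sin_cos R 2).1 Cp _ _ tp).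
    exists 1; apply: nearW => z; exact: (eq_ind_r (fun y => `|y| <= 1) (norm_cos_le1 _) (D1_sin _)).
  exists 1; apply: nearW => z; apply: (eq_ind_r (fun y => `|y| <= 1) _ (D2_sin _)).
  by rewrite normrN norm_sin_le1.
have Cd := @Ckon_dirx R 2 j; have Ct := Ckon_sub (@subsetT _ (off0 R)) (Ckon_space Cta).
have t1 := tame12_mul o Ckon_sin_phase Cd bsin (be j) tsin (te j).
have b1 : evb F (fun z => sin (phase p q sg b h z) * dirx j z) by exact: (evb_mul bsin (be j)).
have t2 := tame12_mul o Ct (Ckon_mul o Ckon_sin_phase Cd) (bndc _ (Ckon_space Cta)) b1
  (tame12_smooth Ec (Ckon_space Cta)) t1.
have b2 : evb F (fun z => ta z.1 * (sin (phase p q sg b h z) * dirx j z)).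
  exact: (evb_mul (bndc _ (Ckon_space Cta)) b1).
have := tame_vanishes o Ckon_eta (Ckon_mul o Ct (Ckon_mul o Ckon_sin_phase Cd)) Ec
  b2 teta t2.
congr (vanishes 2 _ _ _); apply/funext => z; rewrite /field /gain mxE /dirx -surjective_pairing.
move: (enorm z.1)^-1 (expR _) (sin _) (ta _) (z.1 j ord0) => *; ring.
Qed.

(** The set to be crossed is the time axis x = 0. A line through one of its points lies in it if its
    direction has no spatial part and leaves it at once otherwise, which is the dichotomy required
    by [Ckon_glue]. *)
Lemma field_glue j :
  Ckon 2 setT (fun z : spacetime R => field p q ta sg b h z.1 z.2 j ord0) /\
  forall z0 v : spacetime R, z0.1 = 0 ->
    is_derive z0 v (fun z : spacetime R => field p q ta sg b h z.1 z.2 j ord0) 0.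
Proof.
have o := @open_off0 R.
have Z (z : spacetime R) : setT z -> ~ off0 R z -> field p q ta sg b h z.1 z.2 j ord0 = 0.
  by move=> _ Az; rewrite /field (notin_off0 Az) scaler0 mxE.
have L (z0 : spacetime R) : setT z0 -> ~ off0 R z0 -> forall v : spacetime R,
    (\forall s \near 0^', off0 R (s *: v + z0)) \/ (\forall s \near 0^', ~ off0 R (s *: v + z0)).
  move=> _ /notin_off0 z00 v; have [v0|v0] := eqVneq v.1 0.
    by right; apply: nearW => s; rewrite /off0 /= z00 v0 scaler0 addr0 enorm0 ltxx.
  left; have : \forall s \near (0 : R)^', s != 0 by exact: nbhs_dnbhs_neq.
  apply: filterS => s s0; rewrite /off0 /= z00 addr0 enormZ mulr_gt0 ?normr_gt0// enorm_gt0//.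
have C0 : Ckon 2 (off0 R) (fun z : spacetime R => field p q ta sg b h z.1 z.2 j ord0).
  apply: (Ckon_eq o _ (Ckon_mul o Ckon_gain (Ckon_coord 2 j o))).
  by move=> z _; rewrite /field mxE -surjective_pairing.
have [C D] := @Ckon_glue R (spacetime R) 2 (off0 R) setT _ o openT (@subsetT _ _) Z L C0
  (fun z0 _ Az => field_vanishes j (notin_off0 Az)).
split; first exact: C.
move=> z0 v z00; apply: (D isT z0 v I).
by rewrite /off0 /= z00 enorm0 ltxx.
Qed.

Lemma Ck_field : Ck 2 (fun z : spacetime R => field p q ta sg b h z.1 z.2).
Proof.
apply/Ckon_setT.
have C : Ckon 2 setT (fun z : spacetime R =>
    \sum_(j < 3) field p q ta sg b h z.1 z.2 j ord0 *: (delta_mx j ord0 : 'cV[R]_3)).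
  by apply: (Ckon_sum openT) => j; apply: (Ckon_scalel _ openT); exact: (field_glue j).1.
apply: (Ckon_eq openT _ C) => z _; apply/colP => i.
rewrite summxE (bigD1 i)//= big1 ?addr0 ?mxE ?eqxx ?mulr1// => k ki.
by rewrite !mxE eq_sym (negbTE ki) mulr0.
Qed.

(* grad (gain) is parallel to x, hence x_j d_i (gain) is symmetric in i and j. *)
Lemma field_partial (x : 'cV[R]_3) t : exists P : 'I_3 -> 'I_3 -> R,
  (forall i j, P i j = P j i) /\
  forall i j, partial i (fun y => field p q ta sg b h y t j ord0) x = P i j.
Proof.
have [->|x0] := eqVneq x 0.
  exists (fun _ _ => 0); split=> // i j.
  exact: (@derive_val _ _ _ _ _ _ _
    (is_derive_space (t := t) ((field_glue j).2 (0, t) (delta_mx i ord0, 0) erefl))).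
have Az : off0 R (x, t) by rewrite /off0 /= enorm_gt0.
have n0 := enorm_off0 Az; have CN := @Ckon_enorm R 2.
have A1 : off0 R (enorm x *: delta_mx 0 0, t).
  by rewrite /off0 /= enormZ enorm_e1 mulr1 ger0_norm ?enorm_ge0//; exact: Az.
(* The gain read along the first axis; radial symmetry of [ta], [sg] and [b] makes the gain at (y,
   t) equal to [G] at |y|. *)
pose G s := gain p q ta sg b h (s *: delta_mx 0 0, t).
have gG y : gain p q ta sg b h (y, t) = G (enorm y).
  have e : enorm y = enorm (enorm y *: (delta_mx 0 0 : 'cV[R]_3)).
    by rewrite enormZ enorm_e1 mulr1 ger0_norm ?enorm_ge0.
  by rewrite /G /gain /phase /= -e (ta_radial e) (sg_radial e) (b_radial e).
have dG : is_derive (enorm x) (1 : R) G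
   ('D_(1 *: delta_mx 0 0, 0) (gain p q ta sg b h) (enorm x *: delta_mx 0 0, t)).
  apply: (@is_derive_affine R R (spacetime R) R (gain p q ta sg b h)
    (fun s => (s *: delta_mx 0 0, t)) (fun s => (s *: delta_mx 0 0, 0))).
    by move=> s y; congr (_, _); rewrite /= ?scaler0 ?add0r// scalerDl scalerA.
  exact: (Ckon_is_derive _ Ckon_gain A1).
have [g' dG'] : exists g', is_derive (enorm x) (1 : R) G g' by eexists; exact: dG.
(* The product rule for G(|y|) y_j: the derivative of |y| in direction i is x_i / |x|. *)
exists (fun i j => gain p q ta sg b h (x, t) * (i == j)%:R + x j ord0 * (g' * dirx i (x, t))); split.
  by move=> i j; rewrite /dirx /= [i == j]eq_sym; congr (_ + _); ring.
move=> i j; rewrite /partial.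
have dN : is_derive x (delta_mx i ord0) (@enorm R) (dirx i (x, t)).
  have := is_derive_space (t := t) (Ckon_is_derive (delta_mx i ord0, 0) CN Az).
  rewrite (enorm_derive _ Az) (bigD1 i)//= big1 ?addr0 ?mxE ?eqxx ?mulr1// => k ki.
  by rewrite mxE (negbTE ki) mulr0.
have dg := is_derive_chain1 dN dG'.
have dx := is_derive_space (t := t) (@Ckon_is_derive _ _ _ 0 setT _ (delta_mx i ord0, 0) (x, t)
  (Ckon_coord 1 j openT) I).
rewrite coord_derive /= in dx.
have -> : (fun y => field p q ta sg b h y t j ord0) = (G \o @enorm R) * (fun y => y j ord0).
  by apply/funext => y; rewrite /field mxE gG.
have [_ ->] := is_deriveM dg dx.
by rewrite gG mxE andbT [j == i]eq_sym.
Qed.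

Lemma field_curl (x : 'cV[R]_3) t : curl (fun y => field p q ta sg b h y t) x = 0.
Proof.
have [P [sym PE]] := field_partial x t.
by apply/colP => k; rewrite !mxE !PE (sym (k + 1)) subrr.
Qed.

End field_regularity.

(** * The oscillator equation *)

Definition profile {R : realType} (p q h t : R) : R := expR h * sin (theta p q (h, t)).

Lemma theta_derive {R : realType} (p q h t : R) : 1 < p -> p < q ->
  is_derive t 1 (fun t => theta p q (h, t)) (slow p q (h, theta p q (h, t)))^-1.
Proof.
move=> p1 pq.
have := @is_derive_implicit R R (time p q) (pint (slow1 p q)) (slow p q) (fun=> h)
  (fun t => theta p q (h, t)) id t 1 0 1.
rewrite mulr0 subr0 mul1r; apply.
- by apply: near_all => z; exact: is_derive_time1.
- by apply: near_all => z; exact: is_derive_time2.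
- exact: (Ckon_cont (Ckon_pint_slow1 p1 pq) I).
- exact: (Ckon_cont (Ckon_slow p1 pq) I).
- apply: (@continuous_comp _ _ _ (fun t => (h, t)) (theta p q)); last exact: continuous_theta.
  by apply: continuous_pair; [exact: cvg_cst|exact: cvg_id].
- exact: lt0r_neq0 (slow_gt0 _ p1 pq).
- by apply: near_all => s; exact: (thetaP (h, s)).
Qed.

Lemma potX_slice {R : realType} (p q h x : R) : 1 < p -> p < q ->
  is_derive x 1 (fun x => potX p q 0 (h, x))
    ('D_1 (kap (p + 1)) (sin x) * cos x * expR ((p - 1) * h) +
     'D_1 (kap (q + 1)) (sin x) * cos x * expR ((q - 1) * h)).
Proof.
move=> p1 pq; have q1 := lt_trans p1 pq.
have K r : 1 < r -> is_derive x 1 (fun x => kap (r + 1) (sin x)) ('D_1 (kap (r + 1)) (sin x) * cos x).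
  move=> r1; apply: (is_derive_chain1 (is_derive_sin x)).
  by apply: (@Ckon_is_derive R R R 0 setT _ 1 _ _ I); apply: Ckon_kap; lra.
have -> : (fun x => potX p q 0 (h, x)) = (fun x => kap (p + 1) (sin x)) * cst (expR ((p - 1) * h)) +
    (fun x => kap (q + 1) (sin x)) * cst (expR ((q - 1) * h)).
  by apply/funext => y; rewrite /potX !expr0 !mul1r.
have D := is_deriveD (is_deriveM (K p p1) (is_derive_cst (expR ((p - 1) * h)) x 1))
  (is_deriveM (K q q1) (is_derive_cst (expR ((q - 1) * h)) x 1)).
apply: is_derive_eq D _; rewrite !scaler0 !add0r /GRing.scale /=.
by rewrite ![_ * expR _]mulrC.
Qed.

Lemma slow_slice {R : realType} (p q h x d : R) : 1 < p -> p < q ->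
  is_derive x 1 (fun x => potX p q 0 (h, x)) d ->
  is_derive x 1 (fun x => slow p q (h, x)) (- 2^-1 * (slow p q (h, x) ^+ 3 * d)).
Proof.
move=> p1 pq dP.
have aff (f : R * R -> R) e : is_derive (h, x) (dir2 R) f e <-> is_derive x 1 (fun x => f (h, x)) e.
  have E : (fun y : R => f (y *: dir2 R + (h, 0))) = (fun y => f (h, y)).
    by apply/funext => y; rewrite scale_pairD mulr1 mulr0 addr0 add0r.
  rewrite -E; have -> : (h, x) = x *: dir2 R + (h, 0).
    by rewrite scale_pairD mulr1 mulr0 addr0 add0r.
  exact: is_derive_line.
by apply/aff; apply: is_derive_slow => //; exact/aff.
Qed.

Lemma profile_derive {R : realType} (p q h t : R) : 1 < p -> p < q ->
  is_derive t 1 (profile p q h)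
    (expR h * (cos (theta p q (h, t)) / slow p q (h, theta p q (h, t)))).
Proof.
move=> p1 pq.
have D := is_derive_chain1 (theta_derive h t p1 pq) (is_derive_sin (theta p q (h, t))).
have -> : profile p q h = cst (expR h) * (sin \o (fun t => theta p q (h, t))) by [].
apply: is_derive_eq (is_deriveM (is_derive_cst (expR h) t 1) D) _.
by rewrite scaler0 addr0 /GRing.scale.
Qed.

(** Energy conservation differentiated back into an equation of motion: 1/slow^2 is 1 + [potX], and
    [kap_derive] turns [kap] and its derivative into the powers of |sin|. No division by cos occurs,
    so turning points are included. *)
Lemma profile_derive2 {R : realType} (p q h t : R) : 1 < p -> p < q ->
  is_derive t 1 (fun t => expR h * (cos (theta p q (h, t)) / slow p q (h, theta p q (h, t))))
    (- (profile p q h t + `|profile p q h t| `^ (p - 1) * profile p q h t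
        + `|profile p q h t| `^ (q - 1) * profile p q h t)).
Proof.
move=> p1 pq; have q1 := lt_trans p1 pq.
set x := theta p q (h, t).
have s0 : slow p q (h, x) != 0 by exact: lt0r_neq0 (slow_gt0 _ p1 pq).
have Ds := slow_slice p1 pq (potX_slice h x p1 pq).
have Di := @is_deriveV R (fun y => slow p q (h, y)) x _ 1 s0 Ds.
have Dc := is_deriveM (is_derive_cos x) Di.
have D := is_derive_chain1 (theta_derive h t p1 pq) Dc.
have -> : (fun t => expR h * (cos (theta p q (h, t)) / slow p q (h, theta p q (h, t)))) =
  cst (expR h) * ((cos * (fun y => (slow p q (h, y))^-1)) \o (fun t => theta p q (h, t))) by [].
apply: is_derive_eq (is_deriveM (is_derive_cst (expR h) t 1) D) _.
rewrite -/x scaler0 addr0 /GRing.scale /=.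
have nw r : `|profile p q h t| `^ (r - 1) = expR ((r - 1) * h) * `|sin x| `^ (r - 1).
  rewrite /profile normrM powRM// (ger0_norm (expR_ge0 _)) /powR (gt_eqF (expR_gt0 h)) expRK.
  by rewrite mulrC.
rewrite !nw {nw}.
(* [kap_derive] at sin(x), with 1 - sin^2 written as cos^2. *)
have k r : 1 < r -> `|sin x| `^ (r - 1) * sin x =
    sin x * kap (r + 1) (sin x) - cos x ^+ 2 * 'D_1 (kap (r + 1)) (sin x) / 2.
  move=> r1; have := @kap_derive R (r + 1) (sin x); rewrite (_ : r + 1 - 2 = r - 1); last by ring.
  by rewrite -(cos2sin2 x) => H; rewrite -[LHS]opprK -H; [ring|lra].
rewrite /profile -/x.
have Q := slow_sqr (h, x) p1 pq; rewrite /potX !expr0 !mul1r /= in Q.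
have {}Q : (slow p q (h, x))^-1 ^+ 2 = 1 + (kap (p + 1) (sin x) * expR ((p - 1) * h) +
    kap (q + 1) (sin x) * expR ((q - 1) * h)).
  by apply: (mulfI (expf_neq0 2 s0)); rewrite Q -exprMn divff// expr1n.
move: (k p p1) (k q q1) s0 Q.
move: ('D_1 (kap (p + 1)) (sin x)) ('D_1 (kap (q + 1)) (sin x)) (kap (p + 1) (sin x)) (kap (q + 1) (sin x)).
move: (`|sin x| `^ (p - 1)) (`|sin x| `^ (q - 1)) (expR ((p - 1) * h)) (expR ((q - 1) * h)).
move: (slow p q (h, x)) (sin x) (cos x) (expR h) => S s c e a1 a2 e1 e2 D1 D2 K1 K2 k1 k2 S0 Q.
(* The second derivative is exp(h) (cos (potX)'/2 - sin / slow^2), with the prime for d/dtheta; [Q]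
   then replaces 1/slow^2 by 1 + [potX]. *)
transitivity (e * (c * (D1 * c * e1 + D2 * c * e2) / 2 - s * S^-1 ^+ 2)); first by field.
rewrite Q.
have -> : e1 * a1 * (e * s) = e1 * e * (a1 * s) by ring.
have -> : e2 * a2 * (e * s) = e2 * e * (a2 * s) by ring.
by rewrite k1 k2; field.
Qed.

Lemma field_derive2 {R : realType} (p q : R) (ta sg b : 'cV[R]_3 -> R) (h : R -> R) x t :
  1 < p -> p < q ->
  let W := profile p q (h (enorm x)) (sg x * (t + b x)) in
  derive1n 2 (field p q ta sg b h x) t =
    (ta x / enorm x * (sg x ^+ 2 * - (W + `|W| `^ (p - 1) * W + `|W| `^ (q - 1) * W))) *: x.
Proof.
move=> p1 pq W; set k := ta x / enorm x; set H := h (enorm x).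
pose W1 s := expR H * (cos (theta p q (H, s)) / slow p q (H, theta p q (H, s))).
have lin (s : R) : is_derive s (1 : R) (fun s => sg x * (s + b x)) (sg x).
  have -> : (fun s => sg x * (s + b x)) = sg x *: (id + cst (b x)) by [].
  apply: is_derive_eq (is_deriveZ (sg x) (is_deriveD (is_derive_id s 1) (is_derive_cst (b x) s 1))) _.
  by rewrite addr0 /GRing.scale /= mulr1.
have fE : field p q ta sg b h x = fun s => (k * profile p q H (sg x * (s + b x))) *: x.
  by apply/funext => s; rewrite /field /gain /profile /phase /=; congr (_ *: _); rewrite mulrAC.
have D1 : (field p q ta sg b h x)^`()%classic = fun s => (k * (sg x * W1 (sg x * (s + b x)))) *: x.
  apply/funext => s; rewrite derive1E fE; apply: (@derive_val _ _ _ _ _ _ _ _).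
  apply: is_derive_scalel.
  apply: is_derive_eq (is_deriveZ k (is_derive_chain1 (lin s) (profile_derive H _ p1 pq))) _.
  by rewrite /GRing.scale /= [W1 _ * _]mulrC.
rewrite /derive1n /= D1 derive1E; apply: (@derive_val _ _ _ _ _ _ _ _).
apply: is_derive_scalel.
have D2 := is_deriveZ (k * sg x) (is_derive_chain1 (lin t) (profile_derive2 H (sg x * (t + b x)) p1 pq)).
have -> : (fun s => k * (sg x * W1 (sg x * (s + b x)))) =
    (k * sg x) *: (W1 \o (fun s => sg x * (s + b x))).
  by apply/funext => s; rewrite /= mulrA.
apply: is_derive_eq D2 _; rewrite -/W /GRing.scale /=.
by generalize (- (W + `|W| `^ (p - 1) * W + `|W| `^ (q - 1) * W)) k (sg x) => w c s; ring.
Qed.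

(** Away from 0, the three coefficient identities give all terms the common factor m tau / |x| times
    x, leaving the oscillator equation for [W]. At x = 0 every term is a multiple of the zero
    vector. *)
Lemma field_ode {R : realType} (p q r m vp vq : R) (ta sg b : 'cV[R]_3 -> R) (h : R -> R) x t :
  1 < p -> p < q -> 0 < ta x -> r * sg x ^+ 2 = m ->
  vp * ta x `^ (p - 1) = m -> vq * ta x `^ (q - 1) = m ->
  let u := field p q ta sg b h x in
  r *: derive1n 2 u t + m *: u t + (vp * enorm (u t) `^ (p - 1)) *: u t
    + (vq * enorm (u t) `^ (q - 1)) *: u t = 0.
Proof.
move=> p1 pq ta0 Er Ep Eq; 
move=> u; rewrite /u field_derive2//.
set W := profile _ _ _ _; set n := enorm x.
have fE : field p q ta sg b h x t = (ta x * W / n) *: x by [].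
have [->|x0] := eqVneq x 0; first by rewrite /field !scaler0 !addr0.
have n0 : 0 < n by rewrite /n enorm_gt0.
have eE s : enorm (field p q ta sg b h x t) `^ s = ta x `^ s * `|W| `^ s.
  rewrite fE enormZ -/n normrM normfV (gtr0_norm n0) divfK ?(lt0r_neq0 n0)//.
  by rewrite normrM (gtr0_norm ta0) powRM// ltW.
rewrite !eE fE !scalerA -!scalerDl; apply/eqP; rewrite scaler_eq0; apply/orP; left; apply/eqP.
rewrite !(mulrA vp) !(mulrA vq) Ep Eq -Er.
generalize (`|W| `^ (p - 1)) (`|W| `^ (q - 1)) (n^-1) W (sg x) (ta x) => *; ring.
Qed.

(** * The amplitude under the hypotheses of the theorem *)

Notation axis := (delta_mx 0 ord0 : 'cV[_]_3).

Lemma powR_expR {R : realType} (x a : R) : expR x `^ a = expR (a * x).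
Proof. by rewrite /powR (gt_eqF (expR_gt0 x)) expRK. Qed.

Lemma expR_surj {R : realType} (x : R) : 0 < x -> exists y, x = expR y.
Proof. by move=> x0; exists (ln x); rewrite lnK. Qed.

(** The identities for which [sigma], [tau] and the relation for [vp] are designed: scaling time by
    sigma and amplitude by tau gives all terms the same coefficient mu. Writing [m] and [vq] as
    exponentials makes the power identities linear in the exponents. *)
Lemma field_coefficients {R : realType} (p q r m vp vq : R) : 1 < q ->
  0 < r -> 0 < m -> 0 < vq -> vp = (m `^ (q - p) / vq `^ (1 - p)) `^ (q - 1)^-1 ->
  [/\ r * ((m / r) `^ 2^-1) ^+ 2 = m,
      vp * ((m / vq) `^ (q - 1)^-1) `^ (p - 1) = m
    & vq * ((m / vq) `^ (q - 1)^-1) `^ (q - 1) = m].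
Proof.
move=> q1 r0 /expR_surj[x ->] /expR_surj[y ->] ->.
have q0 : q - 1 != 0 by rewrite subr_eq0 gt_eqF.
split.
- rewrite powR12_sqrt ?divr_ge0 ?expR_ge0 ?(ltW r0)// sqr_sqrtr ?divr_ge0 ?expR_ge0 ?(ltW r0)//.
  by rewrite mulrC divfK// lt0r_neq0.
- rewrite !powR_expR -!expRN -!expRD !powR_expR -expRD; congr expR.
  by field.
- rewrite -!expRN -!expRD !powR_expR -expRD; congr expR.
  by field.
Qed.

Lemma Ck_div_powR {R : realType} (f g : 'cV[R]_3 -> R) k a :
  Ck k f -> Ck k g -> (forall x, 0 < f x) -> (forall x, 0 < g x) ->
  Ck k (fun x => (f x / g x) `^ a).
Proof.
move=> /Ckon_setT Cf /Ckon_setT Cg f0 g0; apply/Ckon_setT.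
have Ci := Ckon_inv openT (fun x _ => lt0r_neq0 (g0 x)) Cg.
apply: (@Ckon_comp1 R 'cV[R]_3 k setT [set x : R | 0 < x] (fun y => y `^ a) (fun x => f x / g x)
  openT (Ckon_powR k a) (Ckon_mul openT Cf Ci)).
by move=> x _; rewrite /= divr_gt0.
Qed.

(** The difference quotients on both sides coincide, so the equality holds between functions,
    default values included, and can be iterated for second derivatives. *)
Lemma derive_ray {R : realType} (U : 'cV[R]_3 -> R) :
  'D_1 (fun s : R => U (s *: axis)) = fun s => 'D_axis U (s *: axis).
Proof.
apply/funext => s.
have E : (fun h : R => h^-1 *: (((fun s : R => U (s *: axis)) \o shift s) (h *: (1 : R))
    - U (s *: axis))) = fun h => h^-1 *: ((U \o shift (s *: axis)) (h *: axis) - U (s *: axis)).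
  by apply/funext => h /=; rewrite scalerDl -scalerA scale1r.
exact: (congr1 (fun f => lim (f @ (0 : R)^')) E).
Qed.

Lemma cvg_ray {R : realType} (U : 'cV[R]_3 -> R) (l : R) :
  U x @[x --> (0 : 'cV[R]_3)^'] --> l -> U (s *: axis) @[s --> (0 : R)^'+] --> l.
Proof.
apply: cvg_comp => A A0.
have H : (fun s : R => s *: axis + 0) @ (0 : R)^'+ --> (0 : 'cV[R]_3).
  by apply: cvg_at_right_filter; exact: cvg_line.
have := H _ A0; apply: filterS2 (nbhs_right_gt 0) => s s0 /=; rewrite addr0; apply.
by rewrite -enorm_gt0 enormZ enorm_e1 mulr1 normr_gt0 gt_eqF.
Qed.

(* Where h <= 0 the decay of m controls expR h; where h > 0 the function m is
   bounded below, which confines s to a compact interval. *)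
Lemma amplitude_decay {R : realType} (p q g K : R) (m h : R -> R) : 1 < p -> p < q -> 0 < g ->
  continuous m -> (forall s, 0 < s -> 0 < m s < 1) -> m 0 < 1 ->
  (forall s, 0 < s -> per p q (h s) = 2 * pi * (1 - m s)) ->
  (forall s, 0 < s -> m s * expR (g * (q - 1) * s) <= K) ->
  exists B, forall s, 0 < s -> h s + g * s <= B.
Proof.
move=> p1 pq g0 cm m01 m0 hp HK.
have q0 : 0 < q - 1 by rewrite subr_gt0 (lt_trans p1).
have pi0 : 0 < 2 * pi :> R := pi2_gt0.
have K0 : 0 < K.
  have /andP[a _] := m01 1 ltr01; apply: lt_le_trans (HK 1 ltr01).
  by rewrite mulr_gt0// expR_gt0.
have leln (x y : R) : expR x <= y -> 0 < y -> x <= ln y.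
  by move=> xy y0; rewrite -ler_expR lnK.
(* The value of m at which the amplitude parameter h is 0; h > 0 means m > [c0]. *)
pose c0 := 1 - per p q 0 / (2 * pi).
have c00 : 0 < c0.
  by have /andP[_ l] := per_bounds 0 p1 pq; rewrite /c0 subr_gt0 ltr_pdivrMr// mul1r.
(* If m(s) > c0, the decay hypothesis gives exp(g (q-1) s) <= K / c0, hence s <= S0. *)
pose S0 := `|ln (K / c0) / (g * (q - 1))| + 1.
have S00 : 0 <= S0 by rewrite /S0 addr_ge0.
have c1 : {within `[0, S0], continuous m} by exact: continuous_subspaceT.
have [c cS cmax] := @EVT_max R m 0 S0 S00 c1.
have mc : m c < 1.
  move: cS; rewrite in_itv /= => /andP[]; rewrite le_eqVlt => /orP[/eqP <- //|c0' _].
  by have /andP[] := m01 c c0'.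
(* For h <= 0, exp((q-1) h) <= exp((p-1) h) <= 3 (p+1) m, and the decay of m bounds exp((q-1)(h + g
   s)). [B2] bounds h on the compact part, from [per_upper] and the maximum of m, which is below
   1. *)
pose B1 := ln (3 * (p + 1) * K) / (q - 1).
pose B2 := ln ((q + 1) / 2 / (1 - m c) ^+ 2) / (q - 1).
exists (Num.max B1 (B2 + g * S0)) => s s0; have /andP[ms0 ms1] := m01 s s0.
rewrite le_max; apply/orP; have [hs|hs] := leP (h s) 0.
  left; have [_ _ le] := per_cmp p1 pq hs; rewrite hp// in le.
  have l1 : expR ((p - 1) * h s) <= 3 * (p + 1) * m s.
    have p3 : 0 < 3 * (p + 1) by lra.
    move: le; rewrite (_ : 2 * pi - 2 * pi * (1 - m s) = 2 * pi * m s); last by ring.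
    rewrite -mulrA ler_pM2l// mulrC ler_pdivrMr// mulrC.
    by rewrite [m s * _]mulrC.
  have l2 : expR ((q - 1) * h s) <= expR ((p - 1) * h s).
    by rewrite ler_expR; nra.
  rewrite /B1 ler_pdivlMr//; apply: leln; last by rewrite !mulr_gt0//; lra.
  rewrite (_ : (h s + g * s) * (q - 1) = (q - 1) * h s + g * (q - 1) * s); last by ring.
  rewrite expRD; apply: le_trans (ler_wpM2r (expR_ge0 _) (le_trans l2 l1)) _.
  by rewrite -(mulrA _ (m s)) ler_pM2l ?HK//; lra.
right.
have mc0 : c0 < m s.
  have := per_lt p1 pq hs; rewrite hp// => l.
  by rewrite /c0 ltrBlDr -ltrBlDl ltr_pdivlMr// mulrC.
have sS : s <= S0.
  have l : expR (g * (q - 1) * s) <= K / c0.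
    rewrite ler_pdivlMr// mulrC; apply: le_trans (HK s s0).
    by rewrite ler_wpM2r ?expR_ge0// ltW.
  have := leln _ _ l (divr_gt0 K0 c00); rewrite mulrC -ler_pdivlMr ?mulr_gt0// => l'.
  apply: le_trans l' _; apply: le_trans (ler_norm _) _.
  by rewrite /S0 lerDl.
apply: lerD; last by rewrite ler_pM2l.
have ms : m s <= m c by apply: cmax; rewrite in_itv /= (ltW s0).
have u0 : 0 < 1 - m c by rewrite subr_gt0.
rewrite /B2 ler_pdivlMr//; apply: leln; last first.
  by rewrite !divr_gt0 ?exprn_gt0//; lra.
have := per_upper (h s) p1 pq; rewrite hp// exprMn ler_pM2l ?exprn_gt0// expRN => l.
have E0 := expR_gt0 ((q - 1) * h s).
rewrite ler_pdivlMr ?exprn_gt0// mulrC [h s * _]mulrC.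
have {}l : (1 - m s) ^+ 2 * expR ((q - 1) * h s) <= (q + 1) / 2.
  by rewrite -ler_pdivlMr.
apply: le_trans l; rewrite ler_wpM2r ?(ltW E0)// lerXn2r ?nnegrE ?subr_ge0 ?(ltW ms1) ?(ltW mc)//.
by rewrite lerD2l lerN2.
Qed.

(** Restriction to the ray through the first basis vector turns the hypotheses on sigma into
    one-variable statements about 1 - sigma(0) sigma, to which the existence, asymptotics and decay
    of the amplitude apply. *)
Lemma amplitude {R : realType} (p q g K : R) (sg : 'cV[R]_3 -> R) : 1 < p -> p < q -> 0 < g ->
  Ck 2 sg -> (forall x, 0 < sg x) ->
  (forall x, x != 0 -> sg 0 * sg x < 1) ->
  C2_vanishes_at0 (fun x => `|1 - sg 0 * sg x| `^ (q - 1)^-1) ->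
  (forall x, `|1 - sg 0 * sg x| * expR (g * (q - 1) * enorm x) <= K) ->
  sg 0 = 1 /\ exists h : R -> R, [/\ Ckon 2 [set s : R | 0 < s] h,
    forall e, 0 < e -> \forall s \near 0^'+, [/\ h s <= 0, expR (h s) * 'D_1 h s ^+ 2 <= e,
      expR (h s) * `|'D_1 ('D_1 h) s| <= e & expR (h s) <= e * s ^+ 2],
    forall s, 0 < s -> per p q (h s) = 2 * pi * sg (s *: axis)
    & exists B, forall s, 0 < s -> h s + g * s <= B].
Proof.
move=> p1 pq g0 Csg sg0 H1 [U0 U1 U2] H3.
have q0 : 0 < q - 1 by rewrite subr_gt0 (lt_trans p1).
pose m (s : R) := 1 - sg 0 * sg (s *: axis).
have Cm : Ckon 2 setT m.
  have Cr : Ckon 2 setT (fun s : R => sg (s *: axis)).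
    have cr : continuous (fun s : R => s *: (axis : 'cV[R]_3)).
      by move=> s; apply: cvgZr_tmp; exact: cvg_id.
    apply: (@Ckon_affine R R 'cV[R]_3 R 2 setT sg (fun s => s *: axis) (fun s => s *: axis) openT cr).
      by move=> u h z; rewrite scalerDl scalerA.
    exact/Ckon_setT.
  exact: (Ckon_sub_fun openT (Ckon_cst _ _ (1 : R)) (Ckon_mul openT (Ckon_cst _ _ (sg 0)) Cr)).
have cm : continuous m by move=> s; exact: (Ckon_cont Cm I).
have e1n0 s : 0 < s -> s *: (axis : 'cV[R]_3) != 0.
  by move=> s0; rewrite -enorm_gt0 enormZ enorm_e1 mulr1 normr_gt0 gt_eqF.
have m01 s : 0 < s -> 0 < m s < 1.
  by move=> s0; rewrite /m subr_gt0 H1 ?e1n0//= gtrBl mulr_gt0.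
have pos : \forall s \near (0 : R)^'+, 0 < s by exact: nbhs_right_gt.
(* The power q - 1 undoes the power 1/(q-1) in the hypothesis. By continuity m(0) = 1 - sigma(0)^2
   is then 0. *)
have m0 : m s @[s --> 0^'+] --> (0 : R).
  have c0 := cvg_ray U0.
  have P := cvg_comp _ _ c0 (normr_powR_cvg0 q0).
  apply: (cvg_near_eq _ P); apply: filterS pos => s /m01/andP[ms _] /=.
  rewrite -/(m s) (ger0_norm (powR_ge0 _ _)) -powRrM mulVf ?lt0r_neq0// powRr1 ?normr_ge0//.
  by rewrite gtr0_norm.
have m00 : m 0 = 0.
  have c : m s @[s --> 0^'+] --> m 0 by apply: cvg_at_right_filter; exact: cm.
  exact: (cvg_unique _ c m0).
have s1 : sg 0 = 1.
  move: m00; rewrite /m scale0r => /eqP; rewrite subr_eq0 -expr2 => /eqP /esym/eqP.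
  by rewrite sqrp_eq1 ?(ltW (sg0 0))// => /eqP.
split=> //.
have mE s : m s = `|m s|.
  have [->|s0] := eqVneq s 0; first by rewrite m00 normr0.
  rewrite ger0_norm// ltW// /m subr_gt0 H1// -enorm_gt0 enormZ enorm_e1 mulr1 normr_gt0//.
pose U (x : 'cV[R]_3) := `|1 - sg 0 * sg x| `^ (q - 1)^-1.
have UE : (fun s : R => m s `^ (q - 1)^-1) = (fun s => U (s *: axis)).
  by apply/funext => s; rewrite /U -/(m s) {1}mE.
have Cmp := Ckon_sub (@subsetT _ [set s : R | 0 < s]) Cm.
have [h [Ch hp]] := amplitude_exists p1 pq Cmp m01.
exists h; split=> [//||s s0|].
- apply: (amplitude_asymp p1 pq Cmp Ch m01 hp m0); rewrite UE.
  + exact: cvg_ray U0.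
  + rewrite (derive_ray U); exact: cvg_ray (U1 0).2.
  + rewrite (derive_ray U) (derive_ray (partial 0 U)); exact: cvg_ray (U2 0 0).2.
- by rewrite hp// /m s1 mul1r opprB addrCA subrr addr0.
- apply: (amplitude_decay (K := K) p1 pq g0 cm m01 _ hp); first by rewrite m00.
  move=> s s0; have := H3 (s *: axis).
  by rewrite -/(m s) -mE enormZ enorm_e1 mulr1 gtr0_norm.
Qed.

(** * The breather *)

Lemma field_shift {R : realType} (p q : R) (ta sg b : 'cV[R]_3 -> R) (h : R -> R) :
  phase_shift (field p q ta sg (fun=> 0) h) b = field p q ta sg b h.
Proof.
by apply/funext => x; apply/funext => t; rewrite /phase_shift /field /gain /phase /= addr0.
Qed.

Lemma field_at0 {R : realType} (p q : R) (ta sg b : 'cV[R]_3 -> R) (h : R -> R) t :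
  field p q ta sg b h 0 t = 0.
Proof. exact: scaler0. Qed.

Lemma enorm_field {R : realType} (p q : R) (ta sg b : 'cV[R]_3 -> R) (h : R -> R) x t :
  0 < ta x -> x != 0 -> enorm (field p q ta sg b h x t) <= ta x * expR (h (enorm x)).
Proof.
rewrite -enorm_gt0 => ta0 x0; rewrite /field /gain /= enormZ normrM normfV (gtr0_norm x0).
rewrite divfK ?lt0r_neq0// normrM (gtr0_norm ta0) ler_pM2l// normrM (gtr0_norm (expR_gt0 _)).
by rewrite ler_piMr ?expR_ge0 ?norm_sin_le1.
Qed.

(** When t grows by 2 pi, the argument sg x (t + b x) grows by exactly one period of the orbit at
    radius |x|, so the angle gains 2 pi. *)
Lemma field_periodic {R : realType} (p q : R) (ta sg b : 'cV[R]_3 -> R) (h : R -> R) x :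
  1 < p -> p < q -> (x != 0 -> per p q (h (enorm x)) = 2 * pi * sg x) ->
  periodic (field p q ta sg b h x) (2 * pi).
Proof.
move=> p1 pq hp t; have [->|/hp{}hp] := eqVneq x 0; first by rewrite !field_at0.
rewrite /field /gain /phase /=.
rewrite (_ : sg x * (t + 2 * pi + b x) = sg x * (t + b x) + per p q (h (enorm x))); last first.
  by rewrite hp; ring.
by rewrite theta_2pi// (_ : 2 * pi = pi *+ 2) ?sinD2pi// mulr_natl.
Qed.

Lemma curl_cst {R : realType} (v x : 'cV[R]_3) : curl (fun=> v) x = 0.
Proof. by apply/colP => k; rewrite !mxE /partial !derive_cst subrr. Qed.

Theorem theorem4p1 (R : realType) (p q gamma : R)
    (M : 'cV[R]_3 -> 'M[R]_3) (rho mu vp vq : 'cV[R]_3 -> R)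
    (lt1p : 1 < p) (ltpq : p < q)
    (rho_gt0 : forall x, 0 < rho x) (mu_gt0 : forall x, 0 < mu x)
    (vp_gt0 : forall x, 0 < vp x) (vq_gt0 : forall x, 0 < vq x)
    (rho_radial : radial rho) (mu_radial : radial mu)
    (vp_radial : radial vp) (vq_radial : radial vq)
    (rho_C2 : Ck 2 rho) (mu_C2 : Ck 2 mu) (vp_C2 : Ck 2 vp) (vq_C2 : Ck 2 vq)
    (vpE : forall x,
      vp x = (mu x `^ (q - p) / vq x `^ (1 - p)) `^ (q - 1)^-1)
    (H1 : forall x, x != 0 -> sigma rho mu 0 * sigma rho mu x < 1)
    (H2 : C2_vanishes_at0
      (fun x => `|1 - sigma rho mu 0 * sigma rho mu x| `^ (q - 1)^-1))
    (gamma_gt0 : 0 < gamma)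
    (H3 : has_ubound (range (fun x =>
      `|1 - sigma rho mu 0 * sigma rho mu x|
        * expR (gamma * (q - 1) * enorm x))))
    (H4 : has_ubound (range (tau q mu vq))) :
  let T := 2 * pi * sigma rho mu 0 in
  exists u : 'cV[R]_3 -> R -> 'cV[R]_3,
    [/\ breather T p q M rho mu vp vq u,
        exp_localized gamma u,
        forall b : 'cV[R]_3 -> R, radial b -> Ck 2 b ->
          breather T p q M rho mu vp vq (phase_shift u b)
      & continuum_of_shifts u].
Proof.
move=> T; have q1 : 1 < q by exact: lt_trans ltpq.
have [K HK] := H3; have [N HN] := H4.
set ta := tau q mu vq in H4 HN *; set sg := sigma rho mu in T H1 H2 H3 HK *.
have Cta : Ck 2 ta by exact: Ck_div_powR.
have Csg : Ck 2 sg by exact: Ck_div_powR.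
have ta0 x : 0 < ta x by rewrite powR_gt0 ?divr_gt0.
have sg0 x : 0 < sg x by rewrite powR_gt0 ?divr_gt0.
have ta_radial : radial ta by move=> x y xy; rewrite /ta /tau (mu_radial x y)// (vq_radial x y).
have sg_radial : radial sg by move=> x y xy; rewrite /sg /sigma (mu_radial x y)// (rho_radial x y).
have [sg1 [h [Ch Hh hp [B HB]]]] := amplitude lt1p ltpq gamma_gt0 Csg sg0 H1 H2
  (fun x => HK _ (ex_intro2 _ _ x I erefl)).
have taN x : ta x <= N by apply: HN; exists x.
have loc b : exp_localized gamma (field p q ta sg b h).
  (* (H4) bounds tau by [N], and exp(h(|x|) + gamma |x|) is at most exp([B]). *)
  exists (N * expR B) => _ [[x t] _ <-] /=.
  have [->|x0] := eqVneq x 0.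
    rewrite field_at0 enorm0 mul0r mulr_ge0 ?expR_ge0//.
    exact: le_trans (ltW (ta0 0)) (taN 0).
  apply: le_trans (ler_wpM2r (expR_ge0 _) (enorm_field p q sg b h t (ta0 x) x0)) _.
  rewrite -mulrA -expRD; apply: ler_pM; [exact: (ltW (ta0 x))|exact: expR_ge0|exact: taN|].
  by rewrite ler_expR; apply: HB; rewrite enorm_gt0.
have br b : radial b -> Ck 2 b -> breather T p q M rho mu vp vq (field p q ta sg b h).
  move=> b_radial Cb.
  have c0 t : (fun x => M x *m curl (fun y => field p q ta sg b h y t) x) = fun=> 0.
    apply/funext => x.
    by rewrite (field_curl lt1p ltpq Cta Csg Cb Ch Hh ta_radial sg_radial b_radial) mulmx0.
  split; last by exists gamma; [exact: gamma_gt0|exact: loc].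
    split.
    - exact: (Ck_field lt1p ltpq Cta Csg Cb Ch Hh).
    - by move=> t; rewrite c0; apply/Ckon_setT; exact: Ckon_cst.
    - move=> x t; rewrite c0 curl_cst addr0.
      have [Er Ep Eq] := field_coefficients q1 (rho_gt0 x) (mu_gt0 x) (vq_gt0 x) (vpE x).
      exact: (@field_ode R p q (rho x) (mu x) (vp x) (vq x) ta sg b h x t lt1p ltpq (ta0 x) Er Ep Eq).
  move=> x; rewrite /T sg1 mulr1; apply: field_periodic => // x0.
  rewrite hp ?enorm_gt0//; congr (_ * _); apply: sg_radial.
  by rewrite enormZ enorm_e1 mulr1 ger0_norm ?enorm_ge0.
have cst_radial (c : R) : radial (fun _ : 'cV[R]_3 => c) by [].
have cst_Ck (c : R) : Ck 2 (fun _ : 'cV[R]_3 => c) by apply/Ckon_setT; exact: Ckon_cst.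
exists (field p q ta sg (fun=> 0) h); split.
- exact: (br _ (cst_radial 0) (cst_Ck 0)).
- exact: loc.
- by move=> b b_radial Cb; rewrite field_shift; exact: (br b b_radial Cb).
(* Shifts constant in x, chosen so that at t = 0 and the first unit vector the angle is atan(s):
   dividing by sigma there undoes the clock factor. The values sin(atan(s)) separate the shifts, sin
   being injective between -pi/2 and pi/2. *)
exists (fun s _ => (sg axis)^-1 * time p q (h 1, atan s)); split.
  by move=> s; split; [exact: cst_radial|exact: cst_Ck].
have ev s : phase_shift (field p q ta sg (fun=> 0) h)
    (fun=> (sg axis)^-1 * time p q (h 1, atan s)) axis 0 0 ord0 =
    ta axis * expR (h 1) * sin (atan s).
  rewrite field_shift /field /gain /phase !mxE /= enorm_e1 add0r mulVKf ?lt0r_neq0//.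
  by rewrite (theta_eq lt1p ltpq erefl) divr1 mulr1 mulrA.
move=> s s' E0; have E1 := congr1 (fun f : 'cV[R]_3 -> R -> 'cV[R]_3 => f axis 0 0 ord0) E0.
have E := mulfI (lt0r_neq0 (mulr_gt0 (ta0 axis) (expR_gt0 (h 1))))
  (etrans (esym (ev s)) (etrans E1 (ev s'))).
apply: (can_inj (@atanK R)); apply: sin_inj E.
  by rewrite in_itv /= !ltW ?atan_gtNpi2 ?atan_ltpi2.
by rewrite in_itv /= !ltW ?atan_gtNpi2 ?atan_ltpi2.
Qed.
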